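(* Let $F$ be a graph belonging to one of the following families: (1) bipartite graphs and their complements (including trees); (2) graphs with minimum rank at most three and their complements; (3) joins $G\vee H$ and disjoint unions $G\cup H$ of two graphs $G$ and $H$ such that the numbers of vertices of $G$ and $H$ differ by at most $2$. Then the inequality $q(F)+q(F^c)\le |F|+2$ holds if and only if $F$ is not one of the four graphs $P_4$, $P_5$, $P_5^c$ and $T_{2,2}$.
   Context: All graphs are finite, undirected and simple; isomorphic graphs are identified; $|G|$ is the number of vertices of $G$, and $G^c$ is the complement of $G$. For a graph $G$ with vertex set $\{1,\dots,n\}$, $S(G)$ is the set of all real symmetric $n\times n$ matrices $A=(a_{ij})$ such that for $i\ne j$, $a_{ij}\neq 0$ if and only if $\{i,j\}$ is an edge of $G$ (no restriction on the diagonal). $q(A)$ is the number of distinct eigenvalues of $A$, and $q(G)=\min\{q(A): A\in S(G)\}$. The minimum rank of $G$ is $\min\{\operatorname{rank}(A): A\in S(G)\}$. The join $G\vee H$ is the disjoint union $G\cup H$ together with all possible edges joining vertices of $G$ to vertices of $H$. $P_n$ is the path on $n$ vertices. $T_{2,2}$ is the graph on $5$ vertices obtained from the path with vertices $1,2,3,4,5$ in order by adding the edge $\{2,4\}$. *)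

(* Defs.v *)
From HB Require Import structures.
From mathcomp Require Import all_boot all_order all_algebra.
From mathcomp Require Import finmap all_classical reals.

Set Implicit Arguments.
Unset Strict Implicit.
Unset Printing Implicit Defensive.

Import Order.TTheory GRing.Theory Num.Theory.

Record sgraph (n : nat) := SGraph {
  edge :> rel 'I_n;
  edge_sym : symmetric edge;
  edge_irr : irreflexive edge
}.

(* "F is P_4", "F is a join", etc. are always meant up to isomorphism. *)
Definition isog m n (G : sgraph m) (H : sgraph n) : Prop :=
  exists2 f : 'I_m -> 'I_n, bijective f & forall i j, H (f i) (f j) = G i j.

Section Complement.
Variables (n : nat) (G : sgraph n).

Definition compl_rel : rel 'I_n := fun i j => (i != j) && ~~ G i j.

Lemma compl_sym : symmetric compl_rel.
Proof. by move=> i j; rewrite /compl_rel eq_sym edge_sym. Qed.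

Lemma compl_irr : irreflexive compl_rel.
Proof. by move=> i; rewrite /compl_rel eqxx. Qed.

Definition compl : sgraph n := SGraph compl_sym compl_irr.
End Complement.

Section Sums.
Variables (m n : nat) (G : sgraph m) (H : sgraph n).

(* The first m elements of 'I_(m + n) carry G, the last n carry H; the
   parameter b tells whether the two parts are completely joined. *)
Definition sum_rel (b : bool) : rel 'I_(m + n) := fun i j =>
  match fintype.split i, fintype.split j with
  | inl i', inl j' => G i' j'
  | inr i', inr j' => H i' j'
  | _, _ => b
  end.

Lemma sum_sym b : symmetric (sum_rel b).
Proof.
by move=> i j; rewrite /sum_rel; case: (fintype.split i) (fintype.split j) => i' [] j' //;
  rewrite edge_sym.
Qed.

Lemma sum_irr b : irreflexive (sum_rel b).
Proof. by move=> i; rewrite /sum_rel; case: (fintype.split i) => i'; rewrite edge_irr. Qed.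

Definition gunion : sgraph (m + n) := SGraph (sum_sym false) (sum_irr false).
Definition gjoin : sgraph (m + n) := SGraph (sum_sym true) (sum_irr true).
End Sums.

Definition path_rel n : rel 'I_n := fun i j => (i.+1 == j) || (j.+1 == i).

Lemma path_sym n : symmetric (@path_rel n).
Proof. by move=> i j; rewrite /path_rel orbC. Qed.

Lemma path_irr n : irreflexive (@path_rel n).
Proof. by move=> i; rewrite /path_rel orbb gtn_eqF. Qed.

Definition pathg n : sgraph n := SGraph (@path_sym n) (@path_irr n).

(* Vertices are numbered from 0, so the chord {2,4} becomes {1,3}. *)
Definition T22_rel : rel 'I_5 := fun i j =>
  pathg 5 i j || ((val i, val j) \in [:: (1, 3); (3, 1)]).

Lemma T22_sym : symmetric T22_rel.
Proof.
by move=> i j; rewrite /T22_rel edge_sym !inE !xpair_eqE orbC [in RHS]orbC;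
  congr (_ || _); rewrite orbC; congr (_ || _); rewrite andbC.
Qed.

Lemma T22_irr : irreflexive T22_rel.
Proof. by move=> i; rewrite /T22_rel edge_irr; case: i => -[|[|[|[|]]]]. Qed.

Definition T22 : sgraph 5 := SGraph T22_sym T22_irr.

Definition bipartite n (G : sgraph n) : Prop :=
  exists c : 'I_n -> bool, forall i j, G i j -> c i != c j.

Section MatricesOfGraph.
Variable R : realType.
Local Open Scope ring_scope.

Definition matrix_of n (G : sgraph n) (A : 'M[R]_n) : Prop :=
  A^T = A /\ forall i j, i != j -> (A i j != 0) = G i j.

Lemma finite_eigenvalues n (A : 'M[R]_n) :
  finite_set [set a : R | eigenvalue A a]%classic.
Proof.
apply: contrapT => /(@infinite_set_fset _ _ n.+1) [B BA].
apply/negP; rewrite -ltnNge.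
have A0 : char_poly A != 0 by rewrite monic_neq0 // char_poly_monic.
have := max_poly_roots A0 _ (fset_uniq B).
rewrite size_char_poly; apply; apply/allP => a aB.
by rewrite -eigenvalue_root_char; apply: BA.
Qed.

(* fset_set is the intended set here by finite_eigenvalues. Eigenvalues are
   sought in R only, which is no restriction for symmetric matrices. *)
Definition q_mx n (A : 'M[R]_n) : nat :=
  #|` fset_set [set a : R | eigenvalue A a]%classic |.

Lemma matrix_of_ex n (G : sgraph n) : exists A : 'M[R]_n, matrix_of G A.
Proof.
exists (\matrix_(i, j) (G i j)%:R); split=> [|i j _].
  by apply/matrixP=> i j; rewrite !mxE edge_sym.
by rewrite mxE pnatr_eq0; case: (G i j).
Qed.

Section MinOver.
Variables (n : nat) (G : sgraph n) (f : 'M[R]_n -> nat).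

Definition attained (k : nat) : bool :=
  `[< exists2 A, matrix_of G A & f A = k >].

Lemma attained_ex : exists k, attained k.
Proof. by have [A GA] := matrix_of_ex G; exists (f A); apply/asboolP; exists A. Qed.

Definition min_over : nat := ex_minn attained_ex.
End MinOver.

Definition q n (G : sgraph n) : nat := min_over G (@q_mx n).

Definition min_rank n (G : sgraph n) : nat := min_over G (fun A => \rank A).

(* Trees need no separate clause, being bipartite. *)
Definition in_families n (F : sgraph n) : Prop :=
  [\/ bipartite F \/ bipartite (compl F),
      (min_rank F <= 3)%N \/ (min_rank (compl F) <= 3)%N
    | exists m k (G : sgraph m) (H : sgraph k),
        [/\ (m <= k + 2)%N, (k <= m + 2)%N &
            isog F (gjoin G H) \/ isog F (gunion G H)]].

End MatricesOfGraph.

(* Main.v *)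
Require Import Defs.
From HB Require Import structures.
From mathcomp Require Import all_boot all_order all_algebra.
From mathcomp Require Import perm finmap all_classical reals interval_inference.
From mathcomp Require Import topology normedtype sequences trigo.
From mathcomp Require Import sesquilinear spectral complex.
From mathcomp Require Import ring lra zify.

Set Implicit Arguments.
Unset Strict Implicit.
Unset Printing Implicit Defensive.

Import Order.TTheory GRing.Theory Num.Theory.
Import numFieldNormedType.Exports.

(** Lower bounds. If two vertices are joined by a unique shortest path, of length d, then
    for every matrix A in S(G) the corresponding entry of A^s vanishes for s < d and
    not for s = d. As a symmetric A is annihilated by the product of the t - a over
    its eigenvalues a, it has more than d of them ([geodesic_q_gt]). Applied to the
    four exceptional graphs and their complements, this shows that the inequality
    fails for them.

    Upper bounds. For all other graphs in the families one needs matrices with few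
    distinct eigenvalues, and there are two sources of them.

    The first is a perturbation theorem ([strong_property_perturb]). If a matrix of a
    subgraph has multiple eigenvalues which satisfy a transversality condition, then
    it can be deformed into a matrix of the whole graph in which their multiplicities
    do not decrease. Each double eigenvalue makes q drop by one. In this way a claw
    or a triangle gives q <= n - 1; a cycle of length at least 4, two disjoint
    triangles, or a triangle with two more edges at one vertex give q <= n - 2.
    Moreover every graph has a matrix with spectrum 0, -1, ..., 1 - n.

    The second consists of explicit matrices. For the third family, two matrices with
    such spectra are put side by side (union), or glued along positive kernel vectors
    (join), which creates only two new eigenvalues ([union_join_q]). For the
    complement of a bipartite graph one starts from a symmetric matrix of square 1,
    which is built from the normalised adjacency matrix W of the bipartite complement
    and a nonnegative matrix K with (1 - K)^2 = 1 - e^2 W^2, and corrects it on a space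
    of dimension at most 4: this gives q <= 2, 3 or 4, according to the number of
    colour classes which contain a vertex joined to the whole other class
    ([co_bipartite_matrix]).

    Bipartite F ([bipartite_bound]). Given these bounds for the complement, F has to
    save one or two eigenvalues, and does so if it has a claw or a 4-cycle. What
    remains is a disconnected graph, a double star, P_4 or P_5.

    Minimum rank at most three ([non_bipartite_bound]). Then q(F) <= 4, so it suffices
    that the complement H has q(H) <= n - 2. If H is not bipartite it has a cycle, and
    one may assume that the only one is a triangle, each of whose vertices has at
    most one outer neighbour. Up to five vertices this leaves T_{2,2}. From six
    vertices on, H is a triangle with trees attached; then F has an orthogonal
    representation by vectors of R^3, whose Gram matrix can be scaled to have three
    distinct eigenvalues, while the triangle gives q(H) <= n - 1
    ([representation_q]). *)

(** * Local surjectivity of quadratic maps *)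

Section QuadraticMaps.
Variable R : realType.
Local Open Scope ring_scope.

Lemma entry_le_norm m n (A : 'M[R]_(m, n)) i j : `|A i j| <= `|A|.
Proof.
rewrite [leRHS]/Num.norm /= mx_normrE.
by apply/bigmax_geP; right; exists (i, j).
Qed.

Lemma linear_bounded m n (f : {linear 'rV[R]_m -> 'rV[R]_n}) :
  exists2 c : R, 0 < c & forall v, `|f v| <= c * `|v|.
Proof.
exists (1 + \sum_j `|f (delta_mx 0 j)|).
  by rewrite ltr_wpDr // sumr_ge0.
move=> v; rewrite {1}(row_sum_delta v) linear_sum.
apply: le_trans (ler_norm_sum _ _ _) _.
rewrite mulrDl mul1r mulr_suml ler_wpDl //.
by apply: ler_sum => j _; rewrite linearZ normrZ mulrC ler_wpM2l // entry_le_norm.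
Qed.

Lemma bilinear_bounded m n (b : 'rV[R]_m -> 'rV[R]_m -> 'rV[R]_n) :
  (forall u, linear (b u)) -> (forall v, linear (b^~ v)) ->
  exists2 c : R, 0 < c & forall u v, `|b u v| <= c * `|u| * `|v|.
Proof.
move=> linr linl.
have H u : exists c : R, 0 < c /\ forall v, `|b u v| <= c * `|v|.
  have [f fE] : exists f : {linear 'rV[R]_m -> 'rV[R]_n}, forall v, f v = b u v.
    pose f0 := GRing.isLinear.Build R _ _ _ (b u) (linr u).
    by exists (HB.pack (b u) f0 : {linear _ -> _}).
  have [c c0 fc] := linear_bounded f.
  by exists c; split => // v; rewrite -fE.
pose c u := sval (cid (H u)).
have cP u : 0 < c u /\ forall v, `|b u v| <= c u * `|v| := svalP (cid (H u)).
exists (1 + \sum_j c (delta_mx 0 j)).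
  by rewrite ltr_wpDr // sumr_ge0 // => j _; have [/ltW] := cP (delta_mx 0 j).
move=> u v.
have -> : b u v = \sum_j u 0 j *: b (delta_mx 0 j) v.
  have [f fE] : exists f : {linear 'rV[R]_m -> 'rV[R]_n}, forall u, f u = b u v.
    pose f0 := GRing.isLinear.Build R _ _ _ (b^~ v) (linl v).
    by exists (HB.pack (b^~ v) f0 : {linear _ -> _}).
  rewrite -fE {1}(row_sum_delta u) linear_sum.
  by apply: eq_bigr => j _; rewrite linearZ fE.
apply: le_trans (ler_norm_sum _ _ _) _.
rewrite -mulrA mulrDl mul1r mulr_suml ler_wpDl ?mulr_ge0 //.
apply: ler_sum => j _; rewrite normrZ mulrCA ler_pM ?entry_le_norm //.
by case: (cP (delta_mx 0 j)).
Qed.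

(** The contraction principle below takes place in a complete normed module. *)
HB.instance Definition _ m n :=
  Uniform_isComplete.Build 'M[R]_(m, n) (@cauchy_cvg _).

(** A linear surjection stays locally onto under a quadratic perturbation. With
    P a right inverse of L, a fixed point h of h |-> (y - b(h,h)) P solves h L +
    b(h,h) = y, and this map is a contraction of a small ball, because b is
    bounded: its Lipschitz constant there is proportional to the radius. *)
Lemma quadratic_local_surj m n (L : 'M[R]_(m, n))
    (b : 'rV[R]_m -> 'rV[R]_m -> 'rV[R]_n) :
  (forall u, linear (b u)) -> (forall v, linear (b^~ v)) -> row_full L ->
  forall delta : R, 0 < delta -> exists2 eta : R, 0 < eta &
    forall y, `|y| <= eta -> exists2 h, `|h| <= delta & h *m L + b h h = y.
Proof.
move=> linr linl fullL delta d0.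
have [c c0 bc] := bilinear_bounded linr linl.
pose P := pinvmx L.
have PL y : y *m P *m L = y by rewrite mulmxKpV // submx_full.
have [k k0 Pk] := linear_bounded (mulmxr P : {linear 'rV[R]_n -> 'rV[R]_m}).
(* on the ball of radius r the map has Lipschitz constant 2 c k r <= 1/2 *)
pose r := Num.min delta (4 * (c * k))^-1.
have ck0 : 0 < c * k by rewrite mulr_gt0.
have r0 : 0 < r by rewrite lt_min d0 invr_gt0 mulr_gt0.
have rck : c * k * r <= 4^-1.
  by rewrite -ler_pdivlMl // -invfM [c * k * 4]mulrC ge_min lexx orbT.
exists (r / (2 * k)); first by rewrite divr_gt0 // mulr_gt0.
move=> y yr.
pose Phi h := (y - b h h) *m P.
pose U := [set h : 'rV[R]_m | `|h| <= r]%classic.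
have bbE u v : b u u - b v v = b (u - v) u + b v (u - v).
  have bl a a' w : b (a - a') w = b a w - b a' w.
    by rewrite [in LHS]addrC -scaleN1r linl scaleN1r addrC.
  have br w a a' : b w (a - a') = b w a - b w a'.
    by rewrite [in LHS]addrC -scaleN1r linr scaleN1r addrC.
  by rewrite bl br addrA subrK.
have PhiU : set_fun U U Phi.
  move=> h /= hr; rewrite /U /= /Phi.
  apply: le_trans (Pk _) _.
  have H1 : `|y - b h h| <= r / (2 * k) + c * r * r.
    apply: le_trans (ler_normB _ _) _; rewrite lerD //.
    apply: le_trans (bc _ _) _.
    by rewrite -!mulrA ler_pM2l // ler_pM.
  apply: le_trans (ler_wpM2l (ltW k0) H1) _.
  have -> : k * (r / (2 * k) + c * r * r) = r / 2 + (c * k * r) * r.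
    by field; rewrite gt_eqF.
  have : c * k * r * r <= 4^-1 * r by rewrite ler_pM2r.
  lra.
pose F0 := isFun.Build _ _ U U Phi PhiU.
pose F : {fun U >-> U}%classic := HB.pack Phi F0.
have half0 : 0 <= 2^-1 :> R by rewrite invr_ge0.
have ctr : is_contraction F.
  exists (NngNum half0); split => /=; first by rewrite invf_lt1 // ltr1n.
  move=> [u v] /= [ur vr]; rewrite /U /= in ur vr.
  rewrite /Phi -mulmxBl.
  have -> : y - b u u - (y - b v v) = - (b u u - b v v).
    by apply/rowP => j; rewrite !mxE; ring.
  apply: le_trans (Pk _) _; rewrite normrN bbE.
  have H1 : `|b (u - v) u + b v (u - v)| <= (c * r *+ 2) * `|u - v|.
    apply: le_trans (ler_normD _ _) _; rewrite mulrnAl mulr2n lerD //.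
      apply: le_trans (bc _ _) _.
      by rewrite mulrAC ler_wpM2r // ler_pM2l.
    apply: le_trans (bc _ _) _.
    by rewrite ler_wpM2r // ler_pM2l.
  apply: le_trans (ler_wpM2l (ltW k0) H1) _.
  rewrite mulrA ler_wpM2r //.
  have -> : k * (c * r *+ 2) = (c * k * r) * 2 by rewrite -mulr_natr; ring.
  have : c * k * r * 2 <= 4^-1 * 2 by rewrite ler_pM2r.
  lra.
have clU : closed U.
  have -> : U = ((fun h : 'rV[R]_m => `|h|) @^-1` [set x | x <= r])%classic by [].
  apply: closed_comp; last exact: closed_le.
  by move=> h _; exact: norm_continuous.
have [|h Uh hE] := banach_fixed_point ctr clU.
  by exists 0; rewrite /U /= normr0 ltW.
exists h; first by apply: le_trans Uh _; rewrite ge_min lexx.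
by rewrite {1}hE /= /Phi PL subrK.
Qed.

End QuadraticMaps.

(** * Perturbing a matrix while keeping its multiple eigenvalues *)

Section StrongProperty.
Variable R : realType.
Local Open Scope ring_scope.

Section Parts.
Variables (r n : nat).

(** The unknowns of the perturbation theorem are r matrices of size n; they are
    stored in one row vector, so that the previous result applies. *)
Definition part (i : 'I_r) (h : 'rV[R]_(r * (n * n))) : 'M[R]_n :=
  vec_mx (row i (vec_mx h)).

Definition pack (F : 'I_r -> 'M[R]_n) : 'rV[R]_(r * (n * n)) :=
  mxvec (\matrix_i mxvec (F i)).

Fact part_is_linear i : linear (part i).
Proof. by move=> a u v; rewrite /part !linearP. Qed.
HB.instance Definition _ i :=
  GRing.isLinear.Build R _ _ _ (part i) (part_is_linear i).

Lemma part_pack i F : part i (pack F) = F i.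
Proof. by rewrite /part /pack mxvecK rowK mxvecK. Qed.

Lemma part_inj h h' : (forall i, part i h = part i h') -> h = h'.
Proof.
move=> hh; rewrite -[h]vec_mxK -[h']vec_mxK; congr mxvec; apply/row_matrixP => i.
by rewrite -[LHS]vec_mxK -[RHS]vec_mxK; congr mxvec; apply: hh.
Qed.

Lemma part_entry i h a b : exists j, part i h a b = h 0 j.
Proof. by exists (mxvec_index i (mxvec_index a b)); rewrite !mxE. Qed.

Lemma big_mxvec_index p q (f : 'I_(p * q) -> R) :
  \sum_t f t = \sum_i \sum_j f (mxvec_index i j).
Proof.
rewrite (reindex _ (curry_mxvec_bij p q)) /= pair_bigA /=.
by apply: eq_bigr => -[].
Qed.

Lemma mul_trmx_part h y :
  (h *m y^T) 0 0 = \sum_i \tr (part i h *m (part i y)^T).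
Proof.
rewrite mxE big_mxvec_index; apply: eq_bigr => i _.
rewrite big_mxvec_index; apply: eq_bigr => a _.
by rewrite mxE; apply: eq_bigr => b _; rewrite !mxE.
Qed.

End Parts.

Lemma mxtrace_mul_trmx_eq0 n (Y : 'M[R]_n) :
  (forall Z : 'M[R]_n, \tr (Z *m Y^T) = 0) -> Y = 0.
Proof.
move=> H; apply/matrixP => a b; rewrite mxE.
have := H (delta_mx a b); rewrite /mxtrace (bigD1 a) //= big1 => [|i ia].
  rewrite addr0 mxE (bigD1 b) //= big1 => [|j jb].
    by rewrite addr0 !mxE !eqxx mul1r.
  by rewrite !mxE eqxx (negPf jb) mul0r.
by rewrite mxE big1 // => j _; rewrite !mxE (negPf ia) mul0r.
Qed.

(** Transversality condition. The symmetric matrices of rank at most rank (A0 -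
    lam) near A0 - lam form a manifold, whose normal space consists of the
    symmetric Y with Y (A0 - lam) = 0; the symmetric matrices supported on the
    diagonal and on E have the matrices vanishing there as normal space. The
    condition says that all these normal spaces, one for each lam_i and the last
    one, are independent. For one eigenvalue, and for E the edges of the graph
    of A0, this is the strong Arnold property. *)
Definition strong_property n k (A0 : 'M[R]_n) (lam : 'I_k -> R)
    (E : rel 'I_n) : Prop :=
  forall Y : 'I_k -> 'M[R]_n,
    (forall i, (Y i)^T = Y i) -> (forall i, Y i *m (A0 - (lam i)%:M) = 0) ->
    (forall a b, (a == b) || E a b -> (\sum_i Y i) a b = 0) ->
  forall i, Y i = 0.

(** Surjectivity is checked on the dual side, where it becomes the
    transversality condition. *)
Lemma row_full_dual m n (L : 'M[R]_(m, n)) :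
  (forall y : 'rV_n, L *m y^T = 0 -> y = 0) -> row_full L.
Proof.
move=> H; rewrite /row_full -mxrank_tr -/(row_free L^T) -kermx_eq0.
apply/eqP/row_matrixP => i; rewrite row0; apply: H.
apply: trmx_inj; rewrite trmx_mul trmxK trmx0.
by rewrite -row_mul mulmx_ker row0.
Qed.

(** Under the transversality condition, a small perturbation eps B, imposed off
    the diagonal and off E, can be compensated on these free positions so that
    the rank of A - lam_i never increases. A congruence
    (1 + M_i)^T (A0 - lam_i) (1 + M_i) does not increase the rank, so it suffices
    to solve, for all i at once,
      A0 + mask D + eps B - lam_i = (1 + M_i)^T (A0 - lam_i) (1 + M_i)
    in the unknowns M_i and D, where mask symmetrises D and keeps the free
    positions. This is a quadratic system in (M_i, D); unknowns T_i enter as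
    T_i - T_i^T, only to make the linear part onto all matrices instead of the
    symmetric ones, and symmetry forces T_i - T_i^T = 0 in a solution. The
    orthogonal complement of the image of the linear part is exactly the set of
    families Y which the transversality condition excludes. *)
Theorem strong_property_perturb n k (A0 B : 'M[R]_n) (lam : 'I_k -> R)
    (E : rel 'I_n) (delta : R) :
  A0^T = A0 -> B^T = B -> symmetric E -> strong_property A0 lam E -> 0 < delta ->
  exists A eps, [/\ 0 < eps, A^T = A,
    forall a b, `|A a b - A0 a b| <= delta,
    forall a b, a != b -> ~~ E a b -> A a b = A0 a b + eps * B a b
    & forall i, (\rank (A - (lam i)%:M)%R <= \rank (A0 - (lam i)%:M)%R)%N].
Proof.
move=> A0s Bs Es sp d0.
pose D i := A0 - (lam i)%:M.
have Ds i : (D i)^T = D i by rewrite /D linearB /= A0s tr_scalar_mx.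
pose mask (Z : 'M[R]_n) : 'M[R]_n :=
  \matrix_(a, b) (if (a == b) || E a b then Z a b + Z b a else 0).
have masks Z : (mask Z)^T = mask Z.
  by apply/matrixP => a b; rewrite !mxE eq_sym Es addrC.
have maskP c Z Z' : mask (c *: Z + Z') = c *: mask Z + mask Z'.
  apply/matrixP => a b; rewrite !mxE; case: ifP => _; last by rewrite mulr0 addr0.
  by rewrite mulrDr addrACA.
pose r := (k + (k + 1))%N.
pose iM (i : 'I_k) : 'I_r := lshift _ i.
pose iT (i : 'I_k) : 'I_r := rshift _ (lshift _ i).
pose iD : 'I_r := rshift _ (rshift _ ord0).
pose Lf (h : 'rV[R]_(r * (n * n))) : 'rV[R]_(k * (n * n)) := pack (fun i =>
  (part (iM i) h)^T *m D i + D i *m part (iM i) h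
  + (part (iT i) h - (part (iT i) h)^T) - mask (part iD h)).
have LfE i h : part i (Lf h) = (part (iM i) h)^T *m D i + D i *m part (iM i) h
    + (part (iT i) h - (part (iT i) h)^T) - mask (part iD h) by rewrite part_pack.
have Lf_lin : linear Lf.
  move=> c u v; apply: part_inj => i; rewrite linearP /= !LfE.
  have pl (j : 'I_r) : part j (c *: u + v) = c *: part j u + part j v := linearP _ _ _ _.
  rewrite !pl ![(_ + _)^T]linearD /= ![(_ *: _)^T]linearZ /=.
  rewrite ![(_ + _) *m D i]mulmxDl ![D i *m (_ + _)]mulmxDr.
  rewrite -!scalemxAl -!scalemxAr maskP.
  repeat match goal with |- context [?x *m ?y] => move: (x *m y) => ? end.
  repeat match goal with |- context [part ?x ?y] => move: (part x y) => ? end.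
  apply/matrixP => a b; rewrite !mxE; case: ifP => _; ring.
pose Lf0 := GRing.isLinear.Build R _ _ _ Lf Lf_lin.
pose L : {linear _ -> _} := HB.pack Lf Lf0.
pose b (u v : 'rV[R]_(r * (n * n))) : 'rV[R]_(k * (n * n)) := pack (fun i =>
  (part (iM i) u)^T *m D i *m part (iM i) v).
have bE i u v : part i (b u v) = (part (iM i) u)^T *m D i *m part (iM i) v.
  by rewrite part_pack.
have br u : linear (b u).
  move=> c v w; apply: part_inj => i; rewrite linearP /= !bE.
  by rewrite !linearP.
have bl v : linear (b^~ v).
  move=> c u w; apply: part_inj => i; rewrite linearP /= !bE.
  by rewrite [part _ (_ + _)]linearP [(_ + _)^T]linearP /= ![(_ + _) *m _]mulmxDl -!scalemxAl.
have fullL : row_full (lin1_mx L).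
  apply: row_full_dual => y Ly.
  pose Y i := part i y.
  have tr0 h : \sum_i \tr (part i (L h) *m (Y i)^T) = 0.
    by rewrite -mul_trmx_part -mul_rV_lin1 -mulmxA Ly mulmx0 mxE.
  have LE i h : part i (L h) = (part (iM i) h)^T *m D i + D i *m part (iM i) h
    + (part (iT i) h - (part (iT i) h)^T) - mask (part iD h) by exact: LfE.
  have mask0 : mask 0 = 0.
    by apply/matrixP => a c; rewrite !mxE addr0; case: ifP.
  (* orthogonality to the image, tested on each kind of unknown in turn: the T_i
     make Y_i symmetric, the M_i give Y_i (A0 - lam_i) = 0, and D makes the sum
     of the Y_i vanish on the free positions *)
  have trT (i : 'I_k) (Z : 'M[R]_n) : \tr ((Z - Z^T) *m (Y i)^T) = 0.
    have := tr0 (pack (fun j => if j == iT i then Z else 0)).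
    rewrite (bigD1 i) //= big1 => [|j ji].
      rewrite addr0 !LE !part_pack !eq_shift /= mask0 eqxx.
      by rewrite trmx0 mul0mx mulmx0 !add0r subr0.
    rewrite !LE !part_pack !eq_shift /= (negPf ji).
    by rewrite mask0 trmx0 mul0mx mulmx0 !subr0 !add0r mul0mx mxtrace0.
  have Ys i : (Y i)^T = Y i.
    apply/eqP; rewrite eq_sym -subr_eq0; apply/eqP.
    apply: mxtrace_mul_trmx_eq0 => Z.
    rewrite linearB /= trmxK mulmxBr linearB /=.
    have e : \tr (Z *m Y i) = \tr (Z^T *m (Y i)^T).
      by rewrite -mxtrace_tr trmx_mul mxtrace_mulC.
    by have := trT i Z; rewrite mulmxBl linearB /= -e.
  have trM (i : 'I_k) (Z : 'M[R]_n) : \tr ((Z^T *m D i + D i *m Z) *m (Y i)^T) = 0.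
    have := tr0 (pack (fun j => if j == iM i then Z else 0)).
    rewrite (bigD1 i) //= big1 => [|j ji].
      rewrite addr0 !LE !part_pack !eq_shift /= mask0 eqxx.
      by rewrite trmx0 !subr0 addr0.
    rewrite !LE !part_pack !eq_shift /= (negPf ji).
    by rewrite mask0 trmx0 mul0mx mulmx0 !subr0 !addr0 mul0mx mxtrace0.
  have YD i : Y i *m D i = 0.
    apply: trmx_inj; rewrite trmx0; apply: mxtrace_mul_trmx_eq0 => Z; rewrite trmxK.
    have e1 : \tr (Z^T *m D i *m Y i) = \tr (Z *m (Y i *m D i)).
      by rewrite -mxtrace_tr !trmx_mul trmxK Ys Ds mulmxA mxtrace_mulC.
    have e2 : \tr (D i *m Z *m Y i) = \tr (Z *m (Y i *m D i)).
      by rewrite -mulmxA mxtrace_mulC mulmxA.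
    have := trM i Z; rewrite mulmxDl linearD /= Ys e1 e2.
    by rewrite -mulr2n => /eqP; rewrite mulrn_eq0 /= => /eqP.
  have trD Z : \tr (mask Z *m (\sum_i Y i)^T) = 0.
    have := tr0 (pack (fun j => if j == iD then Z else 0)).
    rewrite (eq_bigr (fun i => - \tr (mask Z *m (Y i)^T))) => [|i _].
      rewrite sumrN -linear_sum /= -mulmx_sumr -linear_sum /=.
      by move/eqP; rewrite oppr_eq0 => /eqP.
    rewrite !LE !part_pack !eq_shift /=.
    by rewrite trmx0 mul0mx mulmx0 !subr0 !add0r mulNmx linearN.
  have Y0 := sp Y Ys YD.
  apply: part_inj => i; rewrite linear0; apply: Y0 => a c ac.
  have YYs : (\sum_i Y i)^T = \sum_i Y i.
    by rewrite linear_sum /=; apply: eq_bigr => j _.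
  set S := \sum_i Y i in YYs trD *.
  have SE p q : S p q = S q p by rewrite -{1}YYs mxE.
  have := trD S; rewrite /mxtrace.
  rewrite (eq_bigr (fun p => \sum_q (if (p == q) || E p q then S p q ^+ 2 *+ 2 else 0))).
    rewrite pair_bigA /= => /eqP; rewrite psumr_eq0 => [/allP/(_ (a, c))|[p q] _] /=.
      by rewrite mem_index_enum ac mulrn_eq0 /= sqrf_eq0 => /(_ isT)/eqP.
    by case: ifP => // _; rewrite mulrn_wge0 // sqr_ge0.
  move=> p _; rewrite mxE; apply: eq_bigr => q _; rewrite !mxE.
  by case: ifP => _; rewrite ?mul0r // (SE q p) -mulr2n -mulrnAl -mulr_natr; ring.
have [eta eta0 Hsol] := @quadratic_local_surj R _ _ (lin1_mx L) b br bl fullL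
  (delta / 3) ltac:(lra).
pose Bk : 'rV[R]_(k * (n * n)) := pack (fun=> B).
pose eps := Num.min (eta / (1 + `|Bk|)) (delta / 3 / (1 + `|B|)).
have eps0 : 0 < eps.
  by rewrite lt_min !divr_gt0 ?ltr_wpDr // ?divr_gt0.
have [|h hd hE] := Hsol (eps *: Bk).
  rewrite normrZ gtr0_norm //.
  apply: (@le_trans _ _ (eta / (1 + `|Bk|) * (1 + `|Bk|))).
    by rewrite ler_pM ?ge_min ?lexx ?(ltW eps0) // lerDr.
  by rewrite divfK // gt_eqF // ltr_wpDr.
pose A := A0 + mask (part iD h) + eps *: B.
have As : A^T = A by rewrite /A !linearD /= linearZ /= A0s masks Bs.
exists A, eps; split=> //.
- move=> p q; rewrite /A !mxE.
  have [j1 Dj1] := part_entry iD h p q; have [j2 Dj2] := part_entry iD h q p.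
  have e1 : `|part iD h p q| <= delta / 3.
    by rewrite Dj1 (le_trans (entry_le_norm _ _ _)).
  have e2 : `|part iD h q p| <= delta / 3.
    by rewrite Dj2 (le_trans (entry_le_norm _ _ _)).
  have e3 : `|eps * B p q| <= delta / 3.
    rewrite normrM gtr0_norm //.
    apply: (@le_trans _ _ (delta / 3 / (1 + `|B|) * (1 + `|B|))).
      rewrite ler_pM ?ge_min ?lexx ?orbT ?(ltW eps0) //.
      by rewrite (le_trans (entry_le_norm _ _ _)) // lerDr.
    by rewrite divfK // gt_eqF // ltr_wpDr.
  rewrite -addrA addrAC subrr add0r.
  apply: le_trans (ler_normD _ _) _.
  case: ifP => _; last by rewrite normr0 add0r; apply: le_trans e3 _; lra.
  have e4 := ler_normD (part iD h p q) (part iD h q p).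
  rewrite !mxE in e1 e2 e4.
  apply: le_trans (lerD (le_trans e4 (lerD e1 e2)) e3) _; lra.
- by move=> p q pq Epq; rewrite !mxE (negPf pq) (negPf Epq) addr0.
move=> i; rewrite -/(D i).
pose M := part (iM i) h; pose T := part (iT i) h.
have eqi : A - (lam i)%:M = (1%:M + M)^T *m D i *m (1%:M + M) + (T - T^T).
  have := congr1 (part i) hE; rewrite mul_rV_lin1 linearD /= linearZ /= !part_pack.
  rewrite -/M -/T => e; rewrite /A -e.
  have -> : (1%:M + M)^T = 1%:M + M^T by rewrite linearD /= trmx1.
  rewrite [(1%:M + M^T) *m D i]mulmxDl mul1mx [(D i + _) *m _]mulmxDl.
  rewrite ![_ *m (1%:M + M)]mulmxDr !mulmx1 {1}/D.
  repeat match goal with |- context [?x *m ?y] => move: (x *m y) => ? end.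
  by move: (mask _) => ?; apply/matrixP => p q; rewrite !mxE; ring.
have T0 : T - T^T = 0.
  have Ts : (T - T^T)^T = T - T^T.
    have -> : T - T^T = (A - (lam i)%:M) - (1%:M + M)^T *m D i *m (1%:M + M).
      by rewrite eqi addrAC subrr add0r.
    have congs (X D' : 'M[R]_n) : D'^T = D' -> (X^T *m D' *m X)^T = X^T *m D' *m X.
      by move=> Ds'; rewrite !trmx_mul trmxK Ds' mulmxA.
    by rewrite [LHS]linearB /= congs // [(A - _)^T]linearB /= As tr_scalar_mx.
  apply/matrixP => p q; have /matrixP/(_ p q) := Ts; rewrite !mxE; lra.
rewrite eqi T0 addr0.
by rewrite (leq_trans (mxrankM_maxl _ _)) // mxrankM_maxr.
Qed.

End StrongProperty.

(** * Counting eigenvalues *)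

Section DistinctEigenvalues.
Variable R : realType.
Local Open Scope ring_scope.

Definition spec n (A : 'M[R]_n) : seq R :=
  enum_fset (fset_set [set a : R | eigenvalue A a]%classic).

Lemma mem_spec n (A : 'M[R]_n) a : (a \in spec A) = eigenvalue A a.
Proof.
rewrite /spec (in_fset_set (finite_eigenvalues A)).
by apply/idP/idP => [|h]; [move/set_mem | apply/mem_set].
Qed.

Lemma spec_uniq n (A : 'M[R]_n) : uniq (spec A).
Proof. exact: fset_uniq. Qed.

Lemma size_spec n (A : 'M[R]_n) : size (spec A) = q_mx A.
Proof. by []. Qed.

Lemma q_mx_le_seq n (A : 'M[R]_n) (s : seq R) :
  (forall a (v : 'rV_n), v != 0 -> v *m A = a *: v -> a \in s) ->
  (q_mx A <= size s)%N.
Proof.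
move=> H; rewrite -size_spec; apply: uniq_leq_size (spec_uniq A) _ => a.
by rewrite mem_spec => /eigenvalueP[v vA v0]; apply: H vA.
Qed.

Lemma q_le n (G : sgraph n) (A : 'M[R]_n) : matrix_of G A -> (q R G <= q_mx A)%N.
Proof.
move=> GA; rewrite /q /min_over; case: ex_minnP => k _; apply.
by apply/asboolP; exists A.
Qed.

Lemma min_overP n (G : sgraph n) (f : 'M[R]_n -> nat) :
  exists2 A, matrix_of G A & f A = min_over G f.
Proof. by rewrite /min_over; case: ex_minnP => k /asboolP[A GA <-] _; exists A. Qed.

Lemma q_attained n (G : sgraph n) : exists2 A : 'M[R]_n, matrix_of G A & q_mx A = q R G.
Proof. exact: min_overP. Qed.

Lemma sum_eigenspace_rank n (A : 'M[R]_n) (s : seq R) : uniq s ->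
  (\sum_(a <- s) \rank (eigenspace A a) <= n)%N.
Proof.
move=> us; rewrite (big_nth 0) big_mkord.
have inj : {in xpredT &, injective (fun i : 'I_(size s) => s`_i)}.
  by move=> i j _ _ /eqP; rewrite nth_uniq // => /eqP/ord_inj.
have /mxdirectP /= <- := @mxdirect_sum_eigenspace _ _ _ A _ _ inj.
exact: rank_leq_col.
Qed.

Lemma rank_eigenspace n (A : 'M[R]_n) a :
  \rank (eigenspace A a) = (n - \rank (A - a%:M)%R)%N.
Proof. exact: mxrank_ker. Qed.

Lemma q_mx_le_size n (A : 'M[R]_n) : (q_mx A <= n)%N.
Proof.
apply: leq_trans (sum_eigenspace_rank A (spec_uniq A)).
rewrite -size_spec -sum1_size big_seq [leqRHS]big_seq.
by apply: leq_sum => a; rewrite mem_spec lt0n mxrank_eq0.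
Qed.

Lemma q_le_size n (G : sgraph n) : (q R G <= n)%N.
Proof. by have [A GA] := matrix_of_ex R G; apply: leq_trans (q_le GA) (q_mx_le_size A). Qed.

Lemma eigenvalue_rank n (A : 'M[R]_n) a :
  eigenvalue A a = (\rank (A - a%:M)%R < n)%N.
Proof. by rewrite /eigenvalue -mxrank_eq0 rank_eigenspace subn_eq0 -ltnNge. Qed.

(** The eigenspaces are in direct sum, so a multiple eigenvalue uses up at least
    two dimensions: m multiple eigenvalues leave at most n - m distinct ones. *)
Lemma q_mx_mult n (A : 'M[R]_n) (t : seq R) : uniq t ->
  (forall a, a \in t -> (\rank (A - a%:M)%R + 2 <= n)%N) ->
  (q_mx A + size t <= n)%N.
Proof.
move=> ut Ht; have := sum_eigenspace_rank A (spec_uniq A); apply: leq_trans.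
have tin a : a \in t -> a \in spec A.
  by move/Ht => h; rewrite mem_spec eigenvalue_rank (leq_trans _ h) // addn2 ltnS leqnSn.
apply: (@leq_trans (\sum_(a <- spec A) (1 + (a \in t)))).
  rewrite big_split /= sum1_size size_spec leq_add2l.
  apply: (@leq_trans (count (mem t) (spec A))).
    by rewrite -size_filter uniq_leq_size // => a at_; rewrite mem_filter inE at_ tin.
  rewrite -sum1_count big_mkcond /=; apply: leq_sum => a _.
  by rewrite /=; case: (a \in t).
rewrite big_seq [leqRHS]big_seq; apply: leq_sum => a.
rewrite mem_spec rank_eigenspace eigenvalue_rank => la.
by case: (boolP (a \in t)) => [/Ht|_] /=; move: (\rank _) la => r; lia.
Qed.

(** The nonzero eigenvalues share a space of dimension rank A. *)
Lemma q_mx_le_rank n (A : 'M[R]_n) : (q_mx A <= (\rank A).+1)%N.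
Proof.
have [A0|A0] := boolP (0 \in spec A); last first.
  have := q_mx_le_size A; rewrite mem_spec eigenvalue_rank in A0.
  by rewrite raddf0 subr0 -leqNgt in A0; move/leq_trans; apply; rewrite ltnW.
have := sum_eigenspace_rank A (spec_uniq A).
rewrite (perm_big _ (perm_to_rem A0)) big_cons rank_eigenspace raddf0 subr0.
have : (size (rem 0%R (spec A)) <= \sum_(a <- rem 0%R (spec A)) \rank (eigenspace A a))%N.
  rewrite -sum1_size big_seq [leqRHS]big_seq; apply: leq_sum => a.
  by move/mem_rem; rewrite mem_spec lt0n mxrank_eq0.
rewrite size_rem // size_spec => h1 h2.
have : (\rank A <= n)%N by exact: rank_leq_row.
by move: h1 (h2 : (n - \rank A + _ <= n)%N); move: (bigop _ _ _) => S; lia.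
Qed.

End DistinctEigenvalues.

Section Isomorphism.
Variable R : realType.
Local Open Scope ring_scope.

Lemma isog_sym m n (F : sgraph m) (G : sgraph n) : isog F G -> isog G F.
Proof.
move=> [f [g fK gK] fE]; exists g => [|i j]; first by exists f.
by rewrite -fE !gK.
Qed.

Lemma isog_trans m n p (F : sgraph m) (G : sgraph n) (H : sgraph p) :
  isog F G -> isog G H -> isog F H.
Proof.
move=> [f bf fE] [g bg gE]; exists (g \o f); first exact: bij_comp.
by move=> i j; rewrite /= gE fE.
Qed.

Lemma isog_compl m n (F : sgraph m) (G : sgraph n) :
  isog F G -> isog (compl F) (compl G).
Proof.
move=> [f bf fE]; exists f => // i j /=.
by rewrite /compl_rel fE (inj_eq (bij_inj bf)).
Qed.

Lemma isog_compl_compl n (G : sgraph n) : isog G (compl (compl G)).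
Proof.
exists id => [|i j]; first by exists id.
rewrite /= /compl_rel /= /compl_rel; have [->|ij] := eqVneq i j.
  by rewrite edge_irr.
by rewrite negbK.
Qed.

Lemma isog_size m n (F : sgraph m) (G : sgraph n) : isog F G -> m = n.
Proof. by move=> [f bf _]; have := bij_eq_card bf; rewrite !card_ord. Qed.

(** Simultaneous renumbering of rows and columns keeps spectrum and rank. *)
Lemma isog_matrix m n (F : sgraph m) (G : sgraph n) (A : 'M[R]_n) :
  isog F G -> matrix_of G A ->
  exists2 A' : 'M[R]_m, matrix_of F A' & (q_mx A' <= q_mx A)%N /\ \rank A' = \rank A.
Proof.
move=> [f [g fK gK] fE] [As AG].
pose A' := \matrix_(i, j) A (f i) (f j).
have mn : m = n.
  by apply: (isog_size (F := F) (G := G)); exists f => //; exists g.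
have eig a (v : 'rV[R]_m) : v != 0 -> v *m A' = a *: v -> eigenvalue A a.
  move=> v0 vA; apply/eigenvalueP; exists (\row_j v 0 (g j)).
    apply/rowP => j; have /rowP/(_ (g j)) := vA; rewrite !mxE => <-.
    rewrite (reindex f) /=; last by exists g => ? _; rewrite ?fK ?gK.
    by apply: eq_bigr => i _; rewrite !mxE gK fK.
  apply: contraNneq v0 => /rowP w0; apply/eqP/rowP => i.
  by have := w0 (f i); rewrite !mxE fK.
exists A'.
  split=> [|i j ij]; first by apply/matrixP => i j; rewrite !mxE -{1}As mxE.
  by rewrite mxE AG ?fE // (can_eq fK).
split.
  rewrite -[leqRHS]size_spec; apply: q_mx_le_seq => a v v0 vA.
  by rewrite mem_spec; apply: eig vA.
subst m; pose s := perm (can_inj fK).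
have -> : A' = row_perm s (col_perm s A) by apply/matrixP => i j; rewrite !mxE !permE.
rewrite row_permE col_permE mulmxA mxrankMfree ?row_free_unit ?unitmx_perm //.
by rewrite -mxrank_tr trmx_mul mxrankMfree ?mxrank_tr // row_free_unit unitmx_tr unitmx_perm.
Qed.

Lemma q_isog m n (F : sgraph m) (G : sgraph n) : isog F G -> q R F = q R G.
Proof.
suff H p r (F' : sgraph p) (G' : sgraph r) : isog F' G' -> (q R F' <= q R G')%N.
  by move=> FG; apply/eqP; rewrite eqn_leq !H //; apply: isog_sym.
move=> FG; have [A GA <-] := q_attained R G'.
by have [A' FA' [+ _]] := isog_matrix FG GA; apply: leq_trans; apply: q_le.
Qed.

End Isomorphism.

(** * Extending a matrix from a subgraph *)

Section Extension.
Variable R : realType.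
Local Open Scope ring_scope.

Lemma sum_codom m n (f : 'I_m -> 'I_n) (F : 'I_n -> R) : injective f ->
  (forall t, t \notin codom f -> F t = 0) -> \sum_t F t = \sum_c F (f c).
Proof.
move=> fi F0; rewrite (bigID (mem (codom f))) /= [X in _ + X]big1 // addr0.
rewrite (eq_bigl (mem (f @: [set: 'I_m]))).
  by rewrite big_imset /= => [|c d _ _ /fi//]; apply: eq_bigl => c; rewrite inE.
move=> t /=; apply/codomP/imsetP => [[c ->]|[c _ ->]]; first by exists c; rewrite ?inE.
by exists c.
Qed.

(** A matrix of a small graph with the transversality property can be planted in
    any graph H that contains the small one as a subgraph, not necessarily
    induced: put a value nu that differs from all lam_i on the rest of the
    diagonal, which keeps the property (the Y_i must vanish outside the planted
    block), and switch on the missing edges of H by a small perturbation. The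
    perturbation is kept below half of every planted edge entry, so that these
    do not vanish. *)
Lemma strong_property_extend k0 n r (G0 : sgraph k0) (H : sgraph n)
    (f : 'I_k0 -> 'I_n) (A0 : 'M[R]_k0) (lam : 'I_r -> R) :
  injective f -> (forall i j, G0 i j -> H (f i) (f j)) ->
  matrix_of G0 A0 -> strong_property A0 lam (edge G0) ->
  exists2 A, matrix_of H A &
    forall i, (\rank (A - (lam i)%:M)%R + (k0 - \rank (A0 - (lam i)%:M)%R) <= n)%N.
Proof.
move=> fi fH [A0s A0G] sp.
pose nu : R := 1 + \sum_i `|lam i|.
have nuP i : nu - lam i != 0.
  rewrite subr_eq0 gt_eqF // /nu (bigD1 i) //= addrCA ltr_pwDr //.
    by rewrite ltr_wpDr // sumr_ge0.
  exact: ler_norm.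
pose g i := [pick a | f a == i].
have gf a : g (f a) = Some a.
  by rewrite /g; case: pickP => [b /eqP/fi->//|/(_ a)]; rewrite eqxx.
have gN t : t \notin codom f -> g t = None.
  rewrite /g; case: pickP => // b /eqP <-; by rewrite codom_f.
pose A1 : 'M[R]_n := \matrix_(i, j)
  if (g i, g j) is (Some a, Some b) then A0 a b else if i == j then nu else 0.
have A1s : A1^T = A1.
  apply/matrixP => i j; rewrite !mxE eq_sym.
  by case: (g i) (g j) => [a|] [b|] //; rewrite -{1}A0s mxE.
pose E : rel 'I_n := fun i j => if (g i, g j) is (Some a, Some b) then G0 a b else false.
have Es : symmetric E by move=> i j; rewrite /E; case: (g i) (g j) => [a|] [b|] //; rewrite edge_sym.
pose B : 'M[R]_n := \matrix_(i, j) (H i j)%:R.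
have Bs : B^T = B by apply/matrixP => i j; rewrite !mxE edge_sym.
have D1 i (v : 'rV[R]_n) b :
    (v *m (A1 - (lam i)%:M)) 0 (f b) = (\row_c v 0 (f c) *m (A0 - (lam i)%:M)) 0 b.
  rewrite !mxE (sum_codom fi) => [|t tf].
    by apply: eq_bigr => c _; rewrite !mxE !gf (inj_eq fi).
  rewrite !mxE (gN _ tf) /=; have /negPf -> : t != f b.
    by apply: contraNneq tf => ->; rewrite codom_f.
  by rewrite subr0 mulr0.
have D2 i (v : 'rV[R]_n) t : t \notin codom f ->
    (v *m (A1 - (lam i)%:M)) 0 t = v 0 t * (nu - lam i).
  move=> tf; rewrite mxE (bigD1 t) //= big1 ?addr0 => [|s st].
    by rewrite !mxE (gN _ tf) eqxx.
  rewrite !mxE (negPf st) (gN _ tf).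
  by case: (g s) => [?|]; rewrite subr0 mulr0.
have sp1 : strong_property A1 lam E.
  move=> Y Ys YD YE.
  have Yrow : forall i p, row p (Y i) *m (A1 - (lam i)%:M) = 0.
    by move=> i p; rewrite -row_mul YD row0.
  have Yout : forall i p t, t \notin codom f -> Y i p t = 0.
    move=> i p t tf; have := congr1 (fun w : 'rV_n => w 0 t) (Yrow i p).
    rewrite D2 // !mxE => /eqP; rewrite mulf_eq0 (negPf (nuP i)) orbF.
    by move/eqP.
  have Yout' : forall i t p, t \notin codom f -> Y i t p = 0.
    by move=> i t p tf; rewrite -Ys mxE Yout.
  pose Z i : 'M[R]_k0 := \matrix_(a, b) Y i (f a) (f b).
  have Z0 : forall i, Z i = 0.
    apply: sp => [i|i|a b ab].
    - by apply/matrixP => a b; rewrite !mxE -{1}Ys mxE.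
    - apply/row_matrixP => a; rewrite row0 row_mul; apply/rowP => b.
      have := D1 i (row (f a) (Y i)) b; rewrite Yrow [LHS]mxE => e.
      rewrite [RHS]mxE e; congr ((_ *m _) _ _).
      by apply/rowP => c; rewrite !mxE.
    - have := YE (f a) (f b); rewrite (inj_eq fi) /E !gf => /(_ ab).
      by rewrite !summxE => e; rewrite -[RHS]e; apply: eq_bigr => i _; rewrite mxE.
  move=> i; apply/matrixP => p t; rewrite mxE.
  have [/codomP[a ->]|pf] := boolP (p \in codom f); last exact: Yout'.
  have [/codomP[b ->]|tf] := boolP (t \in codom f); last exact: Yout.
  by have /matrixP/(_ a b) := Z0 i; rewrite !mxE.
pose delta : R := \big[Num.min/1]_(p : 'I_k0 * 'I_k0 | G0 p.1 p.2) (`|A0 p.1 p.2| / 2).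
have edgeA a b : G0 a b -> A0 a b != 0.
  move=> ab; rewrite A0G //; by apply: contraTneq ab => ->; rewrite edge_irr.
have d0 : 0 < delta.
  rewrite /delta; elim/big_ind: _ => [//|x y x0 y0|[a b] /= ab].
    by rewrite lt_min x0.
  by rewrite divr_gt0 // normr_gt0 edgeA.
have [A [eps [eps0 As Ad AE rk]]] := strong_property_perturb A1s Bs Es sp1 d0.
exists A.
  split=> // i j ij.
  have [Eij|Eij] := boolP (E i j); last first.
    rewrite AE // !mxE (negPf ij).
    have -> : (if g i is Some a then if g j is Some b then A0 a b else 0 else 0) = 0 :> R.
      move: Eij; rewrite /E /g; case: pickP => // a /eqP fa; case: pickP => // b /eqP fb.
      by move=> ab; apply/eqP; rewrite -[_ == 0]negbK A0G //; apply: contraNneq ij => ab'; rewrite -fa -fb ab'.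
    by rewrite add0r mulf_eq0 gt_eqF //= pnatr_eq0; case: (H i j).
  have Hij : H i j.
    move: Eij; rewrite /E /g; case: pickP => // a /eqP <-; case: pickP => // b /eqP <-.
    exact: fH.
  rewrite Hij; apply/eqP => Aij0.
  have := Ad i j; rewrite Aij0 sub0r normrN mxE.
  move: Eij; rewrite /E; case: (g i) (g j) => [a|] [b|] // ab.
  apply/negP; rewrite -ltNge.
  have : delta <= `|A0 a b| / 2 by rewrite /delta (bigD1 (a, b)) //= ge_min lexx.
  have : 0 < `|A0 a b| by rewrite normr_gt0 edgeA.
  lra.
move=> i; apply: (@leq_trans (\rank (A1 - (lam i)%:M)%R
    + (k0 - \rank (A0 - (lam i)%:M)%R))%N).
  by rewrite leq_add2r rk.
pose P : 'M[R]_(k0, n) := \matrix_(a, t) (f a == t)%:R.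
have Pv (v : 'rV[R]_k0) t : (v *m P) 0 (f t) = v 0 t.
  rewrite mxE (bigD1 t) //= big1 ?addr0 => [|c ct]; rewrite mxE ?eqxx ?mulr1 //.
  by rewrite (inj_eq fi) (negPf ct) mulr0.
have Pout (v : 'rV[R]_k0) t : t \notin codom f -> (v *m P) 0 t = 0.
  move=> tf; rewrite mxE big1 // => c _; rewrite mxE.
  by case: eqP tf => [<-|_]; rewrite ?codom_f // mulr0.
rewrite addnC -mxrank_ker.
have Pfree : row_free P.
  apply/row_freeP; exists P^T; apply/matrixP => a b.
  have := Pv (delta_mx 0 a) b.
  rewrite -rowE !mxE /= => e; rewrite (bigD1 (f b)) //= big1 => [|t tb].
    by rewrite !mxE eqxx mulr1 addr0 (inj_eq fi).
  by rewrite !mxE [f b == t]eq_sym (negPf tb) mulr0.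
rewrite -(mxrankMfree (kermx (A0 - (lam i)%:M)) Pfree).
apply: mulmx0_rank_max; apply/row_matrixP => a; rewrite row0 2!row_mul.
apply/rowP => t; rewrite [RHS]mxE.
have [/codomP[b ->]|tf] := boolP (t \in codom f); last by rewrite D2 // Pout // mul0r.
pose w := row a (kermx (A0 - (lam i)%:M)).
have wE : \row_c (w *m P) 0 (f c) = w by apply/rowP => c; rewrite mxE Pv.
rewrite D1 wE.
by rewrite -row_mul mulmx_ker row0 mxE.
Qed.

(** Two eigenvectors that restrict to the standard basis at two positions are
    independent; all the double eigenvalues below are exhibited in this form. *)
Lemma rank_two_eigenvectors n (A : 'M[R]_n) a (u v : 'rV_n) p s :
  u *m A = a *: u -> v *m A = a *: v ->
  u 0 p = 1 -> u 0 s = 0 -> v 0 p = 0 -> v 0 s = 1 ->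
  (\rank (A - a%:M)%R + 2 <= n)%N.
Proof.
move=> uA vA up us vp vs; pose W := col_mx u v.
have W0 : W *m (A - a%:M) = 0.
  rewrite mul_col_mx !mulmxBr uA vA !mul_mx_scalar !subrr; exact: col_mx0.
have Wf : row_free W.
  apply/row_freeP; exists (row_mx (delta_mx p 0) (delta_mx s 0)).
  rewrite mul_col_row; apply/matrixP => i j.
  have dm (w : 'rV[R]_n) x : w *m delta_mx x 0 = (w 0 x)%:M.
    by rewrite -colE; apply/rowP => k; rewrite !ord1 !mxE.
  by rewrite !dm up us vp vs !(raddf0 (@scalar_mx _ _)) -scalar_mx_block.
have := mulmx0_rank_max W0; rewrite addnC; move: Wf => /eqP ->.
by [].
Qed.

Lemma double_eigenvalue k0 n (G0 : sgraph k0) (H : sgraph n)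
    (f : 'I_k0 -> 'I_n) (A0 : 'M[R]_k0) (a : R) :
  injective f -> (forall i j, G0 i j -> H (f i) (f j)) -> matrix_of G0 A0 ->
  (\rank (A0 - a%:M)%R + 2 <= k0)%N ->
  (forall X : 'M[R]_k0, X^T = X -> X *m A0 = a *: X ->
    (forall i j, (i == j) || G0 i j -> X i j = 0) -> X = 0) ->
  (q R H + 1 <= n)%N.
Proof.
move=> fi fH GA rk sp.
have [|A HA rkA] := @strong_property_extend _ _ 1 _ _ _ _ (fun=> a) fi fH GA.
  move=> Y Ys YD YE i; rewrite ord1; apply: sp => //.
    by have /eqP := YD ord0; rewrite mulmxBr mul_mx_scalar subr_eq0 => /eqP.
  by move=> x y /YE; rewrite big_ord1.
apply: (@leq_trans (q_mx A + 1)); first by rewrite leq_add2r q_le.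
apply: (@q_mx_mult _ _ A [:: a] isT) => b; rewrite inE => /eqP ->.
apply: leq_trans (rkA ord0); rewrite leq_add2l leq_subRL //.
by rewrite (leq_trans _ rk) // leq_addr.
Qed.

(** With eigenvalues a and b the condition only has to be checked on X + Y: if Y
    = - X then a X = X A0 = b X, and X vanishes as a differs from b. *)
Lemma two_double_eigenvalues k0 n (G0 : sgraph k0) (H : sgraph n)
    (f : 'I_k0 -> 'I_n) (A0 : 'M[R]_k0) (a b : R) :
  injective f -> (forall i j, G0 i j -> H (f i) (f j)) -> matrix_of G0 A0 ->
  a != b ->
  (\rank (A0 - a%:M)%R + 2 <= k0)%N -> (\rank (A0 - b%:M)%R + 2 <= k0)%N ->
  (forall X Y : 'M[R]_k0, X^T = X -> Y^T = Y -> X *m A0 = a *: X -> Y *m A0 = b *: Y ->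
    (forall i j, (i == j) || G0 i j -> (X + Y) i j = 0) -> X + Y = 0) ->
  (q R H + 2 <= n)%N.
Proof.
move=> fi fH GA ab rka rkb sp.
pose lam (i : 'I_2) := if i == ord0 then a else b.
have [|A HA rkA] := @strong_property_extend _ _ 2 _ _ _ _ lam fi fH GA.
  move=> Y Ys YD YE.
  pose i1 : 'I_2 := lift ord0 ord0.
  have Ea : Y ord0 *m A0 = a *: Y ord0.
    by have /eqP := YD ord0; rewrite mulmxBr mul_mx_scalar subr_eq0 => /eqP.
  have Eb : Y i1 *m A0 = b *: Y i1.
    by have /eqP := YD i1; rewrite mulmxBr mul_mx_scalar subr_eq0 => /eqP.
  have S0 : Y ord0 + Y i1 = 0.
    apply: sp => // x y /YE; rewrite big_ord_recl big_ord1.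
    by [].
  have Y1 : Y i1 = - Y ord0 by apply/eqP; rewrite -addr_eq0 addrC S0.
  have Y0 : Y ord0 = 0.
    have : (a - b) *: Y ord0 = 0.
      by rewrite scalerBl -Ea; move: Eb; rewrite Y1 mulNmx scalerN => /oppr_inj ->; rewrite subrr.
    by move/eqP; rewrite scaler_eq0 subr_eq0 (negPf ab) => /eqP.
  move=> i; have [->//|ne] := eqVneq i ord0.
  have -> : i = i1 by apply/val_inj; case: i ne => [[|[|]]].
  by rewrite Y1 Y0 oppr0.
have uab : uniq [:: a; b] by rewrite /= inE ab.
apply: (@leq_trans (q_mx A + 2)); first by rewrite leq_add2r q_le.
apply: (@q_mx_mult _ _ A _ uab) => c; rewrite !inE => /orP[] /eqP ->.
  apply: leq_trans (rkA ord0); rewrite leq_add2l leq_subRL //.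
  by rewrite (leq_trans _ rka) // leq_addr.
apply: leq_trans (rkA (lift ord0 ord0)); rewrite leq_add2l leq_subRL //.
by rewrite (leq_trans _ rkb) // leq_addr.
Qed.

(** Every set of n distinct reals is the spectrum of some matrix of any graph on
    n vertices: perturb a diagonal matrix, for which the transversality property
    is immediate. Such a matrix can be taken close to diagonal and with
    nonnegative entries off the diagonal, which makes Perron-Frobenius arguments
    available. *)
Lemma distinct_eigenvalues_realizable n (G : sgraph n) (lam : 'I_n -> R) (delta : R) :
  injective lam -> 0 < delta ->
  exists A : 'M[R]_n, [/\ matrix_of G A,
    forall i j, `|A i j - (if i == j then lam i else 0)| <= delta,
    forall i j, i != j -> 0 <= A i j & spec A =i codom lam].
Proof.
move=> li d0.
pose A0 : 'M[R]_n := diag_mx (\row_i lam i).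
have A0E i j : A0 i j = if i == j then lam i else 0.
  by rewrite !mxE; case: eqP => [->|]; rewrite ?mulr1n ?mulr0n.
have A0s : A0^T = A0 by rewrite tr_diag_mx.
pose B : 'M[R]_n := \matrix_(i, j) (G i j)%:R.
have Bs : B^T = B by apply/matrixP => i j; rewrite !mxE edge_sym.
have Ef : symmetric (fun _ _ : 'I_n => false) by [].
have DE i (v : 'rV[R]_n) t : (v *m (A0 - (lam i)%:M)) 0 t = v 0 t * (lam t - lam i).
  rewrite mxE (bigD1 t) //= big1 ?addr0 => [|s st].
    by rewrite !mxE eqxx !mulr1n.
  by rewrite !mxE (negPf st) !mulr0n subr0 mulr0.
have sp : strong_property A0 lam (fun _ _ => false).
  move=> Y Ys YD YE.
  have Y0 i p t : t != i -> Y i p t = 0.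
    move=> ti; have := DE i (row p (Y i)) t.
    rewrite -row_mul YD !mxE => /esym/eqP; rewrite mulf_eq0 subr_eq0 (inj_eq li) (negPf ti).
    by rewrite orbF => /eqP.
  move=> i; apply/matrixP => p t; rewrite mxE.
  have [ti|/Y0//] := eqVneq t i; have [pi|pi] := eqVneq p i; last first.
    by rewrite -Ys mxE Y0.
  have := YE i i; rewrite eqxx summxE (bigD1 i) //= big1 => [|j ji].
    by rewrite addr0 pi ti; apply.
  by rewrite Y0 // eq_sym.
have [A [eps [eps0 As Ad AE rk]]] := strong_property_perturb A0s Bs Ef sp d0.
have off i j : i != j -> A i j = eps * (G i j)%:R.
  by move=> ij; rewrite AE // A0E (negPf ij) add0r mxE.
exists A; split.
- split=> // i j ij; rewrite off // mulf_eq0 gt_eqF //= pnatr_eq0.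
  by case: (G i j).
- by move=> i j; rewrite -A0E.
- by move=> i j ij; rewrite off // mulr_ge0 ?ler0n // ltW.
have sub : {subset codom lam <= spec A}.
  move=> _ /codomP[i ->]; rewrite mem_spec eigenvalue_rank.
  apply: leq_ltn_trans (rk i) _; rewrite -eigenvalue_rank.
  apply/eigenvalueP; exists (delta_mx 0 i).
    apply/rowP => t; have := DE i (delta_mx 0 i) t.
    rewrite mulmxBr mul_mx_scalar !mxE /= => /eqP; rewrite subr_eq => /eqP ->.
    have [->|ti] := eqVneq t i; first by rewrite subrr mulr0 add0r.
    by rewrite mul0r add0r.
  by apply/eqP => /rowP/(_ i); rewrite !mxE !eqxx => /eqP; rewrite oner_eq0.
have uc : uniq (codom lam) by apply/injectiveP.
have := uniq_min_size uc sub; rewrite size_codom card_ord size_spec.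
by case/(_ (q_mx_le_size A)) => _ h c; rewrite h.
Qed.

End Extension.

(** * Small subgraphs which force multiple eigenvalues *)

(** The planted matrices below are given by functions on natural numbers, so
    that their eigenvector equations unfold to sums over explicit ranges. *)
Section NatIndexed.
Variable R : realType.
Local Open Scope ring_scope.
Variables (k n : nat) (H : sgraph n) (f : nat -> 'I_n) (a : nat -> nat -> R).
Hypothesis f_inj : forall i j, (i <= k)%N -> (j <= k)%N -> f i = f j -> i = j.
Hypothesis a_sym : forall i j, a i j = a j i.
Hypothesis a_edge : forall i j, (i < j)%N -> (j <= k)%N -> a i j != 0 -> H (f i) (f j).

Let A0 : 'M[R]_k.+1 := \matrix_(i, j) a i j.
Let base_rel : rel 'I_k.+1 := fun i j => (i != j) && (a i j != 0).

Lemma base_rel_sym : symmetric base_rel.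
Proof. by move=> i j; rewrite /base_rel eq_sym a_sym. Qed.

Lemma base_rel_irr : irreflexive base_rel.
Proof. by move=> i; rewrite /base_rel eqxx. Qed.

Let G0 := SGraph base_rel_sym base_rel_irr.

Lemma base_matrix : matrix_of G0 A0.
Proof.
split=> [|i j ij]; first by apply/matrixP => i j; rewrite !mxE.
by rewrite mxE /= /base_rel ij.
Qed.

Lemma ord_leq (i : 'I_k.+1) : (i <= k)%N.
Proof. exact: (ltn_ord i). Qed.

Lemma base_emb_inj : injective (fun i : 'I_k.+1 => f i).
Proof.
by move=> i j fij; apply/val_inj/(f_inj (ord_leq i) (ord_leq j)).
Qed.

Lemma base_emb_edge (i j : 'I_k.+1) : G0 i j -> H (f i) (f j).
Proof.
case/andP=> ij aij; have [ltij|ltji|eqij] := ltngtP i j.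
- exact: a_edge ltij (ord_leq j) aij.
- rewrite edge_sym; apply: a_edge ltji (ord_leq i) _.
  by rewrite a_sym.
- by case/eqP: ij; apply: val_inj.
Qed.

Lemma nat_mulmx (v : 'rV[R]_k.+1) (j : 'I_k.+1) :
  (v *m A0) 0 j = \sum_(0 <= t < k.+1) v 0 (inord t) * a t j.
Proof. by rewrite mxE big_mkord; apply: eq_bigr => t _; rewrite inord_val mxE. Qed.

Definition nat_eigenvector (c : R) (u : nat -> R) :=
  forall j, (j <= k)%N -> \sum_(0 <= t < k.+1) u t * a t j = c * u j.

Lemma nat_rank c (u v : nat -> R) (p s : nat) : (p <= k)%N -> (s <= k)%N ->
  nat_eigenvector c u -> nat_eigenvector c v ->
  u p = 1 -> u s = 0 -> v p = 0 -> v s = 1 ->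
  (\rank (A0 - c%:M)%R + 2 <= k.+1)%N.
Proof.
have row_eig w : nat_eigenvector c w -> (\row_(i < k.+1) w i) *m A0 = c *: \row_i w i.
  move=> wA; apply/rowP => j; rewrite nat_mulmx !mxE -(wA _ (ord_leq j)).
  rewrite !big_mkord; apply: eq_bigr => t _; by rewrite !mxE inord_val.
move=> pk sk /row_eig uA /row_eig vA *.
by apply: (rank_two_eigenvectors uA vA (p := inord p) (s := inord s)); rewrite !mxE inordK.
Qed.

Definition nat_eigenmatrix (c : R) (X : nat -> nat -> R) :=
  (forall i j, X i j = X j i) /\ (forall i, (i <= k)%N -> nat_eigenvector c (X i)).

Lemma nat_eigenmatrixP c (X : 'M[R]_k.+1) : X^T = X -> X *m A0 = c *: X ->
  nat_eigenmatrix c (fun i j => X (inord i) (inord j)).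
Proof.
move=> Xs XA; split=> [i j|i ik j jk]; first by rewrite -{1}Xs mxE.
have := congr1 (fun Z : 'M_k.+1 => Z (inord i) (inord j)) XA.
rewrite ![in RHS]mxE => <-; rewrite mxE big_mkord.
by apply: eq_bigr => t _; rewrite !mxE inord_val inordK.
Qed.

Definition nat_free i j := (i == j) || (a i j != 0).

Lemma nat_double_eigenvalue c (u v : nat -> R) (p s : nat) :
  (p <= k)%N -> (s <= k)%N -> nat_eigenvector c u -> nat_eigenvector c v ->
  u p = 1 -> u s = 0 -> v p = 0 -> v s = 1 ->
  (forall X, nat_eigenmatrix c X ->
     (forall i j, (i <= k)%N -> (j <= k)%N -> nat_free i j -> X i j = 0) ->
     forall i j, (i <= k)%N -> (j <= k)%N -> X i j = 0) ->
  (q R H + 1 <= n)%N.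
Proof.
move=> pk sk uA vA up us vp vs sp.
apply: (double_eigenvalue base_emb_inj base_emb_edge base_matrix).
  exact: (nat_rank pk sk uA vA).
move=> X Xs /(nat_eigenmatrixP Xs) XA X0; apply/matrixP => i j; rewrite mxE.
have := sp _ XA _ i j; rewrite !inord_val; apply; try exact: ord_leq.
move=> x y xk yk; rewrite /nat_free => xy; apply: X0; rewrite /= /base_rel.
by rewrite -(inj_eq val_inj) /= !inordK // ; case: (x == y) xy.
Qed.

Lemma nat_two_double_eigenvalues c d (u v u' v' : nat -> R) (p s p' s' : nat) :
  c != d -> (p <= k)%N -> (s <= k)%N -> (p' <= k)%N -> (s' <= k)%N ->
  nat_eigenvector c u -> nat_eigenvector c v ->
  u p = 1 -> u s = 0 -> v p = 0 -> v s = 1 ->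
  nat_eigenvector d u' -> nat_eigenvector d v' ->
  u' p' = 1 -> u' s' = 0 -> v' p' = 0 -> v' s' = 1 ->
  (forall X Y, nat_eigenmatrix c X -> nat_eigenmatrix d Y ->
     (forall i j, (i <= k)%N -> (j <= k)%N -> nat_free i j -> X i j + Y i j = 0) ->
     forall i j, (i <= k)%N -> (j <= k)%N -> X i j + Y i j = 0) ->
  (q R H + 2 <= n)%N.
Proof.
move=> cd pk sk pk' sk' uA vA up us vp vs uA' vA' up' us' vp' vs' sp.
apply: (two_double_eigenvalues base_emb_inj base_emb_edge base_matrix cd).
- exact: (nat_rank pk sk uA vA).
- exact: (nat_rank pk' sk' uA' vA').
move=> X Y Xs Ys /(nat_eigenmatrixP Xs) XA /(nat_eigenmatrixP Ys) YA X0.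
apply/matrixP => i j; rewrite !mxE.
have := sp _ _ XA YA _ i j; rewrite !inord_val; apply; try exact: ord_leq.
move=> x y xk yk; rewrite /nat_free => xy.
have := X0 (inord x) (inord y); rewrite mxE; apply; rewrite /= /base_rel.
by rewrite -(inj_eq val_inj) /= !inordK // ; case: (x == y) xy.
Qed.

End NatIndexed.

Ltac unroll := rewrite /index_iota /= ?big_cons ?big_nil /=.

Ltac edge_cases :=
  let h1 := fresh in let h2 := fresh in let h3 := fresh in
  move=> /= h1 h2 h3;
  first [by move: h1 | by move: h2 | by move: h3; rewrite /= ?eqxx | by []].

Ltac is_free := rewrite /nat_free /= ?oppr_eq0 ?pnatr_eq0 ?oner_eq0; done.
Section Bases.
Variable R : realType.
Local Open Scope ring_scope.
Variables (n : nat) (H : sgraph n).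

Definition tab (s : seq (seq R)) (i j : nat) : R := nth 0 (nth [::] s i) j.

Lemma nth_inj_upto (s : seq 'I_n) x0 k : uniq s -> size s = k.+1 ->
  forall i j, (i <= k)%N -> (j <= k)%N -> nth x0 s i = nth x0 s j -> i = j.
Proof. by move=> us sk i j ik jk /eqP; rewrite nth_uniq ?sk ?ltnS // => /eqP. Qed.

Lemma edge_neq x y : H x y -> x != y.
Proof. by apply: contraTneq => ->; rewrite edge_irr. Qed.

(** The all-ones matrix has 0 as a double eigenvalue, and in a triangle all
    positions are free. *)
Lemma triangle_q x y z : H x y -> H y z -> H x z -> (q R H + 1 <= n)%N.
Proof.
move=> xy yz xz.
have u3 : uniq [:: x; y; z].
  by rewrite /= !inE negb_or !edge_neq.
pose a := fun i j : nat => 1 : R.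
apply: (@nat_double_eigenvalue R 2 n H (nth x [:: x; y; z]) a _ _ _ 0
  (nth 0 [:: 1; 0; -1]) (nth 0 [:: 0; 1; -1]) 0 1) => //.
- by apply: nth_inj_upto.
- by case=> [|[|[|i]]] [|[|[|j]]]; edge_cases.
- by case=> [|[|[|j]]] // _; unroll; rewrite /a; lra.
- by case=> [|[|[|j]]] // _; unroll; rewrite /a; lra.
- by move=> X _ X0 i j ik jk; rewrite X0 // /nat_free /a oner_eq0 orbT.
Qed.

(** The adjacency matrix of the star with three leaves has 0 as a double
    eigenvalue. A symmetric X with X A = 0 which vanishes on the free positions
    is supported on the leaves and has zero row sums and zero diagonal there,
    hence vanishes. *)
Lemma claw_q c x y z : H c x -> H c y -> H c z -> uniq [:: x; y; z] -> (q R H + 1 <= n)%N.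
Proof.
move=> cx cy cz u3; have u4 : uniq [:: c; x; y; z].
  by rewrite cons_uniq u3 !inE !negb_or !edge_neq.
pose a := tab [:: [:: 0; 1; 1; 1]; [:: 1; 0; 0; 0]; [:: 1; 0; 0; 0]; [:: 1; 0; 0; 0]].
apply: (@nat_double_eigenvalue R 3 n H (nth c [:: c; x; y; z]) a _ _ _ 0
  (nth 0 [:: 0; 1; 0; -1]) (nth 0 [:: 0; 0; 1; -1]) 1 2) => //.
- by apply: nth_inj_upto.
- case=> [|[|[|[|i]]]] [|[|[|[|j]]]] //=; rewrite /a /tab /= ?nth_nil //; by case: i j => [|?] [|?].
- by case=> [|[|[|[|i]]]] [|[|[|[|j]]]]; edge_cases.
- by case=> [|[|[|[|j]]]] // _; unroll; rewrite /a /tab /=; lra.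
- by case=> [|[|[|[|j]]]] // _; unroll; rewrite /a /tab /=; lra.
move=> X [Xs XA] X0.
have H1 := XA 1%N isT 0%N isT; have H2 := XA 2%N isT 0%N isT; have H3 := XA 3%N isT 0%N isT.
have Z i j : (i <= 3)%N -> (j <= 3)%N -> nat_free a i j = true -> X i j = 0 by exact: X0.
have Z00 := X0 0%N 0%N isT isT isT; have Z11 := X0 1%N 1%N isT isT isT.
have Z22 := X0 2%N 2%N isT isT isT; have Z33 := X0 3%N 3%N isT isT isT.
have f01 : nat_free a 0 1 by rewrite /nat_free /a /tab /= oner_eq0.
have f02 : nat_free a 0 2 by rewrite /nat_free /a /tab /= oner_eq0.
have f03 : nat_free a 0 3 by rewrite /nat_free /a /tab /= oner_eq0.
have Z01 := X0 0%N 1%N isT isT f01; have Z02 := X0 0%N 2%N isT isT f02.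
have Z03 := X0 0%N 3%N isT isT f03.
move: H1 H2 H3; unroll; rewrite /a /tab /= (Xs 1 0)%N (Xs 2 0)%N (Xs 3 0)%N (Xs 2 1)%N (Xs 3 1)%N (Xs 3 2)%N => H1 H2 H3.
have Z12 : X 1%N 2%N = 0 by lra.
have Z13 : X 1%N 3%N = 0 by lra.
have Z23 : X 2%N 3%N = 0 by lra.
by case=> [|[|[|[|i]]]] [|[|[|[|j]]]] // _ _; rewrite // Xs.
Qed.

(** The matrix below has the double eigenvalues 3 and -3: its square is 9. The
    opposite vertices of the cycle come first, so that its two blocks of
    nonadjacent vertices are diagonal. *)
Lemma four_cycle_q x y z t : H x y -> H y z -> H z t -> H t x -> x != z -> y != t ->
  (q R H + 2 <= n)%N.
Proof.
move=> xy yz zt tx xz yt.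
have u4 : uniq [:: x; z; y; t].
  by rewrite /= !inE !negb_or xz yt (edge_neq xy) (edge_neq zt) eq_sym (edge_neq tx) eq_sym (edge_neq yz).
pose a := tab [:: [:: 1; 0; 2; 2]; [:: 0; 1; 2; -2]; [:: 2; 2; -1; 0]; [:: 2; -2; 0; -1]].
apply: (@nat_two_double_eigenvalues R 3 n H (nth x [:: x; z; y; t]) a _ _ _ 3 (-3)
  (nth 0 [:: 1; 1; 1; 0]) (nth 0 [:: 1; -1; 0; 1])
  (nth 0 [:: 1; 0; -1; -1]) (nth 0 [:: 0; 1; -1; 1]) 2 3 0 1) => //.
- by apply: nth_inj_upto.
- by case=> [|[|[|[|i]]]] [|[|[|[|j]]]] //=; rewrite /a /tab /= ?nth_nil //; case: i j => [|?] [|?].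
- rewrite edge_sym in tx; rewrite edge_sym in yz.
  by case=> [|[|[|[|i]]]] [|[|[|[|j]]]]; edge_cases.
- by apply/eqP; lra.
- by case=> [|[|[|[|j]]]] // _; unroll; rewrite /a /tab /=; lra.
- by case=> [|[|[|[|j]]]] // _; unroll; rewrite /a /tab /=; lra.
- by case=> [|[|[|[|j]]]] // _; unroll; rewrite /a /tab /=; lra.
- by case=> [|[|[|[|j]]]] // _; unroll; rewrite /a /tab /=; lra.
move=> X Y [Xs XA] [Ys YA] X0.
have Z i j : (i <= 3)%N -> (j <= 3)%N -> nat_free a i j -> X i j = - Y i j.
  by move=> i3 j3 ij; apply/eqP; rewrite -addr_eq0 X0.
have Z00 := Z 0%N 0%N isT isT isT; have Z11 := Z 1%N 1%N isT isT isT.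
have Z22 := Z 2%N 2%N isT isT isT; have Z33 := Z 3%N 3%N isT isT isT.
have Z02 : X 0%N 2%N = - Y 0%N 2%N by apply: Z => //; is_free.
have Z03 : X 0%N 3%N = - Y 0%N 3%N by apply: Z => //; is_free.
have Z12 : X 1%N 2%N = - Y 1%N 2%N by apply: Z => //; is_free.
have Z13 : X 1%N 3%N = - Y 1%N 3%N by apply: Z => //; is_free.
have [e1 e2] : X 0%N 1%N + Y 0%N 1%N = 0 /\ X 2%N 3%N + Y 2%N 3%N = 0.
  have hX i : (i <= 3)%N -> X i 0%N = X i 2%N + X i 3%N /\ X i 1%N = X i 2%N - X i 3%N.
    move=> i3; have := XA i i3 0%N isT; have := XA i i3 1%N isT.
    by unroll; rewrite /a /tab /= => ? ?; split; lra.
  have hY i : (i <= 3)%N -> Y i 0%N *+ 2 = - (Y i 2%N + Y i 3%N) /\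
      Y i 1%N *+ 2 = - (Y i 2%N - Y i 3%N).
    move=> i3; have := YA i i3 0%N isT; have := YA i i3 1%N isT.
    by unroll; rewrite /a /tab /= => ? ?; split; lra.
  have [] := hX 0%N isT; have [] := hX 1%N isT; have [] := hX 2%N isT; have [] := hX 3%N isT.
  have [] := hY 0%N isT; have [] := hY 1%N isT; have [] := hY 2%N isT; have [] := hY 3%N isT.
  rewrite (Xs 2 0)%N (Xs 3 0)%N (Xs 2 1)%N (Xs 3 1)%N (Xs 3 2)%N (Xs 1 0)%N.
  rewrite (Ys 2 0)%N (Ys 3 0)%N (Ys 2 1)%N (Ys 3 1)%N (Ys 3 2)%N (Ys 1 0)%N.
  by move=> *; split; lra.
have ZZ i j : (i < j)%N -> (j <= 3)%N -> X i j + Y i j = 0.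
  case: i j => [|[|[|[|i]]]] [|[|[|[|j]]]] // _ _; rewrite ?Z02 ?Z03 ?Z12 ?Z13 ?addNr //.
move=> i j i3 j3; have [ij|ij|->] := ltngtP i j.
- exact: ZZ.
- by rewrite Xs Ys ZZ.
- by rewrite X0 // /nat_free eqxx.
Qed.

(** The matrices J and J + 1 on the two triangles have 0 and 1 as double
    eigenvalues; X and Y live on different triangles, where all positions are
    free. *)
Lemma two_triangles_q x y z x' y' z' : uniq [:: x; y; z; x'; y'; z'] ->
  H x y -> H y z -> H x z -> H x' y' -> H y' z' -> H x' z' -> (q R H + 2 <= n)%N.
Proof.
move=> u6 xy yz xz xy' yz' xz'.
pose a := tab [:: [:: 1; 1; 1; 0; 0; 0]; [:: 1; 1; 1; 0; 0; 0]; [:: 1; 1; 1; 0; 0; 0];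
  [:: 0; 0; 0; 2; 1; 1]; [:: 0; 0; 0; 1; 2; 1]; [:: 0; 0; 0; 1; 1; 2]].
apply: (@nat_two_double_eigenvalues R 5 n H (nth x [:: x; y; z; x'; y'; z']) a _ _ _ 0 1
  (nth 0 [:: 1; 0; -1]) (nth 0 [:: 0; 1; -1])
  (nth 0 [:: 0; 0; 0; 1; 0; -1]) (nth 0 [:: 0; 0; 0; 0; 1; -1]) 0 1 3 4) => //.
- by apply: nth_inj_upto.
- by case=> [|[|[|[|[|[|i]]]]]] [|[|[|[|[|[|j]]]]]] //=; rewrite /a /tab /= ?nth_nil //; case: i j => [|?] [|?].
- by case=> [|[|[|[|[|[|i]]]]]] [|[|[|[|[|[|j]]]]]]; edge_cases.
- by rewrite eq_sym oner_eq0.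
- by case=> [|[|[|[|[|[|j]]]]]] // _; unroll; rewrite /a /tab /=; lra.
- by case=> [|[|[|[|[|[|j]]]]]] // _; unroll; rewrite /a /tab /=; lra.
- by case=> [|[|[|[|[|[|j]]]]]] // _; unroll; rewrite /a /tab /=; lra.
- by case=> [|[|[|[|[|[|j]]]]]] // _; unroll; rewrite /a /tab /=; lra.
move=> X Y [Xs XA] [Ys YA] X0.
have X_far i j : (i <= 5)%N -> (3 <= j <= 5)%N -> X i j = 0.
  move=> i5; have := XA i i5 3 isT; have := XA i i5 4 isT; have := XA i i5 5 isT.
  unroll; rewrite /a /tab /= => h1 h2 h3.
  by case: j => [|[|[|[|[|[|j]]]]]] // _; lra.
have Y_far i j : (i <= 5)%N -> (j < 3)%N -> Y i j = 0.
  move=> i5; have := YA i i5 0 isT; have := YA i i5 1 isT; have := YA i i5 2 isT.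
  unroll; rewrite /a /tab /= => h1 h2 h3.
  by case: j => [|[|[|j]]] // _; lra.
move=> i j i5 j5; have [i3|i3] := ltnP i 3; have [j3|j3] := ltnP j 3.
- by apply: X0 => //; case: i j i3 j3 {i5 j5} => [|[|[|i]]] [|[|[|j]]] // _ _; is_free.
- by rewrite X_far ?j3 // Ys Y_far // addr0.
- by rewrite Xs X_far ?i3 // Y_far // addr0.
apply: X0 => //.
by case: i j i3 j3 i5 j5 => [|[|[|[|[|[|i]]]]]] [|[|[|[|[|[|j]]]]]] // _ _ _ _; is_free.
Qed.

(** A triangle with two more edges at one of its vertices. The matrix below has
    the double eigenvalues 0 and 2. *)
Lemma cricket_q a0 b c d e : uniq [:: b; c; d; e] -> H b c ->
  H a0 b -> H a0 c -> H a0 d -> H a0 e -> (q R H + 2 <= n)%N.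
Proof.
move=> u4 bc ab ac ad ae.
have u5 : uniq [:: a0; b; c; d; e] by rewrite cons_uniq u4 !inE !negb_or !edge_neq.
pose a := tab [:: [:: 0; 1; 1; 1; 1]; [:: 1; 1; -1; 0; 0]; [:: 1; -1; 1; 0; 0];
  [:: 1; 0; 0; 0; 0]; [:: 1; 0; 0; 0; 0]].
apply: (@nat_two_double_eigenvalues R 4 n H (nth a0 [:: a0; b; c; d; e]) a _ _ _ 0 2
  (nth 0 [:: 0; 1; 1; 0; -2]) (nth 0 [:: 0; 0; 0; 1; -1])
  (nth 0 [:: 1; 1; 0; 2^-1; 2^-1]) (nth 0 [:: 1; 0; 1; 2^-1; 2^-1]) 1 3 1 2) => //.
- by apply: nth_inj_upto.
- by case=> [|[|[|[|[|i]]]]] [|[|[|[|[|j]]]]] //=; rewrite /a /tab /= ?nth_nil //; case: i j => [|?] [|?].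
- by case=> [|[|[|[|[|i]]]]] [|[|[|[|[|j]]]]]; edge_cases.
- by rewrite eq_sym pnatr_eq0.
- by case=> [|[|[|[|[|j]]]]] // _; unroll; rewrite /a /tab /=; lra.
- by case=> [|[|[|[|[|j]]]]] // _; unroll; rewrite /a /tab /=; lra.
- by case=> [|[|[|[|[|j]]]]] // _; unroll; rewrite /a /tab /=; lra.
- by case=> [|[|[|[|[|j]]]]] // _; unroll; rewrite /a /tab /=; lra.
move=> X Y [Xs XA] [Ys YA] X0.
have hX i : (i <= 4)%N -> [/\ X i 0%N = 0, X i 1%N = X i 2%N & X i 2%N *+ 2 + X i 3%N + X i 4%N = 0].
  move=> i4; have := XA i i4 0%N isT; have := XA i i4 1%N isT; have := XA i i4 3%N isT.
  by unroll; rewrite /a /tab /= => ? ? ?; split; lra.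
have hY i : (i <= 4)%N ->
    [/\ Y i 0%N = Y i 3%N *+ 2, Y i 3%N = Y i 4%N & Y i 0%N = Y i 1%N + Y i 2%N].
  move=> i4; have := YA i i4 1%N isT; have := YA i i4 3%N isT; have := YA i i4 4%N isT.
  by unroll; rewrite /a /tab /= => ? ? ?; split; lra.
have Z i j : (i <= 4)%N -> (j <= 4)%N -> nat_free a i j -> X i j = - Y i j.
  by move=> i4 j4 ij; apply/eqP; rewrite -addr_eq0 X0.
have f0 i : (i <= 4)%N -> nat_free a 0 i by case: i => [|[|[|[|[|i]]]]] // _; is_free.
have Y0 i : (i <= 4)%N -> Y i 0%N = 0.
  move=> i4; rewrite Ys; apply: oppr_inj; rewrite oppr0 -Z ?f0 // Xs.
  by case: (hX i i4).
have Y3 i : (i <= 4)%N -> Y i 3%N = 0 /\ Y i 4%N = 0.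
  by move=> i4; have [] := hY i i4; rewrite Y0 // => ? ? _; split; lra.
have f12 : nat_free a 1 2 by is_free.
have Y12 : [/\ Y 1%N 1%N = 0, Y 1%N 2%N = 0 & Y 2%N 2%N = 0].
  have [_ _] := hY 1%N isT; have [_ _] := hY 2%N isT; rewrite !Y0 // (Ys 2%N 1%N).
  have [_ + _] := hX 1%N isT; rewrite !Z // => *; split; lra.
have [Y11 Y1_2 Y22] := Y12.
have Y_0 i j : (i <= 4)%N -> (j <= 4)%N -> Y i j = 0.
  case: j => [|[|[|[|[|j]]]]] // i4 _; try (by rewrite Y0 // ); try (by case: (Y3 i i4)).
    case: i i4 => [|[|[|[|[|i]]]]] // _; rewrite Ys ?Y0 //; first [by case: (Y3 1%N isT) | idtac].
  case: i i4 => [|[|[|[|[|i]]]]] // _; rewrite Ys ?Y0 //; by case: (Y3 2%N isT).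
have [X1 X2] : [/\ X 1%N 1%N = 0, X 1%N 2%N = 0 & X 2%N 2%N = 0] /\ (X 3%N 3%N = 0 /\ X 4%N 4%N = 0).
  by rewrite !Z ?Y_0 ?oppr0.
case: X1 => X11 X12 X22; case: X2 => X33 X44.
have [_ _] := hX 1%N isT; have [_ + +] := hX 3%N isT; have [_ + +] := hX 4%N isT.
rewrite (Xs 3%N 1%N) (Xs 3%N 2%N) (Xs 4%N 1%N) (Xs 4%N 2%N) (Xs 4%N 3%N) X12 X33 X44.
move=> e1 e2 e3 e4 e5.
have X13 : X 1%N 3%N = 0 by lra.
have X14 : X 1%N 4%N = 0 by lra.
have X23 : X 2%N 3%N = 0 by lra.
have X24 : X 2%N 4%N = 0 by lra.
have X34 : X 3%N 4%N = 0 by lra.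
have X_0 i : (i <= 4)%N -> X i 0%N = 0 by move=> i4; case: (hX i i4).
move=> i j i4 j4; rewrite Y_0 // addr0.
by case: i j i4 j4 => [|[|[|[|[|i]]]]] [|[|[|[|[|j]]]]] // _ _; rewrite ?X_0 // Xs ?X_0.
Qed.

End Bases.

(** * Long cycles *)

(** On a cycle of length m the adjacency matrix has the double eigenvalues 2 cos
    (2 pi r / m), 0 < r < m / 2; for m >= 5 the values r = 1 and r = 2 give two
    of them. *)
Section Cycles.
Variable R : realType.
Local Open Scope ring_scope.

Section CyclicMatrix.
Variable k : nat.
Hypothesis k4 : (4 <= k)%N.
Let m := k.+1.

Let nxt (j : nat) := (j.+1 %% m)%N.
Let prv (j : nat) := ((j + k) %% m)%N.
Let a (i j : nat) : R := ((nxt i == j) || (nxt j == i))%:R.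

Lemma prvE j : (j < m)%N -> prv j = if j == 0%N then k else j.-1.
Proof.
rewrite /prv /m; case: j => [|j] jm; first by rewrite add0n modn_small.
by rewrite addSnnS modnDr modn_small // ltnW.
Qed.

Lemma nxtE j : (j < m)%N -> nxt j = if j == k then 0%N else j.+1.
Proof.
rewrite /nxt /m => jm; case: eqP => [->|jk]; first by rewrite modnn.
by rewrite modn_small //; lia.
Qed.

Lemma cyclic_edge t j : (t < m)%N -> (j < m)%N ->
  (nxt t == j) || (nxt j == t) = (t == prv j) || (t == nxt j).
Proof.
rewrite /m => tm jm; rewrite !nxtE // prvE //.
by case: (t =P k) (j =P k) (j =P 0%N) => [?|?] [?|?] [?|?]; subst; lia.
Qed.

Lemma cyclic_sum (w : nat -> R) j : (j < m)%N ->
  \sum_(0 <= t < m) w t * a t j = w (prv j) + w (nxt j).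
Proof.
move=> jm; rewrite big_mkord.
have pm : (prv j < m)%N by rewrite ltn_mod.
have nm : (nxt j < m)%N by rewrite ltn_mod.
have ne : prv j != nxt j.
  by rewrite prvE // nxtE //; case: (j =P k) (j =P 0%N) => [?|?] [?|?]; lia.
rewrite (bigD1 (Ordinal pm)) //= (bigD1 (Ordinal nm)) /=; last first.
  by rewrite -(inj_eq val_inj) /= eq_sym.
rewrite big1 => [|t /andP[tp tn]].
  by rewrite addr0 /a !cyclic_edge ?eqxx ?orbT ?mulr1.
rewrite /a cyclic_edge //.
rewrite -(inj_eq val_inj) /= in tp; rewrite -(inj_eq val_inj) /= in tn.
by rewrite (negPf tp) (negPf tn) mulr0.
Qed.

Lemma cyclic_eigenvector (r : nat) (phi c : R) :
  let theta : R := pi *+ 2 *+ r / m%:R in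
  nat_eigenvector k a (2 * cos theta) (fun t => c * sin (theta * t%:R + phi)).
Proof.
move=> theta j jk; rewrite cyclic_sum //.
have m0 : m%:R != 0 :> R by rewrite pnatr_eq0.
have per x : sin (x + theta * m%:R) = sin x.
  rewrite /theta divfK //.
  exact: (periodicn (@sinD2pi R)).
clearbody theta.
have sP : sin (theta * (prv j)%:R + phi) = sin (theta * j%:R + phi - theta).
  rewrite prvE //; case: eqP => [->|/eqP j0].
    rewrite -[RHS]per /m -natr1; congr sin; ring.
  have -> : j%:R = j.-1%:R + 1 :> R by rewrite natr1 prednK ?lt0n.
  by rewrite mulrDr mulr1 [in RHS]addrAC addrK.
have sN : sin (theta * (nxt j)%:R + phi) = sin (theta * j%:R + phi + theta).
  rewrite nxtE //; case: eqP => [->|_].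
    rewrite -[LHS]per /m -natr1; congr sin; ring.
  by congr sin; rewrite -natr1; ring.
by rewrite sP sN; move: (_ + phi) => x; rewrite sinB sinD; ring.
Qed.

(** Transversality for the cycle. Z = X + Y is symmetric, commutes with the
    adjacency matrix, and is killed row by row by (A - c) (A - d), a recurrence
    that determines a row from four consecutive entries. The three central
    entries Z i (i-1), Z i i, Z i (i+1) vanish, as they are free positions. By
    commutation Z i (i+2) and Z i (i-2) are equal, so the recurrence centred at
    i makes them vanish as well; the whole row follows. *)
Lemma cyclic_strong (c d : R) X Y : nat_eigenmatrix k a c X -> nat_eigenmatrix k a d Y ->
  (forall i j, (i <= k)%N -> (j <= k)%N -> nat_free a i j -> X i j + Y i j = 0) ->
  forall i j, (i <= k)%N -> (j <= k)%N -> X i j + Y i j = 0.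
Proof.
move=> [Xs XA] [Ys YA] XY0.
have pm j : (prv j <= k)%N by rewrite -ltnS ltn_mod.
have nm j : (nxt j <= k)%N by rewrite -ltnS ltn_mod.
have np j : (j <= k)%N -> nxt (prv j) = j.
  move=> jk; rewrite nxtE ?ltnS // prvE //.
  by case: (j =P 0%N) => ?; case: eqP => ?; lia.
have pn j : (j <= k)%N -> prv (nxt j) = j.
  move=> jk; rewrite prvE ?ltnS // nxtE //.
  by case: (j =P k) => ?; case: eqP => ?; lia.
have XE i j : (i <= k)%N -> (j <= k)%N -> X i (prv j) + X i (nxt j) = c * X i j.
  by move=> ik jk; rewrite -cyclic_sum //; apply: XA.
have YE i j : (i <= k)%N -> (j <= k)%N -> Y i (prv j) + Y i (nxt j) = d * Y i j.
  by move=> ik jk; rewrite -cyclic_sum //; apply: YA.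
pose Z i j := X i j + Y i j.
have Zs i j : Z i j = Z j i by rewrite /Z Xs Ys.
have Z0 i : (i <= k)%N -> Z i i = 0 by move=> ik; rewrite /Z XY0 // /nat_free eqxx.
have Zn i : (i <= k)%N -> Z i (nxt i) = 0.
  move=> ik; rewrite /Z XY0 // /nat_free /a eqxx /=.
  by rewrite oner_eq0 orbT.
have Zp i : (i <= k)%N -> Z i (prv i) = 0.
  by move=> ik; rewrite Zs -{2}(np i ik) Zn.
(* Z commutes with the adjacency matrix of the cycle *)
have comm i j : (i <= k)%N -> (j <= k)%N ->
    Z (prv i) j + Z (nxt i) j = Z i (prv j) + Z i (nxt j).
  move=> ik jk; rewrite /Z addrACA [RHS]addrACA XE // YE //.
  by rewrite (Xs (prv i)) (Xs (nxt i)) (Ys (prv i)) (Ys (nxt i)) XE // YE // Xs Ys.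
have rec i j : (i <= k)%N -> (j <= k)%N ->
    Z i (prv (prv j)) + Z i (nxt (nxt j)) + Z i j *+ 2
    - (c + d) * (Z i (prv j) + Z i (nxt j)) + c * d * Z i j = 0.
  move=> ik jk; have x1 := XE i (prv j) ik (pm j); have x2 := XE i (nxt j) ik (nm j).
  have y1 := YE i (prv j) ik (pm j); have y2 := YE i (nxt j) ik (nm j).
  rewrite np // in x1 y1; rewrite pn // in x2 y2.
  have x3 := XE i j ik jk; have y3 := YE i j ik jk.
  rewrite /Z.
  have -> : X i (prv (prv j)) = c * X i (prv j) - X i j by rewrite -x1 addrK.
  have -> : Y i (prv (prv j)) = d * Y i (prv j) - Y i j by rewrite -y1 addrK.
  have -> : X i (nxt (nxt j)) = c * X i (nxt j) - X i j by rewrite -x2 addrC addKr.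
  have -> : Y i (nxt (nxt j)) = d * Y i (nxt j) - Y i j by rewrite -y2 addrC addKr.
  have -> : X i (nxt j) = c * X i j - X i (prv j) by rewrite -x3 addrC addKr.
  have -> : Y i (nxt j) = d * Y i j - Y i (prv j) by rewrite -y3 addrC addKr.
  by rewrite -mulr_natr; ring.
have shift i : (i <= k)%N -> Z i (nxt (nxt i)) = Z (prv i) (nxt i).
  move=> ik; have := comm i (nxt i) ik (nm i).
  by rewrite Z0 // pn // Z0 // addr0 add0r.
have second i : (i <= k)%N -> Z i (nxt (nxt i)) = 0.
  move=> ik; have e := shift _ (pm i); rewrite np // in e.
  have e1 : Z (prv (prv i)) i = Z i (nxt (nxt i)).
    by rewrite shift // e np // shift // np.
  have := rec i i ik ik; rewrite Z0 // Zn // Zp // (Zs _ (prv (prv i))) e1.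
  by lra.
have all0 i t : (i <= k)%N -> let j := iter t nxt (prv i) in
    [/\ Z i j = 0, Z i (nxt j) = 0, Z i (nxt (nxt j)) = 0 & Z i (nxt (nxt (nxt j))) = 0].
  move=> ik; elim: t => [|t] /=; first by rewrite np // Zp // Z0 // Zn // second.
  set j := iter t nxt (prv i); have jk : (j <= k)%N by rewrite /j; case: (t) => [|t1] /=.
  case=> z1 z2 z3 z4; split=> //.
  have := rec i (nxt (nxt j)) ik (nm _); rewrite !pn // z1 z2 z3 z4.
  by lra.
move=> i j ik jk; rewrite -/(Z i j).
have [t <-] : exists t, iter t nxt (prv i) = j.
  have it t : iter t nxt (prv i) = ((prv i + t) %% m)%N.
    elim: t => [|t /= ->]; first by rewrite addn0 /prv modn_mod.
    by rewrite /nxt -addn1 modnDml addn1 addnS.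
  exists (j + (m - prv i))%N; rewrite it addnCA subnKC ?modnDr ?modn_small //.
  by rewrite ltnW // ltnS.
by case: (all0 i t ik).
Qed.

Lemma cyclic_q n (H : sgraph n) (f : nat -> 'I_n) :
  (forall i j, (i <= k)%N -> (j <= k)%N -> f i = f j -> i = j) ->
  (forall i, (i <= k)%N -> H (f i) (f (nxt i))) -> (q R H + 2 <= n)%N.
Proof.
move=> fi fE.
pose theta := pi *+ 2 / m%:R : R.
have m0 : 0 < m%:R :> R by rewrite ltr0n.
have p0 := pi_gt0 R.
have m5 : 5 <= m%:R :> R by rewrite ler_nat.
have th0 : 0 < theta by rewrite divr_gt0 // pmulrn_lgt0.
have th2 : theta *+ 2 < pi.
  rewrite /theta -mulrnAl ltr_pdivrMr //.
  by apply: (@lt_le_trans _ _ (pi * 5)); [lra | rewrite ler_pM2l].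
have s1 : sin theta != 0 by rewrite gt_eqF // sin_gt0_pi // th0 /=; lra.
have s2 : sin (theta *+ 2) != 0 by rewrite gt_eqF // sin_gt0_pi // th2 andbT pmulrn_lgt0.
have ne : 2 * cos theta != 2 * cos (theta *+ 2).
  have two0 : 2 != 0 :> R by rewrite pnatr_eq0.
  apply/eqP => /(mulfI two0) e.
  have : theta = theta *+ 2 by apply: cos_inj e; rewrite in_itv /=; apply/andP; lra.
  by lra.
have a_sym i j : a i j = a j i by rewrite /a orbC.
have vec (r : nat) phi c0 : nat_eigenvector k a (2 * cos (theta *+ r))
    (fun t => c0 * sin (theta *+ r * t%:R + phi)).
  have -> : theta *+ r = pi *+ 2 *+ r / m%:R by rewrite /theta -mulrnAl.
  exact: cyclic_eigenvector.
(* eigenvectors normalised at positions 1 and 0: multiples of the sine waves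
   that vanish at 0 and at 1 *)
apply: (@nat_two_double_eigenvalues R k n H f a fi a_sym _ _ _
  (fun t => (sin theta)^-1 * sin (theta *+ 1 * t%:R + 0))
  (fun t => - (sin theta)^-1 * sin (theta *+ 1 * t%:R - theta))
  (fun t => (sin (theta *+ 2))^-1 * sin (theta *+ 2 * t%:R + 0))
  (fun t => - (sin (theta *+ 2))^-1 * sin (theta *+ 2 * t%:R - theta *+ 2))
  1 0 1 0 ne) => //; try lia; rewrite ?mulr1n ?mulr0 ?mulr1 ?addr0 ?add0r ?subrr ?sinN ?sin0 ?mulr0 ?mulrN ?mulNr ?opprK ?mulVf //.
- move=> i j ij jk; rewrite /a pnatr_eq0 eqb0 negbK => /orP[] /eqP <-.
    by apply: fE; lia.
  by rewrite edge_sym; apply: fE.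
- exact: (vec 1%N).
- by move=> j jk; rewrite -[in cos _](mulr1n theta) -(vec 1%N (- theta)).
exact: cyclic_strong.
Qed.

End CyclicMatrix.
End Cycles.

(** * Unions *)

Section LongCycles.
Variable R : realType.

Lemma long_cycle_q n (H : sgraph n) (c : seq 'I_n) :
  uniq c -> cycle H c -> (4 <= size c)%N -> (q R H + 2 <= n)%N.
Proof.
case: c => // x0 p uc cc; set c := x0 :: p in uc *.
have edge i : (i < size c)%N -> H (nth x0 c i) (nth x0 c (i.+1 %% size c)).
  move=> ic; move: (cc) => /(pathP x0)/(_ i); rewrite size_rcons => /(_ ic).
  rewrite -rcons_cons !nth_rcons -/c ic.
  have [e|ne] := eqVneq i.+1 (size c).
    have -> : i = size p by case: e.
    by rewrite ltnn eqxx modnn.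
  have ip : (i < size p)%N by rewrite /= in ic ne; lia.
  by rewrite ip modn_small // ltnS.
rewrite leq_eqVlt => /predU1P[c4|c5]; last first.
  pose k := (size c).-1.
  have kE : k.+1 = size c by [].
  apply: (@cyclic_q R k _ n H (nth x0 c)) => //.
  by move=> i j ik jk /eqP; rewrite nth_uniq ?ltnS // => /eqP.
have e0 := edge 0%N; have e1 := edge 1%N; have e2 := edge 2; have e3 := edge 3.
rewrite -c4 in e0 e1 e2 e3.
apply: (four_cycle_q R (e0 isT) (e1 isT) (e2 isT) (e3 isT)).
- by rewrite nth_uniq // -c4.
- by rewrite nth_uniq // -c4.
Qed.

End LongCycles.

Section Unions.
Variable R : realType.

Lemma gunion_lshift m n (G : sgraph m) (H : sgraph n) i j :
  gunion G H (lshift n i) (lshift n j) = G i j.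
Proof. by rewrite /= /sum_rel !(unsplitK (inl _)). Qed.

Lemma gunion_rshift m n (G : sgraph m) (H : sgraph n) i j :
  gunion G H (rshift m i) (rshift m j) = H i j.
Proof. by rewrite /= /sum_rel !(unsplitK (inr _)). Qed.

Lemma gunion_lrshift m n (G : sgraph m) (H : sgraph n) i j :
  gunion G H (lshift n i) (rshift m j) = false.
Proof. by rewrite /= /sum_rel (unsplitK (inl _)) (unsplitK (inr _)). Qed.

Lemma gunion_rlshift m n (G : sgraph m) (H : sgraph n) i j :
  gunion G H (rshift m i) (lshift n j) = false.
Proof. by rewrite /= /sum_rel (unsplitK (inl _)) (unsplitK (inr _)). Qed.

Lemma gjoin_lshift m n (G : sgraph m) (H : sgraph n) i j :
  gjoin G H (lshift n i) (lshift n j) = G i j.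
Proof. by rewrite /= /sum_rel !(unsplitK (inl _)). Qed.

Lemma gjoin_rshift m n (G : sgraph m) (H : sgraph n) i j :
  gjoin G H (rshift m i) (rshift m j) = H i j.
Proof. by rewrite /= /sum_rel !(unsplitK (inr _)). Qed.

Lemma gjoin_lrshift m n (G : sgraph m) (H : sgraph n) i j :
  gjoin G H (lshift n i) (rshift m j).
Proof. by rewrite /= /sum_rel (unsplitK (inl _)) (unsplitK (inr _)). Qed.

Lemma gjoin_rlshift m n (G : sgraph m) (H : sgraph n) i j :
  gjoin G H (rshift m i) (lshift n j).
Proof. by rewrite /= /sum_rel (unsplitK (inl _)) (unsplitK (inr _)). Qed.

Definition gunionE := (gunion_lshift, gunion_rshift, gunion_lrshift, gunion_rlshift).
Definition gjoinE := (gjoin_lshift, gjoin_rshift, gjoin_lrshift, gjoin_rlshift).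

Lemma isog_compl_gunion m n (G : sgraph m) (H : sgraph n) :
  isog (compl (gunion G H)) (gjoin (compl G) (compl H)).
Proof.
exists id => [|i j]; first by exists id.
case: (split_ordP i) => i' ->; case: (split_ordP j) => j' ->;
  rewrite gjoinE /= /compl_rel gunionE ?eq_shift //.
Qed.

Lemma isog_compl_gjoin m n (G : sgraph m) (H : sgraph n) :
  isog (compl (gjoin G H)) (gunion (compl G) (compl H)).
Proof.
exists id => [|i j]; first by exists id.
case: (split_ordP i) => i' ->; case: (split_ordP j) => j' ->;
  rewrite gunionE /= /compl_rel gjoinE ?eq_shift ?andbF //.
Qed.

Lemma isog_gunionC m n (G : sgraph m) (H : sgraph n) : isog (gunion G H) (gunion H G).
Proof.
pose sw p r (i : 'I_(p + r)) : 'I_(r + p) :=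
  match fintype.split i with inl j => rshift r j | inr j => lshift p j end.
have swl p r j : sw p r (lshift r j) = rshift r j by rewrite /sw (unsplitK (inl _)).
have swr p r j : sw p r (rshift p j) = lshift p j by rewrite /sw (unsplitK (inr _)).
exists (sw m n).
  by exists (sw n m) => i; case: (split_ordP i) => j ->; rewrite !(swl, swr).
by move=> i j; case: (split_ordP i) => i' ->; case: (split_ordP j) => j' ->;
  rewrite !(swl, swr) !gunionE.
Qed.

Lemma isog_gjoinC m n (G : sgraph m) (H : sgraph n) : isog (gjoin G H) (gjoin H G).
Proof.
apply: isog_trans (isog_compl_compl _) _.
apply: isog_trans _ (isog_sym (isog_compl_compl _)); apply: isog_compl.
apply: isog_trans (isog_compl_gjoin G H) _; apply: isog_trans (isog_gunionC _ _) _.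
exact: isog_sym (isog_compl_gjoin H G).
Qed.

Definition separated n (G : sgraph n) (C : {set 'I_n}) : Prop :=
  [/\ (0 < #|C|)%N, (#|C| < n)%N & forall i j, i \in C -> j \notin C -> G i j = false].

(** Connectedness without paths: only the edges which leave a set of vertices
    are ever used. *)
Definition connectedg n (G : sgraph n) : Prop := forall C, ~ separated G C.

Lemma separated_gunion n (G : sgraph n) (C : {set 'I_n}) : separated G C ->
  exists (G1 : sgraph #|C|) (G2 : sgraph #|~: C|),
    isog (gunion G1 G2) G /\ [/\ (0 < #|C|)%N, (0 < #|~: C|)%N & (#|C| + #|~: C| = n)%N].
Proof.
move=> [C0 CT Cno].
have ind (D : {set 'I_n}) : exists G' : sgraph #|D|,
    forall i j, G' i j = G (enum_val i) (enum_val j).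
  have s : symmetric (fun i j : 'I_#|D| => G (enum_val i) (enum_val j)).
    by move=> i j; rewrite edge_sym.
  have r : irreflexive (fun i j : 'I_#|D| => G (enum_val i) (enum_val j)).
    by move=> i; rewrite edge_irr.
  by exists (SGraph s r).
have [G1 E1] := ind C; have [G2 E2] := ind (~: C).
have cn : (#|C| + #|~: C| = n)%N by rewrite cardsC card_ord.
exists G1, G2; split; last by split=> //; lia.
pose f (i : 'I_(#|C| + #|~: C|)) : 'I_n :=
  match fintype.split i with inl j => enum_val j | inr j => enum_val j end.
have fl j : f (lshift _ j) = enum_val j by rewrite /f (unsplitK (inl _)).
have fr j : f (rshift _ j) = enum_val j by rewrite /f (unsplitK (inr _)).
have inC (j : 'I_#|C|) : enum_val j \in C by exact: enum_valP.
have inD (j : 'I_#|~: C|) : enum_val j \notin C by have := enum_valP j; rewrite inE.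
exists f.
  apply: inj_card_bij; last by rewrite !card_ord cn.
  move=> i j; case: (split_ordP i) => i' ->; case: (split_ordP j) => j' ->; rewrite ?fl ?fr.
  - by move/enum_val_inj ->.
  - by move=> e; have := inC i'; rewrite e (negPf (inD j')).
  - by move=> e; have := inC j'; rewrite -e (negPf (inD i')).
  - by move/enum_val_inj ->.
move=> i j; case: (split_ordP i) => i' ->; case: (split_ordP j) => j' ->;
  rewrite ?fl ?fr !gunionE //.
- by rewrite Cno.
- by rewrite edge_sym Cno.
Qed.

Local Open Scope ring_scope.

Lemma block_eigenvector m n (A : 'M[R]_m) (B : 'M[R]_n) a (v : 'rV_(m + n)) :
  v != 0 -> v *m block_mx A 0 0 B = a *: v -> eigenvalue A a \/ eigenvalue B a.
Proof.
rewrite -[v]hsubmxK mul_row_block !mulmx0 addr0 add0r scale_row_mx => v0 /eq_row_mx[e1 e2].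
have [l0|l0] := eqVneq (lsubmx v) 0; last by left; apply/eigenvalueP; exists (lsubmx v).
have [r0|r0] := eqVneq (rsubmx v) 0; last by right; apply/eigenvalueP; exists (rsubmx v).
by rewrite l0 r0 row_mx0 eqxx in v0.
Qed.

Lemma matrix_of_gunion m n (G : sgraph m) (H : sgraph n) (A : 'M[R]_m) (B : 'M[R]_n) :
  matrix_of G A -> matrix_of H B -> matrix_of (gunion G H) (block_mx A 0 0 B).
Proof.
move=> [As AG] [Bs BH]; split; first by rewrite tr_block_mx As Bs !trmx0.
move=> i j; case: (split_ordP i) => i' ->; case: (split_ordP j) => j' ->;
  rewrite gunionE ?block_mxEul ?block_mxEur ?block_mxEdl ?block_mxEdr ?mxE ?eq_shift ?eqxx //.
- exact: AG.
- exact: BH.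
Qed.

(** The spectrum 0, -1, ..., 1 - k, realised by every graph on k vertices:
    matrices of different sizes then have nested spectra. *)
Definition negs (k : nat) : seq R := [seq - i%:R | i <- iota 0 k].

Lemma size_negs k : size (negs k) = k.
Proof. by rewrite size_map size_iota. Qed.

Lemma mem_negs k i : (i < k)%N -> - i%:R \in negs k.
Proof. by move=> ik; apply/mapP; exists i => //; rewrite mem_iota. Qed.

Lemma negsP k a : reflect (exists2 i, (i < k)%N & a = - i%:R) (a \in negs k).
Proof.
apply: (iffP mapP) => -[j]; first by rewrite mem_iota => ? ->; exists j.
by move=> jk ->; exists j => //; rewrite mem_iota.
Qed.

Lemma sub_negs k l : (k <= l)%N -> {subset negs k <= negs l}.
Proof. by move=> kl _ /negsP[i ik ->]; apply/mem_negs/(leq_trans ik). Qed.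

Lemma negs_realizable n (G : sgraph n) : exists A : 'M[R]_n, matrix_of G A /\
  forall a, eigenvalue A a -> a \in negs n.
Proof.
have li : injective (fun i : 'I_n => - (i : nat)%:R : R).
  by move=> i j /oppr_inj/eqP; rewrite eqr_nat => /eqP/val_inj.
have [A [GA _ _ sA]] := @distinct_eigenvalues_realizable R n G _ 1 li ltr01.
exists A; split=> // a; rewrite -mem_spec sA => /codomP[i ->].
exact: mem_negs.
Qed.

(** Realise the nested spectra on both sides. *)
Lemma gunion_q_le m n (G : sgraph m) (H : sgraph n) : (q R (gunion G H) <= maxn m n)%N.
Proof.
have [A [GA Ae]] := negs_realizable G; have [B [HB Be]] := negs_realizable H.
apply: leq_trans (q_le (matrix_of_gunion GA HB)) _.
rewrite -[leqRHS]size_negs; apply: q_mx_le_seq => a v v0 /(block_eigenvector v0)[/Ae|/Be];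
  apply: sub_negs; [exact: leq_maxl | exact: leq_maxr].
Qed.

End Unions.

(** * Joins, and the third family *)

Section Joins.
Variable R : realType.
Local Open Scope ring_scope.

Definition positive_row n (u : 'rV[R]_n) := forall i, 0 < u 0 i.

Lemma positive_row_norm n (u : 'rV[R]_n.+1) : positive_row u -> 0 < (u *m u^T) 0 0.
Proof.
move=> u0; rewrite mxE (bigD1 ord0) //= ltr_pwDl ?mxE ?mulr_gt0 ?u0 //.
by apply: sumr_ge0 => i _; rewrite mxE mulr_ge0 // ltW ?u0.
Qed.

(** The positive vector u will fill the positions between the two sides of a
    join. *)
Definition perron n (G : sgraph n) (A : 'M[R]_n) (u : 'rV[R]_n) :=
  [/\ matrix_of G A, u *m A = 0, positive_row u
    & forall a, eigenvalue A a -> a \in negs R n].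

(** Orthogonally to u, only the eigenvalues -1, -2, ... then remain. *)
Definition simple_top n (A : 'M[R]_n) (u : 'rV[R]_n) :=
  forall (x : 'rV_n), x != 0 -> x *m A = 0 -> x *m u^T != 0.

(** Take a matrix with spectrum 0, -1, ..., so close to diagonal that all rows
    but the first are diagonally dominant. Then a kernel vector whose first
    coordinate is 0 vanishes. So the kernel is a line, and a generator u with
    u_0 = 1 is nonnegative by diagonal dominance at its smallest entry. No edge
    leaves the zero set of u, which is therefore empty in a connected graph. *)
Lemma perron_connected n (G : sgraph n.+1) : connectedg G ->
  exists A u, perron G A u /\ simple_top A u.
Proof.
move=> Gc.
have li : injective (fun i : 'I_n.+1 => - (i : nat)%:R : R).
  by move=> i j /oppr_inj/eqP; rewrite eqr_nat => /eqP/val_inj.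
pose d : R := (n.+1%:R * 2 + 2)^-1.
have N0 : 0 < n.+1%:R :> R by rewrite ltr0n.
have d0 : 0 < d by rewrite invr_gt0; lra.
have dE : n.+1%:R * d + d = 2^-1.
  by rewrite /d; field; rewrite gt_eqF //; lra.
have nd0 : 0 < n.+1%:R * d by rewrite mulr_gt0.
have [A [GA Ad Apos sA]] := @distinct_eigenvalues_realizable R _ G _ d li d0.
have [As AG] := GA.
have diag (i : 'I_n.+1) : i != ord0 -> A i i <= -1 + d.
  move=> i0; have := Ad i i; rewrite eqxx opprK ler_norml => /andP[_ h].
  have : (1 <= i)%N by rewrite lt0n; apply: contra i0 => /eqP i0; apply/eqP/val_inj.
  rewrite -(ler_nat R); lra.
have offd i : \sum_(j | j != i) A j i <= n.+1%:R * d.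
  have -> : n.+1%:R * d = \sum_(j < n.+1) d by rewrite sumr_const card_ord mulr_natl.
  rewrite [leRHS](bigD1 i) //= ler_wpDl ?(ltW d0) //; apply: ler_sum => j ji.
  by have := Ad j i; rewrite (negPf ji) subr0 => /(le_trans (ler_norm _)).
have eq0 (x : 'rV[R]_n.+1) : x *m A = 0 -> forall i, - A i i * x 0 i = \sum_(j | j != i) x 0 j * A j i.
  move=> xA i; have /rowP/(_ i) := xA; rewrite !mxE (bigD1 i) //= => /eqP.
  by rewrite addr_eq0 => /eqP h; rewrite mulNr mulrC h opprK.
have dom (x : 'rV[R]_n.+1) : x *m A = 0 -> x 0 ord0 = 0 -> x = 0.
  move=> xA x0; case: (@arg_maxP _ _ _ ord0 predT (fun i => `|x 0 i|)) => // i _ imax0.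
  have imax j : `|x 0 j| <= `|x 0 i| by exact: imax0.
  have [i0|i0] := eqVneq (x 0 i) 0.
    apply/rowP => j; have := imax j; rewrite i0 normr0 normr_le0 => /eqP ->.
    by rewrite mxE.
  have ine : i != ord0 by apply: contra_neq i0 => ->.
  have M0 : 0 < `|x 0 i| by rewrite normr_gt0.
  have := congr1 Num.norm (eq0 x xA i); rewrite normrM ger0_norm; last first.
    have := diag i ine; lra.
  move=> e; suff : - A i i * `|x 0 i| <= n.+1%:R * d * `|x 0 i|.
    by rewrite ler_pM2r // => h; exfalso; have := diag i ine; lra.
  rewrite e; apply: le_trans (ler_norm_sum _ _ _) _.
  apply: (le_trans _ (ler_wpM2r (ltW M0) (offd i))); rewrite mulr_suml.
  apply: ler_sum => j ji; rewrite normrM mulrC (ger0_norm (Apos _ _ ji)).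
  by rewrite ler_wpM2l ?Apos ?imax.
have : eigenvalue A 0.
  rewrite -mem_spec sA; apply/codomP; exists ord0; by rewrite oppr0.
case/eigenvalueP => w wA w0; rewrite scale0r in wA.
have w00 : w 0 ord0 != 0 by apply: contra_neq w0; exact: dom.
pose u := (w 0 ord0)^-1 *: w.
have uA : u *m A = 0 by rewrite -scalemxAl wA scaler0.
have u00 : u 0 ord0 = 1 by rewrite mxE mulVf.
case: (@arg_minP _ _ _ ord0 predT (fun i => u 0 i)) => // i _ imin0.
have imin j : u 0 i <= u 0 j by exact: imin0.
have u_pos : positive_row u.
  have [i0 j|i0] := ltP 0 (u 0 i); first by apply: lt_le_trans (imin j).
  have ine : i != ord0 by apply: contraTneq i0 => ->; rewrite u00 -ltNge.
  have ui0 : u 0 i = 0.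
    apply/eqP; rewrite eq_le i0 /=.
    have H : \sum_(j | j != i) A j i * u 0 i <= - A i i * u 0 i.
      rewrite (eq0 u uA i); apply: ler_sum => j ji.
      by rewrite mulrC ler_wpM2r ?Apos ?imin.
    move: H; rewrite -mulr_suml -subr_ge0 -mulrBl.
    by rewrite pmulr_rge0 //; have := offd i; have := diag i ine; lra.
  have upos j : 0 <= u 0 j by rewrite -ui0 imin.
  pose C := [set j | u 0 j == 0].
  case: (Gc C); split.
  - by apply/card_gt0P; exists i; rewrite inE ui0.
  - have := max_card (mem C); rewrite card_ord leq_eqVlt => /orP[/eqP cC|//].
    have : ord0 \in C.
      have -> : C = finset.setT by apply/eqP; rewrite eqEcard finset.subsetT cardsT card_ord cC leqnn.
      by rewrite inE.
    by rewrite inE u00 oner_eq0.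
  move=> j l; rewrite !inE => /eqP uj ul.
  have jl : l != j by apply: contraNneq ul => ->; rewrite uj.
  have := eq0 u uA j; rewrite uj mulr0 => /esym/eqP.
  rewrite psumr_eq0 => [/allP/(_ l)|p pj]; last by rewrite mulr_ge0 ?upos ?Apos.
  rewrite mem_index_enum jl mulf_eq0 (negPf ul) /= => /(_ isT)/eqP Al.
  by rewrite edge_sym -AG // Al eqxx.
exists A, u; split.
  split=> // a; rewrite -mem_spec sA => /codomP[j ->]; exact: mem_negs.
move=> x x0 xA; apply/eqP => xu.
have e : x - x 0 ord0 *: u = 0.
  apply: dom; first by rewrite mulmxBl -scalemxAl xA uA scaler0 subr0.
  by rewrite 3!mxE u00 mulr1 subrr.
have xE : x = x 0 ord0 *: u by apply/eqP; rewrite -subr_eq0 e.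
have : (x 0 ord0 *: (u *m u^T)) 0 0 = 0 by rewrite scalemxAl -xE xu mxE.
rewrite mxE => /eqP; rewrite mulf_eq0 (gt_eqF (positive_row_norm u_pos)) orbF => /eqP z.
by rewrite xE z scale0r eqxx in x0.
Qed.

Lemma perron_isog m n (F : sgraph m) (G : sgraph n) A u : isog F G -> perron F A u ->
  exists A' u', perron G A' u' /\ forall a, eigenvalue A' a -> eigenvalue A a.
Proof.
move=> FG; have mn := isog_size FG; case: FG => f [g fK gK] fE.
case=> [[As AF] uA u0 Ae].
pose A' := \matrix_(i, j) A (g i) (g j); pose u' := \row_i u 0 (g i).
have mulE (w : 'rV[R]_n) : (\row_i w 0 (f i)) *m A = \row_i (w *m A') 0 (f i).
  apply/rowP => j; rewrite !mxE [RHS](reindex f) /=; last by exists g => ? _; rewrite ?fK ?gK.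
  by apply: eq_bigr => i _; rewrite !mxE !fK.
have inj (w w' : 'rV[R]_n) : \row_i w 0 (f i) = \row_i w' 0 (f i) -> w = w'.
  by move/rowP => h; apply/rowP => i; have := h (g i); rewrite !mxE gK.
have eig a : eigenvalue A' a -> eigenvalue A a.
  case/eigenvalueP => w wA w0; apply/eigenvalueP; exists (\row_i w 0 (f i)).
    by rewrite mulE wA; apply/rowP => i; rewrite !mxE.
  apply: contra_neq w0 => h; apply: inj; rewrite h.
  by apply/rowP => i; rewrite !mxE.
exists A', u'; split=> //; split.
- split=> [|i j ij]; first by apply/matrixP => i j; rewrite !mxE -{1}As mxE.
  by rewrite mxE AF ?(can_eq gK) // -fE !gK.
- apply: inj; rewrite -mulE.
  have -> : \row_i u' 0 (f i) = u by apply/rowP => i; rewrite !mxE fK.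
  by rewrite uA; apply/rowP => i; rewrite !mxE.
- by move=> i; rewrite mxE.
- by move=> a /eig/Ae; rewrite [in negs R m]mn.
Qed.

(** A connected graph has a simple top eigenvalue. Otherwise split the graph in
    two parts; their spectra are nested, so the union has fewer eigenvalues than
    vertices. Either way one value is saved in the joins below. *)
Lemma perron_exists n (G : sgraph n.+1) : exists A u, perron G A u /\
  (simple_top A u \/ forall a, eigenvalue A a -> a \in negs R n).
Proof.
elim/ltn_ind: n G => n IH G.
have [Gc|] := pselect (connectedg G).
  by have [A [u [pA sA]]] := perron_connected Gc; exists A, u; split=> //; left.
move/existsNP => [C /contrapT /separated_gunion[G1 [G2 [iso [c1 c2 c12]]]]].
move: #|C| #|~: C|%SET G1 G2 iso c1 c2 c12 => [|p] // [|r] // G1 G2 iso _ _ prn.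
have [|A [u [[GA uA u0 Ae] _]]] := IH p _ G1; first by lia.
have [|B [v [[GB vB v0 Be] _]]] := IH r _ G2; first by lia.
have P0 : perron (gunion G1 G2) (block_mx A 0 0 B) (row_mx u v).
  split.
  - exact: matrix_of_gunion.
  - by rewrite mul_row_block !mulmx0 addr0 add0r uA vB row_mx0.
  - by move=> i; rewrite mxE; case: fintype.split => j; rewrite ?u0 ?v0.
  move=> a /eigenvalueP[w wA w0].
  case: (block_eigenvector w0 wA) => [/Ae|/Be]; apply: sub_negs; lia.
have [A' [u' [pA' eA']]] := perron_isog iso P0.
exists A', u'; split=> //; right => a /eA'/eigenvalueP[w wA w0].
case: (block_eigenvector w0 wA) => [/Ae|/Be]; apply: sub_negs; lia.
Qed.

(** Gluing A and B by a multiple of u^T v fills all positions between the two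
    sides. Orthogonally to u and v nothing changes, and on the plane spanned by
    u and v the eigenvalues solve (a - s) (a - t) = g, with g > 0 at choice. *)
Lemma gjoin_q_le m n (G : sgraph m.+1) (H : sgraph n.+1) (A : 'M[R]_m.+1) (B : 'M[R]_n.+1)
    (u : 'rV_m.+1) (v : 'rV_n.+1) (s t g : R) (l : seq R) :
  matrix_of G A -> matrix_of H B -> positive_row u -> positive_row v ->
  u *m A = s *: u -> v *m B = t *: v -> 0 < g ->
  (forall a (x : 'rV_m.+1), x != 0 -> x *m A = a *: x -> x *m u^T = 0 -> a \in l) ->
  (forall a (x : 'rV_n.+1), x != 0 -> x *m B = a *: x -> x *m v^T = 0 -> a \in l) ->
  (forall a, (a - s) * (a - t) = g -> a \in l) ->
  (q R (gjoin G H) <= size l)%N.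
Proof.
move=> [As AG] [Bs BH] u0 v0 uA vB g0 lA lB lg.
have nu := positive_row_norm u0; have nv := positive_row_norm v0.
set p := (u *m u^T) 0 0 in nu; set r := (v *m v^T) 0 0 in nv.
have uu : u *m u^T = p%:M by rewrite [LHS]mx11_scalar.
have vv : v *m v^T = r%:M by rewrite [LHS]mx11_scalar.
pose c := Num.sqrt (g / (p * r)).
have c2 : c ^+ 2 * p * r = g.
  by rewrite sqr_sqrtr; [field; rewrite !gt_eqF | rewrite divr_ge0 ?mulr_ge0 // ltW].
have c0 : 0 < c by rewrite sqrtr_gt0 divr_gt0 ?mulr_gt0.
pose M := block_mx A (c *: (u^T *m v)) (c *: (v^T *m u)) B.
have GM : matrix_of (gjoin G H) M.
  split; first by rewrite tr_block_mx As Bs !linearZ /= !trmx_mul !trmxK.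
  have prod (m' n' : nat) (x : 'rV[R]_m') (y : 'rV[R]_n') i j :
      (x^T *m y) i j = x 0 i * y 0 j by rewrite mxE big_ord1 !mxE.
  move=> i j; case: (split_ordP i) => i' ->; case: (split_ordP j) => j' ->;
    rewrite gjoinE ?block_mxEul ?block_mxEur ?block_mxEdl ?block_mxEdr ?eq_shift.
  - exact: AG.
  - by rewrite mxE prod gt_eqF // !mulr_gt0.
  - by rewrite mxE prod gt_eqF // !mulr_gt0.
  - exact: BH.
apply: leq_trans (q_le GM) _; apply: q_mx_le_seq => a w.
rewrite -[w]hsubmxK; move: (lsubmx w) (rsubmx w) => x y {w} w0.
rewrite mul_row_block scale_row_mx => /eq_row_mx[e1 e2].
pose xu := (x *m u^T) 0 0; pose yv := (y *m v^T) 0 0.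
have xuE : x *m u^T = xu%:M by rewrite [LHS]mx11_scalar.
have yvE : y *m v^T = yv%:M by rewrite [LHS]mx11_scalar.
rewrite -scalemxAr mulmxA yvE mul_scalar_mx in e1.
rewrite -scalemxAr mulmxA xuE mul_scalar_mx in e2.
have uAt : A *m u^T = s *: u^T by rewrite -{1}As -trmx_mul uA linearZ.
have vBt : B *m v^T = t *: v^T by rewrite -{1}Bs -trmx_mul vB linearZ.
have f1 : s * xu + c * yv * p = a * xu.
  have := congr1 (fun z : 'rV_m.+1 => (z *m u^T) 0 0) e1.
  rewrite /= mulmxDl -mulmxA uAt -!scalemxAr -!scalemxAl xuE uu !mxE !eqxx !mulr1n.
  by move=> <-; rewrite mulrA.
have f2 : c * xu * r + t * yv = a * yv.
  have := congr1 (fun z : 'rV_n.+1 => (z *m v^T) 0 0) e2.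
  rewrite /= mulmxDl -mulmxA vBt -!scalemxAr -!scalemxAl yvE vv !mxE !eqxx !mulr1n.
  by move=> <-; rewrite mulrA.
have [xu0|xu0] := eqVneq xu 0.
  have yv0 : yv = 0.
    move: f1; rewrite xu0 !mulr0 add0r => /eqP; rewrite !mulf_eq0.
    by rewrite (gt_eqF c0) (gt_eqF nu) orbF /= => /eqP.
  rewrite xu0 yv0 !scale0r !scaler0 addr0 add0r in e1 e2.
  have [x0|x0] := eqVneq x 0.
    apply: (lB _ y) => //; last by rewrite yvE yv0 raddf0.
    by apply: contra_neq w0 => y0; rewrite x0 y0 row_mx0.
  by apply: (lA _ x) => //; rewrite xuE xu0 raddf0.
apply: lg; apply: (mulfI xu0); rewrite -c2.
have g1 : (a - s) * xu = c * yv * p by rewrite mulrBl -f1; ring.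
have g2 : (a - t) * yv = c * xu * r by rewrite mulrBl -f2; ring.
transitivity ((a - t) * ((a - s) * xu)); first by ring.
rewrite g1; transitivity (c * p * ((a - t) * yv)); first by ring.
by rewrite g2; ring.
Qed.

(** With b the larger number of vertices, the union has q at most b, so q at
    most a + 2 is needed for the join, a being the smaller one. If b is at most
    a + 1, the spectra 0, -1, ... with s = t = 0 and g = 1 produce only the new
    value 1, so b + 1 values suffice. If b = a + 2, one value less is needed.
    Either B has spectrum in 0, ..., 2 - b, and the same choice works; or
    orthogonally to v only -1, ..., 1 - b occur, and one shifts A by -1 and
    takes s = -1, t = 0, g = 2, for which the two new eigenvalues are 1 and -2.
    *)
Theorem union_join_q m n (G G' : sgraph m) (H H' : sgraph n) :
  (m <= n + 2)%N -> (n <= m + 2)%N ->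
  (q R (gunion G H) + q R (gjoin G' H') <= m + n + 2)%N.
Proof.
wlog mn : m n G G' H H' / (m <= n)%N.
  move=> W h1 h2; have [?|/ltnW ?] := leqP m n; first exact: W.
  by rewrite (q_isog R (isog_gunionC G H)) (q_isog R (isog_gjoinC G' H')) [(m + n)%N]addnC W.
move=> _ nm.
have qu := gunion_q_le R G H; rewrite (maxn_idPr mn) in qu.
have qj := q_le_size R (gjoin G' H').
case: m n G G' H H' mn nm qu qj => [|m] [|n] G G' H H' mn nm qu qj //; try lia.
case: n H H' mn nm qu qj => [|n] H H' mn nm qu qj; first by lia.
have [A [u [[GA uA u0 Ae] _]]] := perron_exists G'.
have [B [v [[HB vB v0 Be] Bt]]] := perron_exists H'.
have Ae' a (x : 'rV_m.+1) : x != 0 -> x *m A = a *: x -> a \in negs R m.+1.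
  by move=> x0 xA; apply: Ae; apply/eigenvalueP; exists x.
have Be' a (x : 'rV_n.+2) : x != 0 -> x *m B = a *: x -> a \in negs R n.+2.
  by move=> x0 xB; apply: Be; apply/eigenvalueP; exists x.
have uA0 : u *m A = 0 *: u by rewrite scale0r.
have vB0 : v *m B = 0 *: v by rewrite scale0r.
have sq1 (l : seq R) : 1 \in l -> -1 \in l -> forall a, (a - 0) * (a - 0) = 1 -> a \in l.
  move=> l1 lN1 a /eqP; rewrite !subr0 -expr2 sqrf_eq1 => /orP[] /eqP -> //.
have sz k : size (1 :: negs R k) = k.+1 by rewrite -cat1s size_cat size_negs.
have [n1|n2] : (n <= m)%N \/ n = m.+1 by lia.
  have : (q R (gjoin G' H') <= size (1%R :: negs R n.+2))%N.
    apply: (gjoin_q_le GA HB u0 v0 uA0 vB0 ltr01).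
    - move=> a x x0 xA _; rewrite inE; apply/orP; right.
      by apply: sub_negs (Ae' _ _ x0 xA); lia.
    - by move=> a x x0 xB _; rewrite inE (Be' _ _ x0 xB) orbT.
    apply: sq1; rewrite inE ?eqxx //; apply/orP; right; exact: (@mem_negs R n.+2 1).
  by rewrite sz; lia.
suff : (q R (gjoin G' H') <= n.+2)%N by lia.
case: Bt => [Bs|Bn].
  pose l : seq R := 1 :: [seq - i.+1%:R | i <- iota 0 n.+1].
  have li i : (0 < i <= n.+1)%N -> - i%:R \in l.
    case: i => // i /andP[_ ilt]; rewrite inE; apply/orP; right.
    by apply/mapP; exists i => //; rewrite mem_iota.
  apply: (@leq_trans (size l)); last by rewrite /= size_map size_iota.
  pose A1 := A - 1%:M.
  have A1E (x : 'rV[R]_m.+1) : x *m A1 = x *m A - x by rewrite mulmxBr mulmx1.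
  have GA1 : matrix_of G' A1.
    case: GA => As AG; split; first by rewrite linearB /= As trmx1.
    by move=> i j ij; rewrite !mxE (negPf ij) subr0 AG.
  apply: (gjoin_q_le (s := -1) (g := 2) GA1 HB u0 v0 _ vB0) => //.
  - by rewrite A1E uA sub0r scaleN1r.
  - move=> a x x0 xA _; have /negsP[i im ai] : a + 1 \in negs R m.+1.
      by apply: (Ae' _ x x0); rewrite scalerDl scale1r -xA A1E subrK.
    have -> : a = - i.+1%:R by rewrite -natr1 opprD -ai addrK.
    by apply: li; lia.
  - move=> a x x0 xB xv; have /negsP[[|i] iN ai] := Be' _ _ x0 xB.
      by have := Bs x x0; rewrite xB ai oppr0 scale0r xv eqxx => /(_ erefl).
    by rewrite ai; apply: li.
  move=> a; rewrite subr0 opprK => e.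
  have /eqP : (a - 1) * (a + 2) = 0 by rewrite mulrC; transitivity ((a + 1) * a - 2); [ring | rewrite e subrr].
  rewrite mulf_eq0 subr_eq0 addr_eq0 => /orP[] /eqP ->; first by rewrite inE eqxx.
  by apply: (li 2); lia.
apply: (@leq_trans (size (1%R :: negs R n.+1))); last by rewrite sz.
apply: (gjoin_q_le GA HB u0 v0 uA0 vB0 ltr01).
- move=> a x x0 xA _; rewrite inE; apply/orP; right.
  by apply: sub_negs (Ae' _ _ x0 xA); lia.
- move=> a x x0 xB _; rewrite inE (Bn a) ?orbT //.
  by apply/eigenvalueP; exists x.
apply: sq1; rewrite inE ?eqxx //; apply/orP; right; apply: (@mem_negs R n.+1 1); lia.
Qed.

End Joins.

(** * Lower bounds, and the four exceptional graphs *)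

Section LowerBounds.
Variable R : realType.
Local Open Scope ring_scope.
Local Notation "M ^ f" := (map_mx f M).

Lemma horner_mx_eigenvector (F : fieldType) n (A : 'M[F]_n.+1) a (v : 'rV_n.+1) p :
  v *m A = a *: v -> v *m horner_mx A p = p.[a] *: v.
Proof.
move=> vA; elim/poly_ind: p => [|p c IH]; first by rewrite raddf0 mulmx0 horner0 scale0r.
rewrite rmorphD rmorphM /= horner_mx_X horner_mx_C mulmxDr mulmxA IH -scalemxAl vA.
by rewrite mul_mx_scalar scalerA -scalerDl !hornerE.
Qed.

(** By the spectral theorem this polynomial with simple roots annihilates a
    symmetric matrix; it has degree q(A). *)
Definition spec_poly n (A : 'M[R]_n) : {poly R} := \prod_(a <- spec A) ('X - a%:P).

Lemma spec_poly_annihilates n (A : 'M[R]_n.+1) : A^T = A -> horner_mx A (spec_poly A) = 0.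
Proof.
move=> As; pose f : {rmorphism R -> R[i]} := real_complex R; pose C : numClosedFieldType := R[i].
pose Ac : 'M[C]_n.+1 := A ^ f.
have Areal : Ac \is a mxOver Num.real.
  by apply/mxOverP => i j; rewrite mxE; apply/complex_realP; exists (A i j).
have Asym : Ac \is symmetricmx.
  apply/is_hermitianmxP; rewrite expr0 scale1r map_mx_id //.
  by apply/matrixP => i j; rewrite !mxE -{1}As mxE.
have Aherm := realsym_hermsym Asym Areal.
have /orthomx_spectralP AE := hermitian_normalmx Aherm.
have dreal := hermitian_spectral_diag_real Aherm.
set P := spectralmx Ac in AE; set d := spectral_diag Ac in AE dreal.
have Pu : P \in unitmx := spectral_unit Ac.
apply: (map_mx_inj (f := f)); rewrite map_mx0 map_horner_mx -/Ac; set p := map_poly f _.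
have Pp : P *m horner_mx Ac p = 0.
  apply/row_matrixP => i; rewrite row_mul row0.
  have PA : row i P *m Ac = d 0 i *: row i P.
    rewrite -row_mul AE !mulmxA mulmxV // mul1mx row_mul.
    by rewrite row_diag_mx -scalemxAl -rowE.
  have P0 : row i P != 0.
    apply/negP => /eqP r0; have /row_freeP[Q' PQ] : row_free P.
      by rewrite row_free_unit.
    have /rowP/(_ i) : row i (P *m Q') = 0 by rewrite row_mul r0 mul0mx.
    by rewrite PQ !mxE eqxx => /eqP; rewrite oner_eq0.
  rewrite (horner_mx_eigenvector _ PA).
  have /complex_realP[r dr] := mxOverP dreal 0 i.
  have rs : r \in spec A.
    rewrite mem_spec -(eigenvalue_map f); apply/eigenvalueP.
    by exists (row i P) => //; rewrite PA dr.
  rewrite dr /p horner_map /= /spec_poly.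
  have : root (\prod_(a <- spec A) ('X - a%:P)) r by rewrite root_prod_XsubC.
  by move/rootP => ->; rewrite rmorph0 scale0r.
by rewrite -[LHS]mul1mx -(mulVmx Pu) -mulmxA Pp mulmx0.
Qed.

Lemma horner_mx_sum n (A : 'M[R]_n.+1) (p : {poly R}) :
  horner_mx A p = \sum_(i < size p) p`_i *: A ^+ i.
Proof.
rewrite -{1}[p]coefK poly_def linear_sum /=; apply: eq_bigr => i _.
by rewrite linearZ /= rmorphXn /= horner_mx_X.
Qed.

(** If q(A) were at most d, the d-th power of A would be a combination of the
    lower powers. *)
Lemma spec_size_gt n (A : 'M[R]_n.+1) i j d : A^T = A ->
  (forall s, (s < d)%N -> (A ^+ s) i j = 0) -> (A ^+ d) i j != 0 -> (d < q_mx A)%N.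
Proof.
move=> As low top; rewrite ltnNge; apply: contra top => qd.
pose p := spec_poly A * 'X^(d - q_mx A).
have sp : size (spec_poly A) = (q_mx A).+1 by rewrite size_prod_XsubC size_spec.
have mp : spec_poly A \is monic by apply: monic_prod_XsubC.
have szp : size p = d.+1.
  rewrite size_monicM ?monic_neq0 ?monicXn // sp size_polyXn addSn /= addnS.
  by rewrite subnKC.
have lp : p`_d = 1.
  have : lead_coef p = 1 by apply/monicP; rewrite monicMl ?monicXn.
  by rewrite /lead_coef szp.
have : horner_mx A p = 0 by rewrite rmorphM /= spec_poly_annihilates // mul0r.
rewrite horner_mx_sum szp => /matrixP/(_ i j); rewrite summxE big_ord_recr /=.
rewrite big1 => [|s _]; last by rewrite mxE low // mulr0.
by rewrite add0r lp scale1r mxE => ->.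
Qed.

(** A shortest path x_0, ..., x_d, unique between its ends, forces q > d: the
    entry of A^s at (x_0, x_d) is 0 for s < d, and for s = d it is the product
    of the entries of A along the path. The function h plays the role of the
    distance from x_0. *)
Lemma geodesic_q_gt n (G : sgraph n.+1) (h : 'I_n.+1 -> nat) (x : nat -> 'I_n.+1) d :
  (forall u v, G u v -> (h v <= (h u).+1)%N) ->
  (forall s, (s <= d)%N -> h (x s) = s) ->
  (forall v, h v = 0%N -> v = x 0%N) ->
  (forall s u, (s < d)%N -> G u (x s.+1) -> h u = s -> u = x s) ->
  (forall s, (s < d)%N -> G (x s) (x s.+1)) ->
  (d < q R G)%N.
Proof.
move=> hG hx h0 uni xG; have [A [As AG] <-] := q_attained R G.
have A0 u v : ~~ G u v -> u != v -> A u v = 0.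
  by move=> Guv uv; apply/eqP; rewrite -[_ == 0]negbK AG.
have far s v : (s < h v)%N -> (A ^+ s) (x 0%N) v = 0.
  elim: s v => [|s IH] v sv; first by rewrite expr0 !mxE; case: eqP sv => [<-|//]; rewrite hx.
  rewrite exprSr mxE big1 // => u _.
  have [us|us] := ltnP s (h u); first by rewrite IH ?mul0r.
  rewrite A0 ?mulr0 //; last by apply: contraTneq sv => <-; rewrite -leqNgt (leq_trans us).
  by apply/negP => /hG; lia.
apply: (@spec_size_gt _ A (x 0%N) (x d)) => // [s sd|]; first by rewrite far ?hx.
suff H s : (s <= d)%N -> (A ^+ s) (x 0%N) (x s) != 0 by exact: H.
elim: s => [|s IH] sd; first by rewrite expr0 mxE eqxx oner_eq0.
rewrite exprSr mxE (bigD1 (x s)) //= big1 => [|u us].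
  rewrite addr0 mulf_neq0 ?IH ?(ltnW sd) // AG ?xG //.
  by apply: contraTneq (xG s sd) => <-; rewrite edge_irr.
have [su|su] := ltnP s (h u); first by rewrite far ?mul0r.
rewrite A0 ?mulr0 //; last by apply: contraTneq su => ->; rewrite hx // ltnn.
apply/negP => Gu; have hu : h u = s.
  by have := hG _ _ Gu; rewrite hx // => ?; lia.
by case/eqP: us; apply: uni Gu hu.
Qed.

Lemma path_q_gt n : (n < q R (pathg n.+1))%N.
Proof.
apply: (@geodesic_q_gt _ _ (fun i => i) (fun s => inord s)).
- by move=> u v /= /orP[] /eqP; lia.
- by move=> s sn; rewrite inordK.
- by move=> v v0; apply/val_inj; rewrite /= inordK.
- move=> s u sn _ us; apply/val_inj; rewrite /= inordK //; exact: ltnW.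
by move=> s sn; rewrite /= /path_rel !inordK ?eqxx //; exact: ltnW.
Qed.

Lemma house_q_gt : (2 < q R (compl (pathg 5)))%N.
Proof.
apply: (@geodesic_q_gt _ _ (fun i => nth 0 [:: 2; 0; 2; 1; 1] i)%N
  (fun s => nth ord0 [:: inord 1; inord 4; inord 2] s)).
- by case=> [[|[|[|[|[|i]]]]] hi] // [[|[|[|[|[|j]]]]] hj].
- by case=> [|[|[|s]]] // _; rewrite /= inordK.
- by case=> [[|[|[|[|[|i]]]]] hi] //= _; apply/val_inj; rewrite /= inordK.
- case=> [|[|s]] // [[|[|[|[|[|i]]]]] hi] //= _; rewrite /compl_rel /= /path_rel -?(inj_eq val_inj) /= ?inordK // => _ _; apply/val_inj; by rewrite /= inordK.
by case=> [|[|s]] // _; rewrite /= /compl_rel /= /path_rel -(inj_eq val_inj) /= !inordK.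
Qed.

Lemma co_P4_q_gt : (3 < q R (compl (pathg 4)))%N.
Proof.
apply: (@geodesic_q_gt _ _ (fun i => nth 0 [:: 1; 3; 0; 2] i)%N
  (fun s => nth ord0 [:: inord 2; inord 0; inord 3; inord 1] s)).
- by case=> [[|[|[|[|i]]]] hi] // [[|[|[|[|j]]]] hj].
- by case=> [|[|[|[|s]]]] // _; rewrite /= inordK.
- by case=> [[|[|[|[|i]]]] hi] //= _; apply/val_inj; rewrite /= inordK.
- by case=> [|[|[|s]]] // [[|[|[|[|i]]]] hi] //= _; rewrite /compl_rel /= /path_rel
    -?(inj_eq val_inj) /= ?inordK // => _ _; apply/val_inj; rewrite /= inordK.
by case=> [|[|[|s]]] // _; rewrite /= /compl_rel /= /path_rel -(inj_eq val_inj) /= !inordK.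
Qed.

Lemma bull_q_gt : (3 < q R T22)%N.
Proof.
apply: (@geodesic_q_gt _ _ (fun i => nth 0 [:: 0; 1; 2; 2; 3] i)%N
  (fun s => nth ord0 [:: inord 0; inord 1; inord 3; inord 4] s)).
- by case=> [[|[|[|[|[|i]]]]] hi] // [[|[|[|[|[|j]]]]] hj].
- by case=> [|[|[|[|s]]]] // _; rewrite /= inordK.
- by case=> [[|[|[|[|[|i]]]]] hi] //= _; apply/val_inj; rewrite /= inordK.
- by case=> [|[|[|s]]] // [[|[|[|[|[|i]]]]] hi] //= _; rewrite /T22_rel /= /path_rel
    /= ?inordK // => _ _; apply/val_inj; rewrite /= inordK.
by case=> [|[|[|s]]] // _; rewrite /= /T22_rel /= /path_rel /= !inordK.
Qed.

Lemma co_bull_q_gt : (3 < q R (compl T22))%N.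
Proof.
apply: (@geodesic_q_gt _ _ (fun i => nth 0 [:: 1; 3; 2; 0; 2] i)%N
  (fun s => nth ord0 [:: inord 3; inord 0; inord 4; inord 1] s)).
- by case=> [[|[|[|[|[|i]]]]] hi] // [[|[|[|[|[|j]]]]] hj].
- by case=> [|[|[|[|s]]]] // _; rewrite /= inordK.
- by case=> [[|[|[|[|[|i]]]]] hi] //= _; apply/val_inj; rewrite /= inordK.
- by case=> [|[|[|s]]] // [[|[|[|[|[|i]]]]] hi] //= _; rewrite /compl_rel /= /T22_rel /= /path_rel
    -?(inj_eq val_inj) /= ?inordK // => _ _; apply/val_inj; rewrite /= inordK.
by case=> [|[|[|s]]] // _; rewrite /= /compl_rel /= /T22_rel /= /path_rel -(inj_eq val_inj) /= !inordK.
Qed.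

(** The values q are at least 4 and 4 for P_4, 5 and 3 for P_5, and 4 and 4 for
    T_{2,2}. *)
Lemma exceptions_q n (F : sgraph n) :
  [\/ isog F (pathg 4), isog F (pathg 5), isog F (compl (pathg 5)) | isog F T22] ->
  (n + 2 < q R F + q R (compl F))%N.
Proof.
have P4 := path_q_gt 3; have P5 := path_q_gt 4; have C5 := house_q_gt.
have C4 := co_P4_q_gt; have B := bull_q_gt; have CB := co_bull_q_gt.
case=> iso; have n_eq := isog_size iso; subst n;
  rewrite (q_isog R iso) (q_isog R (isog_compl iso)).
- by lia.
- by lia.
- rewrite -(q_isog R (isog_compl_compl (pathg 5))); lia.
by lia.
Qed.

End LowerBounds.

(** * A nonnegative square root *)

Section MatrixLimits.
Variable R : realType.
Local Open Scope ring_scope.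

Definition cvgmx m n (A_ : nat -> 'M[R]_(m, n)) (L : 'M[R]_(m, n)) : Prop :=
  forall i j, ((fun t => A_ t i j) @ \oo --> L i j)%classic.

Lemma cvgmx_unique m n (A_ : nat -> 'M[R]_(m, n)) L L' : cvgmx A_ L -> cvgmx A_ L' -> L = L'.
Proof.
move=> AL AL'; apply/matrixP => i j; apply: cvg_unique (AL i j) (AL' i j).
exact: norm_hausdorff.
Qed.

Lemma cvgmx_cst m n (A : 'M[R]_(m, n)) : cvgmx (fun=> A) A.
Proof. by move=> i j; apply: cvg_cst. Qed.

Lemma cvg_finsum (I : finType) (u : I -> nat -> R) (l : I -> R) :
  (forall i, (u i @ \oo --> l i)%classic) ->
  ((fun t => \sum_i u i t) @ \oo --> \sum_i l i)%classic.
Proof.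
move=> ul; elim: (index_enum I) => [|i s IH].
  have -> : (fun t => \sum_(i <- [::]) u i t) = (fun=> 0) by apply/funext => t; rewrite big_nil.
  by rewrite big_nil; apply: cvg_cst.
have -> : (fun t => \sum_(j <- i :: s) u j t) = (fun t => u i t + \sum_(j <- s) u j t).
  by apply/funext => t; rewrite big_cons.
by rewrite big_cons; apply: cvgD.
Qed.

Lemma cvgmxM m n p (A_ : nat -> 'M[R]_(m, n)) (B_ : nat -> 'M[R]_(n, p)) A B :
  cvgmx A_ A -> cvgmx B_ B -> cvgmx (fun t => A_ t *m B_ t) (A *m B).
Proof.
move=> AA BB i j.
have -> : (fun t => (A_ t *m B_ t) i j) = (fun t => \sum_k A_ t i k * B_ t k j).
  by apply/funext => t; rewrite mxE.
by rewrite mxE; apply: cvg_finsum => k; apply: cvgM.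
Qed.

Lemma cvgmxD m n (A_ B_ : nat -> 'M[R]_(m, n)) A B :
  cvgmx A_ A -> cvgmx B_ B -> cvgmx (fun t => A_ t + B_ t) (A + B).
Proof.
move=> AA BB i j.
have -> : (fun t => (A_ t + B_ t) i j) = (fun t => A_ t i j + B_ t i j).
  by apply/funext => t; rewrite mxE.
by rewrite mxE; apply: cvgD.
Qed.

Lemma cvgmxZ m n (a_ : nat -> R) (a : R) (A_ : nat -> 'M[R]_(m, n)) A :
  (a_ @ \oo --> a)%classic -> cvgmx A_ A -> cvgmx (fun t => a_ t *: A_ t) (a *: A).
Proof.
move=> aa AA i j.
have -> : (fun t => (a_ t *: A_ t) i j) = (fun t => a_ t * A_ t i j).
  by apply/funext => t; rewrite mxE.
by rewrite mxE; apply: cvgM.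
Qed.

Lemma cvgmx_tr m n (A_ : nat -> 'M[R]_(m, n)) A :
  cvgmx A_ A -> cvgmx (fun t => (A_ t)^T) A^T.
Proof.
move=> AA i j.
have -> : (fun t => (A_ t)^T i j) = (fun t => A_ t j i).
  by apply/funext => t; rewrite mxE.
by rewrite mxE; apply: AA.
Qed.

(** A matrix 1 - K with square 1 - e^2 W^2, where K is nonnegative: K is the
    increasing limit of K := (K^2 + e^2 W^2) / 2, started at 0. The fixed vector
    h of W keeps the iteration bounded, since on h it reduces to the scalar
    iteration p := (p^2 + e^2) / 2, which never exceeds e. All commutation
    relations of W^2 and the vanishing columns pass to the limit. *)
Lemma nonneg_square_root n (W : 'M[R]_n) (h : 'rV[R]_n) (e : R) :
  0 < e -> e < 1 -> W^T = W -> (forall i j, 0 <= W i j) ->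
  (forall i, 0 <= h 0 i) -> (forall i j, h 0 j = 0 -> W i j = 0) -> h *m W = h ->
  exists (K : 'M[R]_n) (p : R), [/\ K^T = K,
    forall i j, 0 <= K i j,
    K *m K + e ^+ 2 *: (W *m W) = 2 *: K,
    forall Z, Z *m (W *m W) = W *m W *m Z -> Z *m K = K *m Z
    & [/\ h *m K = p *: h, p ^+ 2 + e ^+ 2 = 2 * p, p < 1 & forall i j, h 0 j = 0 -> K i j = 0]].
Proof.
move=> e0 e1 Ws W0 h0 hW hWh.
pose V := e ^+ 2 *: (W *m W).
have V0 i j : 0 <= V i j.
  rewrite mxE mulr_ge0 ?sqr_ge0 // mxE; apply: sumr_ge0 => k _; exact: mulr_ge0.
have Vs : V^T = V by rewrite linearZ /= trmx_mul Ws.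
have Vh i j : h 0 j = 0 -> V i j = 0.
  by move=> hj; rewrite !mxE big1 ?mulr0 // => k _; rewrite (hW _ _ hj) mulr0.
pose step (K : 'M[R]_n) := 2^-1 *: (K *m K + V).
pose K_ t := iter t step 0.
pose p_ t := iter t (fun p => (p ^+ 2 + e ^+ 2) / 2) 0.
have K_S t : K_ t.+1 = 2^-1 *: (K_ t *m K_ t + V) by [].
have half : 0 <= 2^-1 :> R by rewrite invr_ge0.
have K0 t i j : 0 <= K_ t i j.
  elim: t i j => [|t IH] i j; first by rewrite mxE.
  rewrite K_S mxE mulr_ge0 // mxE addr_ge0 // mxE.
  by apply: sumr_ge0 => k _; apply: mulr_ge0.
have Ks t : (K_ t)^T = K_ t.
  elim: t => [|t IH]; first by rewrite trmx0.
  by rewrite K_S linearZ /= linearD /= trmx_mul IH Vs.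
have Kh t i j : h 0 j = 0 -> K_ t i j = 0.
  move=> hj; elim: t i => [|t IH] i; first by rewrite mxE.
  by rewrite K_S 2!mxE Vh // mxE big1 ?addr0 ?mulr0 // => k _; rewrite IH mulr0.
have Khp t : h *m K_ t = p_ t *: h.
  elim: t => [|t IH]; first by rewrite mulmx0 scale0r.
  rewrite K_S -scalemxAr mulmxDr mulmxA IH -scalemxAl IH /V -scalemxAr mulmxA !hWh.
  by rewrite scalerA -scalerDl scalerA -expr2 mulrC.
have p0 t : 0 <= p_ t <= e.
  elim: t => [|t /andP[IH1 IH2]]; first by rewrite /= lexx ltW.
  rewrite /=; apply/andP; split.
    by rewrite divr_ge0 // addr_ge0 ?sqr_ge0.
  have : p_ t ^+ 2 <= e ^+ 2 by rewrite ler_sqr // nnegrE // ltW.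
  have : e ^+ 2 <= e by rewrite expr2 -[leRHS]mulr1 ler_pM2l // ltW.
  rewrite ler_pdivrMr //; lra.
have Kmon t i j : K_ t i j <= K_ t.+1 i j.
  elim: t i j => [|t IH] i j; first by rewrite [leLHS]mxE.
  rewrite [K_ t.+1]K_S [K_ t.+2]K_S !mxE ler_wpM2l // lerD2r.
  by apply: ler_sum => k _; rewrite ler_pM.
have Kbnd t i j : K_ t i j <= e * h 0 i / h 0 j.
  have [hj|hj] := eqVneq (h 0 j) 0; first by rewrite Kh // hj invr0 mulr0.
  have hj0 : 0 < h 0 j by rewrite lt_neqAle eq_sym hj h0.
  rewrite ler_pdivlMr //.
  have /rowP/(_ i) := Khp t; rewrite !mxE (bigD1 j) //= => E.
  have /andP[_ pe] := p0 t.
  apply: (@le_trans _ _ (p_ t * h 0 i)); last by rewrite ler_wpM2r.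
  rewrite -E -{2}(Ks t) mxE mulrC ler_wpDr //.
  by apply: sumr_ge0 => k _; rewrite mulr_ge0.
have Kcvg i j : exists l : R, ((fun t => K_ t i j) @ \oo --> l)%classic.
  exists (sup (range (fun t => K_ t i j))); apply: nondecreasing_cvgn.
    by apply/nondecreasing_seqP => t.
  by exists (e * h 0 i / h 0 j) => _ [t _ <-].
pose K : 'M[R]_n := \matrix_(i, j) sval (cid (Kcvg i j)).
have KK : cvgmx K_ K by move=> i j; rewrite mxE; exact: svalP (cid (Kcvg i j)).
have pcvg : exists l : R, (p_ @ \oo --> l)%classic.
  have pmon t : p_ t <= p_ t.+1.
    elim: t => [|t IH] /=; first by rewrite divr_ge0 // addr_ge0 ?sqr_ge0.
    have [/andP[a1 _] /andP[a2 _]] := (p0 t, p0 t.+1).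
    by rewrite ler_pM2r ?invr_gt0 // lerD2r ler_sqr ?nnegrE.
  exists (sup (range p_)); apply: nondecreasing_cvgn; first by apply/nondecreasing_seqP.
  by exists e => _ [t _ <-]; case/andP: (p0 t).
have [p pp] := pcvg.
exists K, p; split.
- apply: (cvgmx_unique _ KK).
  have -> : K_ = (fun t => (K_ t)^T) by apply/funext => t; rewrite Ks.
  exact: cvgmx_tr.
- by move=> i j; apply: cvgr_to_ge (KK i j) _; apply: nearW => t; apply: K0.
- have c1 : cvgmx (fun t => K_ t.+1) (2^-1 *: (K *m K + V)).
    apply: cvgmxZ; first exact: cvg_cst.
    by apply: cvgmxD; [exact: cvgmxM | exact: cvgmx_cst].
  have c2 : cvgmx (fun t => K_ t.+1) K by move=> i j; have := KK i j; rewrite -(cvg_shiftS (fun t => K_ t i j)).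
  by rewrite {3}(cvgmx_unique c2 c1) scalerA divff // scale1r.
- move=> Z ZW.
  have ZK t : Z *m K_ t = K_ t *m Z.
    elim: t => [|t IH]; first by rewrite mulmx0 mul0mx.
    rewrite K_S -scalemxAr -scalemxAl mulmxDr mulmxDl mulmxA IH -(mulmxA (K_ t) Z (K_ t)) IH mulmxA.
    by rewrite /V -scalemxAr ZW -scalemxAl.
  have c1 := cvgmxM (@cvgmx_cst _ _ Z) KK; have c2 := cvgmxM KK (@cvgmx_cst _ _ Z).
  apply: (cvgmx_unique c1).
  by have -> : (fun t => Z *m K_ t) = (fun t => K_ t *m Z) by apply/funext => t; rewrite ZK.
split.
- have c1 := cvgmxM (@cvgmx_cst _ _ h) KK; have c2 := cvgmxZ pp (@cvgmx_cst _ _ h).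
  apply: (cvgmx_unique c1).
  by have -> : (fun t => h *m K_ t) = (fun t => p_ t *: h) by apply/funext => t; rewrite Khp.
- have c1 : ((fun t => p_ t.+1) @ \oo --> (p ^+ 2 + e ^+ 2) / 2)%classic.
    apply: cvgM; last exact: cvg_cst.
    apply: cvgD; last exact: cvg_cst.
    by rewrite expr2; apply: cvgM.
  have c2 : ((fun t => p_ t.+1) @ \oo --> p)%classic by have := pp; rewrite -(cvg_shiftS p_).
  have pE := cvg_unique (@norm_hausdorff _ _) c2 c1.
  by rewrite {2}pE mulrC divfK.
- apply: le_lt_trans e1; apply: cvgr_to_le pp _; apply: nearW => t.
  by case/andP: (p0 t).
move=> i j hj; apply/eqP; rewrite eq_le; apply/andP; split.
  by apply: cvgr_to_le (KK i j) _; apply: nearW => t; rewrite Kh.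
by apply: cvgr_to_ge (KK i j) _; apply: nearW => t; apply: K0.
Qed.

End MatrixLimits.

(** * Complements of bipartite graphs *)

Section CoBipartite.
Variable R : realType.
Local Open Scope ring_scope.

Section Construction.
Variables (n : nat) (F : sgraph n) (c : 'I_n -> bool).
Hypothesis bip : forall i j, F i j -> c i != c j.

(** The bipartite complement of F with respect to the colouring c. *)
Definition bicompl i j := (c i != c j) && ~~ F i j.

Lemma bicompl_sym : symmetric bicompl.
Proof. by move=> i j; rewrite /bicompl eq_sym edge_sym. Qed.

Definition full i := [forall j, ~~ bicompl i j].

(* W is the normalised adjacency matrix of the bipartite complement, with the
   fixed vector h of square roots of degrees; S is the diagonal matrix of colour
   signs, which anticommutes with W *)
Let deg i : R := \sum_j (bicompl i j)%:R.
Let h : 'rV[R]_n := \row_i Num.sqrt (deg i).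
Let W : 'M[R]_n := \matrix_(i, j) if bicompl i j then (h 0 i * h 0 j)^-1 else 0.
Let sg i : R := if c i then 1 else -1.
Let S : 'M[R]_n := diag_mx (\row_i sg i).

Let deg_ge0 i : 0 <= deg i. Proof. by apply: sumr_ge0. Qed.

Let deg_gt0 i j : bicompl i j -> 0 < deg i.
Proof. by move=> ij; rewrite /deg (bigD1 j) //= ij ltr_pwDl ?ltr01 // sumr_ge0. Qed.

Let h_ge0 i : 0 <= h 0 i. Proof. by rewrite mxE sqrtr_ge0. Qed.

Let h_gt0 i j : bicompl i j -> 0 < h 0 i.
Proof. by move=> ij; rewrite mxE sqrtr_gt0 (deg_gt0 ij). Qed.

Let h_full i : full i = (h 0 i == 0).
Proof.
apply/forallP/eqP => [fi|hi j]; last by apply/negP => /h_gt0; rewrite hi ltxx.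
by rewrite mxE /deg big1 ?sqrtr0 // => j _; rewrite (negPf (fi j)).
Qed.

Let W_sym : W^T = W.
Proof. by apply/matrixP => i j; rewrite !mxE bicompl_sym mulrC. Qed.

Let W_ge0 i j : 0 <= W i j.
Proof. by rewrite mxE; case: ifP => // _; rewrite invr_ge0 mulr_ge0. Qed.

Let W_full i j : h 0 j = 0 -> W i j = 0.
Proof.
move/eqP; rewrite -h_full => /forallP/(_ i); rewrite bicompl_sym => ij.
by rewrite mxE (negPf ij).
Qed.

Let h_W : h *m W = h.
Proof.
apply/rowP => j; rewrite mxE.
have [hj|hj] := eqVneq (h 0 j) 0.
  by rewrite hj big1 // => i _; rewrite W_full // mulr0.
transitivity (deg j / h 0 j).
  rewrite /deg mulr_suml; apply: eq_bigr => i _; rewrite [W i j]mxE bicompl_sym.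
  case: ifP => [ij|_]; last by rewrite mulr0 mul0r.
  rewrite bicompl_sym in ij.
  by rewrite invfM mulrA divff ?mul1r // gt_eqF // (h_gt0 ij).
have -> : deg j = h 0 j ^+ 2 by rewrite mxE sqr_sqrtr.
by rewrite expr2 mulfK.
Qed.

Let S_mul (v : 'rV[R]_n) j : (v *m S) 0 j = v 0 j * sg j.
Proof. by rewrite mul_mx_diag !mxE. Qed.

Let SS : S *m S = 1%:M.
Proof.
apply/matrixP => i j; rewrite mul_mx_diag !mxE /sg.
case: eqP => [->|_]; rewrite ?mulr0n ?mul0r ?mulr1n //.
by case: (c j); rewrite ?mulrNN mulr1.
Qed.

Let S_sym : S^T = S. Proof. exact: tr_diag_mx. Qed.

Let SW : S *m W = - (W *m S).
Proof.
apply/matrixP => i j; rewrite mul_diag_mx mul_mx_diag !mxE /sg.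
case: (boolP (bicompl i j)) => [/andP[cij _]|_]; last by rewrite mulr0 mul0r oppr0.
by move: cij; case: (c i); case: (c j) => // _; rewrite ?mul1r ?mulr1 ?mulN1r ?mulrN1 ?opprK.
Qed.

Variables (al ga ga' : R) (e : R).
Hypotheses (e0 : 0 < e) (e1 : e < 1).
Variables (i0 j0 : 'I_n).
Hypothesis ij0 : bicompl i0 j0.

(** Without full vertices, M0 = S (1 - K) + e W has square 1, because S anticommutes
    with W and commutes with K; it has the right pattern between the colour
    classes, and inside them its entries, -K in one and K in the other, have
    constant sign but may vanish. Let x and y be the normalised restrictions of h
    to the classes, w and z the unit vectors carried by the full vertices. On the orthogonal complement of w, x, y, z the
    matrix is left unchanged, so its square stays 1 there. On their span it is
    replaced by the compression
      x |-> al x + e y + ga w,    y |-> e x - al y + ga' z,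
      w |-> ga x,    z |-> ga' y,
    where M0 acts by x |-> a x + e y, y |-> e x - a y, w |-> w, z |-> - z.
    As al < a, the change fills all positions inside a class between vertices that
    are not full; ga and ga' join these to the full vertices, and the change on w
    and z joins the full vertices to each other. *)
Theorem co_bipartite_matrix (a := Num.sqrt (1 - e ^+ 2)) :
  al < a -> ((exists i, c i && full i) -> ga != 0) -> ((exists i, ~~ c i && full i) -> ga' != 0) ->
  ((forall i, c i -> ~~ full i) -> ga = 0) -> ((forall i, ~~ c i -> ~~ full i) -> ga' = 0) ->
  exists2 M : 'M[R]_n, matrix_of (compl F) M &
    forall t (v : 'rV_n), v != 0 -> v *m M = t *: v ->
      t ^+ 2 = 1 \/ exists w x y z : R, [/\ w != 0 -> exists i, c i && full i,
        z != 0 -> exists i, ~~ c i && full i, [\/ w != 0, x != 0, y != 0 | z != 0] &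
        [/\ t * w = ga * x, t * x = al * x + e * y + ga * w,
            t * y = e * x - al * y + ga' * z & t * z = ga' * y]].
Proof.
move=> ala ga1 ga'1 ga0 ga'0.
have [K [p [Ks K0 KE Kcomm [hK pE p1 Kfull]]]] :=
  nonneg_square_root e0 e1 W_sym W_ge0 (fun i => h_ge0 i) W_full h_W.
have aE : a = 1 - p.
  rewrite /a; have -> : 1 - e ^+ 2 = (1 - p) ^+ 2.
    have -> : e ^+ 2 = 2 * p - p ^+ 2 by rewrite -pE addrAC subrr add0r.
    by ring.
  by rewrite sqrtr_sqr ger0_norm // subr_ge0 ltW.
have a0 : 0 < a by rewrite aE subr_gt0.
have SK : S *m K = K *m S.
  apply: Kcomm; rewrite mulmxA SW mulNmx -(mulmxA W S W) SW mulmxN opprK mulmxA.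
  by [].
have WK : W *m K = K *m W by apply: Kcomm; rewrite mulmxA.
pose M0 := S *m (1%:M - K) + e *: W.
have M0s : M0^T = M0.
  rewrite /M0 linearD /= linearZ /= W_sym trmx_mul S_sym linearB /= trmx1 Ks.
  by rewrite mulmxBl mulmxBr mul1mx mulmx1 SK.
have M0sq : M0 *m M0 = 1%:M.
  have c1 : S *m (1%:M - K) = (1%:M - K) *m S.
    by rewrite mulmxBl mulmxBr mul1mx mulmx1 SK.
  have c2 : W *m (1%:M - K) = (1%:M - K) *m W.
    by rewrite mulmxBl mulmxBr mul1mx mulmx1 WK.
  pose T := S *m (1%:M - K).
  have TT : T *m T = (1%:M - K) *m (1%:M - K).
    by rewrite {1}/T c1 /T mulmxA -(mulmxA _ S S) SS mulmx1.
  have WT : W *m T = - (T *m W).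
    by rewrite /T -mulmxA -c2 mulmxA [in RHS]mulmxA SW mulNmx opprK.
  rewrite /M0 -/T mulmxDl !mulmxDr TT.
  rewrite -!scalemxAl -!scalemxAr scalerA -expr2 WT scalerN addrA addrK.
  have -> : e ^+ 2 *: (W *m W) = 2 *: K - K *m K by rewrite -KE addrAC subrr add0r.
  rewrite mulmxBl !mulmxBr !mul1mx mulmx1.
  by apply/matrixP => i j; move: (K *m K) => K2; rewrite !mxE; ring.
pose E : R := \sum_(i | c i) (h 0 i) ^+ 2.
have [i1 ci1 hi1] : exists2 i1, c i1 & 0 < h 0 i1.
  have /andP[cij _] := ij0; have := h_gt0 ij0.
  have := ij0; rewrite bicompl_sym => /h_gt0.
  by case ci: (c i0) cij; case cj: (c j0) => // _ ? ?; [exists i0 | exists j0].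
have E0 : 0 < E.
  rewrite /E (bigD1 i1) //= ltr_pwDl // ?exprn_gt0 // sumr_ge0 // => i _.
  exact: sqr_ge0.
pose x : 'rV[R]_n := \row_i (if c i then h 0 i / Num.sqrt E else 0).
pose y := x *m W.
have yE j : y 0 j = if c j then 0 else h 0 j / Num.sqrt E.
  have /rowP/(_ j) := h_W; rewrite !mxE => hj.
  case: ifP => cj.
    apply: big1 => i _; rewrite !mxE /bicompl cj.
    by case: (c i); rewrite ?mul0r //= mulr0.
  rewrite -hj mulr_suml; apply: eq_bigr => i _; rewrite !mxE /bicompl cj.
  by case: (c i) => /=; rewrite ?mul0r ?mulr0 ?mul0r // mulrAC.
have yW : y *m W = x.
  apply/rowP => j; rewrite [RHS]mxE.
  have /rowP/(_ j) := h_W; rewrite !mxE => hj.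
  case: ifP => cj; last first.
    apply: big1 => i _; rewrite yE !mxE /bicompl cj.
    by case: (c i); rewrite ?mul0r //= mulr0.
  rewrite -hj mulr_suml; apply: eq_bigr => i _; rewrite yE !mxE /bicompl cj.
  by case: (c i) => /=; rewrite ?mul0r ?mulr0 ?mul0r // mulrAC.
have xx : x *m x^T = 1%:M.
  apply/rowP => k; rewrite !ord1 !mxE /= mulr1n.
  have sE : Num.sqrt E ^+ 2 = E by rewrite sqr_sqrtr // ltW.
  transitivity (E / Num.sqrt E ^+ 2); last by rewrite sE divff // gt_eqF.
  rewrite /E mulr_suml [RHS]big_mkcond /=; apply: eq_bigr => i _; rewrite !mxE.
  by case: (c i); rewrite ?mulr0 // -expr2 expr_div_n.
have yy : y *m y^T = 1%:M.
  by rewrite /y trmx_mul W_sym mulmxA -/y yW xx.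
have xS : x *m S = x.
  by apply/rowP => j; rewrite S_mul !mxE /sg; case: (c j); rewrite ?mulr1 ?mul0r.
have yS : y *m S = - y.
  by apply/rowP => j; rewrite S_mul [RHS]mxE yE /sg; case: (c j); rewrite ?mul0r ?oppr0 ?mulrN1.
have xK : x *m K = p *: x.
  have xh : x = (2 * Num.sqrt E)^-1 *: (h + h *m S).
    apply/rowP => j; rewrite [LHS]mxE [RHS]mxE [(h + h *m S) 0 j]mxE S_mul /sg; case: (c j).
      by field; rewrite sqrtr_eq0 -ltNge E0.
    by rewrite mulrN1 subrr mulr0.
  by rewrite {1}xh -scalemxAl mulmxDl -mulmxA SK mulmxA hK -scalemxAl -scalerDr scalerA mulrC -scalerA -xh.
have yK : y *m K = p *: y by rewrite /y -mulmxA WK mulmxA xK scalemxAl.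
pose fullrow (b : bool) : 'rV[R]_n := \row_i ((c i == b) && full i)%:R.
pose unitrow b := (Num.sqrt (\sum_i (fullrow b 0 i)))^-1 *: fullrow b.
have frE b i : fullrow b 0 i = ((c i == b) && full i)%:R by rewrite mxE.
have urE b i : unitrow b 0 i = (Num.sqrt (\sum_i (fullrow b 0 i)))^-1 * ((c i == b) && full i)%:R.
  by rewrite mxE frE.
have sum_pos b i : (c i == b) && full i -> 0 < \sum_i (fullrow b 0 i).
  move=> bi; rewrite (bigD1 i) //= frE bi ltr_pwDl ?ltr01 // sumr_ge0 // => j _.
  by rewrite frE.
have ur_pos b i : (c i == b) && full i -> 0 < unitrow b 0 i.
  by move=> bi; rewrite urE bi mulr1 invr_gt0 sqrtr_gt0 (sum_pos _ _ bi).
have ur0 b i : ~~ ((c i == b) && full i) -> unitrow b 0 i = 0.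
  by move=> bi; rewrite urE (negPf bi) mulr0.
have uru b i : (c i == b) && full i -> unitrow b *m (unitrow b)^T = 1%:M.
  move=> bi; apply/rowP => k; rewrite !ord1 mxE [RHS]mxE eqxx mulr1n.
  have sp := sum_pos _ _ bi; set T := \sum_i _ in sp.
  have sT : Num.sqrt T ^+ 2 = T by rewrite sqr_sqrtr // ltW.
  transitivity (T / Num.sqrt T ^+ 2); last by rewrite sT divff // gt_eqF.
  rewrite {1}/T mulr_suml; apply: eq_bigr => j _; rewrite [X in _ * X]mxE urE -/T frE.
  by case: (_ && _); rewrite ?mulr0 ?mul0r // !mulr1 mul1r -invfM -expr2.
pose w := unitrow true; pose z := unitrow false.
have urW b : unitrow b *m W = 0.
  apply/rowP => j; rewrite mxE [RHS]mxE big1 // => i _; rewrite urE.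
  case: andP => [[_]|_]; last by rewrite mulr0 mul0r.
  by rewrite h_full => /eqP hi; rewrite -W_sym mxE W_full ?mulr0.
have urK b : unitrow b *m K = 0.
  apply/rowP => j; rewrite mxE [RHS]mxE big1 // => i _; rewrite urE.
  case: andP => [[_]|_]; last by rewrite mulr0 mul0r.
  by rewrite h_full => /eqP hi; rewrite -Ks mxE Kfull ?mulr0.
have wS : w *m S = w.
  apply/rowP => j; rewrite S_mul /w urE /sg; case: (c j); rewrite ?mulr1 //=.
  by rewrite mulr0 mul0r.
have zS : z *m S = - z.
  apply/rowP => j; rewrite S_mul [RHS]mxE /z urE /sg; case: (c j) => /=.
    by rewrite mulr0 mul0r oppr0.
  by rewrite mulrN1.
have trE (u : 'rV[R]_n) i k : u^T i k = u k i by rewrite mxE.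
have xy : x *m y^T = 0.
  apply/rowP => k; rewrite !ord1 mxE [RHS]mxE big1 // => i _; rewrite [x 0 i]mxE trE yE.
  by case: (c i); rewrite ?mulr0 ?mul0r.
have urx b : unitrow b *m x^T = 0.
  apply/rowP => k; rewrite !ord1 mxE [RHS]mxE big1 // => i _; rewrite trE urE [x 0 i]mxE.
  case: andP => [[_]|_]; last by rewrite mulr0 mul0r.
  by rewrite h_full => /eqP ->; rewrite mul0r if_same mulr0.
have ury b : unitrow b *m y^T = 0.
  apply/rowP => k; rewrite !ord1 mxE [RHS]mxE big1 // => i _; rewrite trE urE yE.
  case: andP => [[_]|_]; last by rewrite mulr0 mul0r.
  by rewrite h_full => /eqP ->; rewrite mul0r if_same mulr0.
have wz : w *m z^T = 0.
  apply/rowP => k; rewrite !ord1 mxE [RHS]mxE big1 // => i _; rewrite trE /w /z !urE.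
  by case: (c i) => /=; rewrite ?mulr0 ?mul0r.
have symm0 (u v : 'rV[R]_n) : u *m v^T = 0 -> v *m u^T = 0.
  by move=> uv; apply: trmx_inj; rewrite trmx_mul trmxK uv trmx0.
pose D := - (w^T *m w) + ga *: (w^T *m x + x^T *m w) + (al - a) *: (x^T *m x)
  + (a - al) *: (y^T *m y) + ga' *: (y^T *m z + z^T *m y) + z^T *m z.
have Ds : D^T = D.
  have tD (A B : 'M[R]_n) : (A + B)^T = A^T + B^T by rewrite linearD.
  have tZ r (A : 'M[R]_n) : (r *: A)^T = r *: A^T by rewrite linearZ.
  have tN (A : 'M[R]_n) : (- A)^T = - A^T by rewrite linearN.
  rewrite /D !(tD, tZ, tN, trmx_mul, trmxK).
  by rewrite [x^T *m w + _]addrC [z^T *m y + _]addrC.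
pose M := M0 + D.
have Ms : M^T = M by rewrite linearD /= M0s Ds.
have vD (v : 'rV[R]_n) : v *m D = - (v *m w^T *m w) + ga *: (v *m w^T *m x + v *m x^T *m w)
    + (al - a) *: (v *m x^T *m x) + (a - al) *: (v *m y^T *m y)
    + ga' *: (v *m y^T *m z + v *m z^T *m y) + v *m z^T *m z.
  rewrite /D; move: (w) (x) (y) (z) => w1 x1 y1 z1.
  by rewrite !mulmxDr mulmxN -!scalemxAr !mulmxDr !mulmxA.
have xM : x *m M = al *: x + e *: y + ga *: w.
  rewrite mulmxDr vD (symm0 _ _ (urx true)) xx xy (symm0 _ _ (urx false)) !mul0mx ?mul1mx.
  rewrite mulmxDr mulmxA xS mulmxBr mulmx1 xK -scalemxAr -/y aE.
  by apply/rowP => j; rewrite ?mul1mx; move: (x) (y) (w) => x' y' w'; rewrite !mxE; ring.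
have yM : y *m M = e *: x - al *: y + ga' *: z.
  rewrite mulmxDr vD (symm0 _ _ (ury true)) (symm0 _ _ xy) yy (symm0 _ _ (ury false)) !mul0mx ?mul1mx.
  rewrite mulmxDr mulmxA yS mulmxBr mulmx1 mulNmx yK -scalemxAr yW aE.
  by apply/rowP => j; rewrite ?mul1mx; move: (x) (y) (z) => x' y' w'; rewrite !mxE; ring.
have wM : w *m M = ga *: x.
  have [[i ifull]|none] := pselect (exists i, c i && full i).
    have ww : w *m w^T = 1%:M by apply: (uru true i); rewrite eqb_id.
    rewrite mulmxDr vD ww (urx true) (ury true) wz !mul0mx !mul1mx.
    rewrite mulmxDr mulmxA wS mulmxBr mulmx1 (urK true) -scalemxAr (urW true).
    by apply/rowP => j; move: (w) (x) => w' x'; rewrite !mxE; ring.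
  have nf i : c i -> ~~ full i by move=> ci; apply/negP => fi; apply: none; exists i; rewrite ci.
  have -> : w = 0.
    apply/rowP => i; rewrite [RHS]mxE /w ur0 //.
    by apply/negP => /andP[/eqP ci]; apply/negP/nf.
  by rewrite ga0 // mul0mx scale0r.
have zM : z *m M = ga' *: y.
  have [[i ifull]|none] := pselect (exists i, ~~ c i && full i).
    have zz : z *m z^T = 1%:M by apply: (uru false i); rewrite eqbF_neg.
    rewrite mulmxDr vD (symm0 _ _ wz) zz (urx false) (ury false) !mul0mx !mul1mx.
    rewrite mulmxDr mulmxA zS mulmxBr mulmx1 mulNmx (urK false) -scalemxAr (urW false).
    by apply/rowP => j; move: (z) (y) => w' x'; rewrite !mxE; ring.
  have nf i : ~~ c i -> ~~ full i by move=> ci; apply/negP => fi; apply: none; exists i; rewrite ci.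
  have -> : z = 0.
    apply/rowP => i; rewrite [RHS]mxE /z ur0 //.
    by apply/negP => /andP[/eqP ci]; apply/negP/nf; rewrite ci.
  by rewrite ga'0 // mul0mx scale0r.
have tr_prod (u v : 'rV[R]_n) i j : (u^T *m v) i j = u 0 i * v 0 j.
  by rewrite mxE big_ord1 !mxE.
have M_entry i j : i != j -> M i j = sg i * - K i j + e * W i j
   - w 0 i * w 0 j + ga * (w 0 i * x 0 j + x 0 i * w 0 j) + (al - a) * (x 0 i * x 0 j)
   + (a - al) * (y 0 i * y 0 j) + ga' * (y 0 i * z 0 j + z 0 i * y 0 j) + z 0 i * z 0 j.
  move=> ij; have -> : M i j = (S *m (1%:M - K)) i j + e * W i j + D i j by rewrite 2!mxE [(e *: W) i j]mxE.
  have -> : D i j = - (w 0 i * w 0 j) + ga * (w 0 i * x 0 j + x 0 i * w 0 j) + (al - a) * (x 0 i * x 0 j)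
   + (a - al) * (y 0 i * y 0 j) + ga' * (y 0 i * z 0 j + z 0 i * y 0 j) + z 0 i * z 0 j.
    by rewrite -!tr_prod /D; move: (w^T *m w) (w^T *m x) (x^T *m w) (x^T *m x) (y^T *m y)
      (y^T *m z) (z^T *m y) (z^T *m z) => *; rewrite !mxE.
  rewrite mul_diag_mx mxE [(\row_i sg i) 0 i]mxE [(1%:M - K) i j]mxE [(1%:M : 'M_n) i j]mxE (negPf ij).
  by rewrite [(- K) i j]mxE sub0r !addrA.
have Kcross i j : c i != c j -> K i j = 0.
  move=> cij; have /matrixP/(_ i j) := SK.
  rewrite mul_diag_mx mul_mx_diag !mxE /sg.
  by case: (c i) (c j) cij => -[] // _; lra.
have x_pos i : c i -> ~~ full i -> 0 < x 0 i.
  by move=> ci; rewrite h_full [x 0 i]mxE ci => hi; rewrite divr_gt0 ?sqrtr_gt0 // lt_neqAle eq_sym hi h_ge0.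
have x_full i : full i -> x 0 i = 0.
  by rewrite h_full [x 0 i]mxE => /eqP ->; rewrite mul0r if_same.
have y_pos i : ~~ c i -> ~~ full i -> 0 < y 0 i.
  by move=> ci; rewrite h_full yE (negPf ci) => hi; rewrite divr_gt0 ?sqrtr_gt0 // lt_neqAle eq_sym hi h_ge0.
have y_full i : full i -> y 0 i = 0.
  by rewrite h_full yE => /eqP ->; rewrite mul0r if_same.
have K_full i j : full i || full j -> K i j = 0.
  case/orP; rewrite h_full => /eqP hi; last exact: Kfull.
  by rewrite -Ks mxE Kfull.
exists M.
  split=> // i j ij; rewrite M_entry // [RHS]/= /compl_rel ij /=.
  case ci: (c i); case cj: (c j).
  - have -> : F i j = false by apply/negP => /bip; rewrite ci cj.
    rewrite !yE ci cj (ur0 false i) ?ci // (ur0 false j) ?cj // !mulr0 !addr0.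
    rewrite [W i j]mxE /bicompl ci cj /= mulr0 addr0 /sg ci mul1r.
    case: (boolP (full i)) (boolP (full j)) => fi [] fj.
    + have wi : 0 < w 0 i by apply: ur_pos; rewrite ci.
      have wj : 0 < w 0 j by apply: ur_pos; rewrite cj.
      rewrite K_full ?fi // !x_full // !mul0r !mulr0 oppr0 !addr0 add0r mulr0 addr0.
      by rewrite oppr_eq0 mulf_neq0 // gt_eqF.
    + have wi : 0 < w 0 i by apply: ur_pos; rewrite ci.
      rewrite K_full ?fi // (x_full i) // (ur0 true j) ?cj // !mul0r !mulr0 !subr0 oppr0 add0r !addr0.
      apply: mulf_neq0; last by rewrite lt0r_neq0 ?mulr_gt0 ?x_pos ?cj.
      by apply: ga1; exists i; rewrite ci.
    + have wj : 0 < w 0 j by apply: ur_pos; rewrite cj.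
      rewrite K_full ?fj ?orbT // (x_full j) // (ur0 true i) ?ci // !mul0r !mulr0 !subr0 oppr0 !add0r !addr0.
      apply: mulf_neq0; last by rewrite lt0r_neq0 ?mulr_gt0 ?x_pos ?ci //.
      by apply: ga1; exists j; rewrite cj.
    rewrite (ur0 true i) ?ci // (ur0 true j) ?cj // !mul0r !mulr0 !addr0 subr0 mulr0 addr0 lt_eqF //.
    have := K0 i j; have := x_pos i ci fi; have := x_pos j cj fj => xi xj Kij.
    have : (a - al) * (x 0 i * x 0 j) > 0 by rewrite !mulr_gt0 // subr_gt0.
    lra.
  - have xyzw : [/\ w 0 j = 0, x 0 j = 0, y 0 i = 0 & z 0 i = 0].
      by rewrite yE ci [x 0 j]mxE cj /w /z !ur0 ?ci ?cj.
    case: xyzw => -> -> -> ->; rewrite Kcross ?ci ?cj //.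
    rewrite !(mulr0, mul0r, addr0, subr0, oppr0, add0r) mulf_eq0 gt_eqF //= [W i j]mxE /bicompl ci cj /=.
    case Fij: (F i j); rewrite ?eqxx //= invr_eq0 mulf_eq0 !gt_eqF //.
      by apply: (@h_gt0 j i); rewrite /bicompl ci cj edge_sym Fij.
    by apply: (@h_gt0 i j); rewrite /bicompl ci cj Fij.
  - have xyzw : [/\ w 0 i = 0, x 0 i = 0, y 0 j = 0 & z 0 j = 0].
      by rewrite yE cj [x 0 i]mxE ci /w /z !ur0 ?ci ?cj.
    case: xyzw => -> -> -> ->; rewrite Kcross ?ci ?cj //.
    rewrite !(mulr0, mul0r, addr0, subr0, oppr0, add0r) mulf_eq0 gt_eqF //= [W i j]mxE /bicompl ci cj /=.
    case Fij: (F i j); rewrite ?eqxx //= invr_eq0 mulf_eq0 !gt_eqF //.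
      by apply: (@h_gt0 j i); rewrite /bicompl ci cj edge_sym Fij.
    by apply: (@h_gt0 i j); rewrite /bicompl ci cj Fij.
  have -> : F i j = false by apply/negP => /bip; rewrite ci cj.
  have [-> -> -> ->] : [/\ w 0 i = 0, w 0 j = 0, x 0 i = 0 & x 0 j = 0].
    by rewrite ![x 0 _]mxE ci cj /w !ur0 ?ci ?cj.
  rewrite [W i j]mxE /bicompl ci cj /= !mulr0 subr0 !addr0 /sg ci mulN1r opprK.
  rewrite !mulr0 !addr0.
  case: (boolP (full i)) (boolP (full j)) => fi [] fj.
  + have wi : 0 < z 0 i by apply: ur_pos; rewrite ci.
    have wj : 0 < z 0 j by apply: ur_pos; rewrite cj.
    rewrite K_full ?fi // !y_full // !mul0r !mulr0 !addr0 !add0r mulr0 add0r.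
    by rewrite mulf_neq0 // gt_eqF.
  + have wi : 0 < z 0 i by apply: ur_pos; rewrite ci.
    rewrite K_full ?fi // (y_full i) // (ur0 false j) ?cj // !mul0r !mulr0 !add0r !addr0.
    apply: mulf_neq0; last by rewrite lt0r_neq0 ?mulr_gt0 ?y_pos ?cj //.
    by apply: ga'1; exists i; rewrite ci.
  + have wj : 0 < z 0 j by apply: ur_pos; rewrite cj.
    rewrite K_full ?fj ?orbT // (y_full j) // (ur0 false i) ?ci // !mul0r !mulr0 !add0r !addr0.
    apply: mulf_neq0; last by rewrite lt0r_neq0 ?mulr_gt0 ?y_pos ?ci //.
    by apply: ga'1; exists j; rewrite cj.
  rewrite (ur0 false i) ?ci // (ur0 false j) ?cj // !mul0r !mulr0 !addr0 mulr0 addr0 gt_eqF //.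
  have := K0 i j; have := y_pos i (negbT ci) fi; have := y_pos j (negbT cj) fj => xi xj Kij.
  have : (a - al) * (y 0 i * y 0 j) > 0 by rewrite !mulr_gt0 // subr_gt0.
  lra.
move=> t v v0 vM.
pose co (u : 'rV[R]_n) : R := (v *m u^T) 0 0.
have coE u : v *m u^T = (co u)%:M by rewrite [LHS]mx11_scalar.
have coM (u : 'rV[R]_n) : t * co u = co (u *m M).
  by rewrite /co trmx_mul Ms mulmxA vM -scalemxAl [RHS]mxE.
have coD u u' : co (u + u') = co u + co u' by rewrite /co linearD /= mulmxDr mxE.
have coZ r u : co (r *: u) = r * co u by rewrite /co linearZ /= -scalemxAr mxE.
have coN u : co (- u) = - co u by rewrite -scaleN1r coZ mulN1r.
have [all0|some] := pselect [/\ co w = 0, co x = 0, co y = 0 & co z = 0].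
  left; case: all0 => cw cx cy cz.
  have vM0 : v *m M0 = t *: v.
    rewrite -vM (mulmxDr v M0 D) vD !coE cw cx cy cz !raddf0 !mul0mx.
    by rewrite !(addr0, scaler0, oppr0).
  have : t ^+ 2 *: v = v.
    by rewrite expr2 -scalerA -vM0 scalemxAl -vM0 -mulmxA M0sq mulmx1.
  move/eqP; rewrite -subr_eq0 -{2}[v]scale1r -scalerBl scaler_eq0 (negPf v0) orbF.
  by rewrite subr_eq0 => /eqP.
right; exists (co w), (co x), (co y), (co z); split.
- move=> cw; apply: contrapT => none; move/eqP: cw; apply.
  suff -> : w = 0 by rewrite /co trmx0 mulmx0 mxE.
  apply/rowP => i; rewrite [RHS]mxE /w ur0 //.
  by apply/negP => /andP[/eqP ci fi]; apply: none; exists i; rewrite ci.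
- move=> cz; apply: contrapT => none; move/eqP: cz; apply.
  suff -> : z = 0 by rewrite /co trmx0 mulmx0 mxE.
  apply/rowP => i; rewrite [RHS]mxE /z ur0 //.
  by apply/negP => /andP[/eqP ci fi]; apply: none; exists i; rewrite ci.
- apply: contrapT => no; apply: some; split; apply/eqP/negPn/negP => ne; apply: no.
  + exact: Or41.
  + exact: Or42.
  + exact: Or43.
  + exact: Or44.
by rewrite !coM wM xM yM zM !(coD, coZ, coN).
Qed.

End Construction.
End CoBipartite.

Section CoBipartiteQ.
Variable R : realType.
Local Open Scope ring_scope.
Implicit Types (n : nat).

Lemma bicompl_swap n (F : sgraph n) (c : 'I_n -> bool) i j :
  bicompl F (fun k => ~~ c k) i j = bicompl F c i j.
Proof. by rewrite /bicompl (inj_eq negb_inj). Qed.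

Lemma full_swap n (F : sgraph n) (c : 'I_n -> bool) i :
  full F (fun k => ~~ c k) i = full F c i.
Proof. by apply: eq_forallb => j; rewrite bicompl_swap. Qed.

Lemma sqr_eq1 (t : R) : t ^+ 2 = 1 -> t = 1 \/ t = -1.
Proof. by move/eqP; rewrite sqrf_eq1 => /orP[]/eqP ->; [left|right]. Qed.

Section Cases.
Variables (n : nat) (F : sgraph n) (c : 'I_n -> bool).
Hypothesis bip : forall i j, F i j -> c i != c j.

(* with e = 3/4 the case al = 0, ga = ga' = 1/2 below has the eigenvalues 1, -1,
   1/4, -1/4 *)
Let e : R := 3 / 4.
Let e0 : 0 < e. Proof. by rewrite /e; lra. Qed.
Let e1 : e < 1. Proof. by rewrite /e; lra. Qed.
Let a : R := Num.sqrt (1 - e ^+ 2).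
Let a2 : a ^+ 2 = 1 - e ^+ 2.
Proof. by rewrite /a sqr_sqrtr // /e; lra. Qed.
Let a0 : 0 < a. Proof. by rewrite sqrtr_gt0 /e; lra. Qed.

(** al = - a gives back square 1, since a^2 + e^2 = 1. *)
Lemma co_bipartite_no_full : (forall i, ~~ full F c i) -> (q R (compl F) <= 2)%N.
Proof.
move=> nf; case: n F c bip nf => [|m] G d dG nf.
  by apply: leq_trans (q_le_size _ _) _.
have := nf ord0; rewrite negb_forall => /existsP[j /negPn ij].
have := @co_bipartite_matrix R _ G d dG (- a) 0 0 e e0 e1 _ _ ij.
case=> //=.
- by rewrite -/a; move: a0; lra.
- by case=> i /andP[_ fi]; have := nf i; rewrite fi.
- by case=> i /andP[_ fi]; have := nf i; rewrite fi.
move=> M GM eig; apply: leq_trans (q_le GM) _.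
apply: (@q_mx_le_seq _ _ _ [:: 1; -1]) => t v v0 vM; rewrite !inE.
suff : t ^+ 2 = 1 by case/sqr_eq1=> ->; rewrite eqxx ?orbT.
case: (eig t v v0 vM) => // -[w [x [y [z [wf zf ne [_ xt yt _]]]]]].
have w0 : w = 0.
  by apply/eqP/negPn/negP => /wf[i /andP[_ fi]]; have := nf i; rewrite fi.
have z0 : z = 0.
  by apply/eqP/negPn/negP => /zf[i /andP[_ fi]]; have := nf i; rewrite fi.
rewrite w0 z0 eqxx in ne xt yt.
have xx : t ^+ 2 * x = x.
  have -> : t ^+ 2 * x = t * (t * x) by ring.
  rewrite xt; have -> : t * (- a * x + e * y + 0 * 0) = - a * (t * x) + e * (t * y) by ring.
  rewrite xt yt; have -> : - a * (- a * x + e * y + 0 * 0) + e * (e * x - - a * y + 0 * 0)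
    = (a ^+ 2 + e ^+ 2) * x by ring.
  by rewrite a2; ring.
have yy : t ^+ 2 * y = y.
  have -> : t ^+ 2 * y = t * (t * y) by ring.
  rewrite yt; have -> : t * (e * x - - a * y + 0 * 0) = e * (t * x) + a * (t * y) by ring.
  rewrite xt yt; have -> : e * (- a * x + e * y + 0 * 0) + a * (e * x - - a * y + 0 * 0)
    = (a ^+ 2 + e ^+ 2) * y by ring.
  by rewrite a2; ring.
by case: ne => // ne; apply: (mulIf ne); rewrite mul1r.
Qed.

(** al = 0 and ga = a: on the span of w, x, y the eigenvalues are 0, 1 and -1,
    since a^2 + e^2 = 1. *)
Lemma co_bipartite_one_side : (forall i, ~~ c i -> ~~ full F c i) ->
  (exists i, ~~ c i) -> (q R (compl F) <= 3)%N.
Proof.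
move=> nf [i0 ci0].
have [j ij] : exists j, bicompl F c i0 j.
  by have := nf i0 ci0; rewrite negb_forall => /existsP[j /negPn ij]; exists j.
have [some|none] := pselect (exists i, c i && full F c i); last first.
  apply: (leq_trans (co_bipartite_no_full _)) => // i.
  case ci: (c i); last by apply: nf; rewrite ci.
  by apply/negP => fi; apply: none; exists i; rewrite ci.
have := @co_bipartite_matrix R _ F c bip 0 a 0 e e0 e1 _ _ ij.
case=> //=.
- by move=> _; rewrite gt_eqF.
- by case=> i /andP[ci fi]; have := nf i ci; rewrite fi.
- by move=> no; case: some => i /andP[/no/negP no'].
move=> M GM eig; apply: leq_trans (q_le GM) _.
apply: (@q_mx_le_seq _ _ _ [:: 1; -1; 0]) => t v v0 vM; rewrite !inE.
case: (eig t v v0 vM) => [/sqr_eq1[]->|]; rewrite ?eqxx ?orbT //.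
move=> [w [x [y [z [wf zf ne [wt xt yt _]]]]]].
have z0 : z = 0.
  by apply/eqP/negPn/negP => /zf[i /andP[ci fi]]; have := nf i ci; rewrite fi.
rewrite z0 eqxx in ne yt.
have [x0|x0] := eqVneq x 0.
  rewrite x0 eqxx in wt yt ne.
  suff -> : t = 0 by rewrite eqxx !orbT.
  case: ne => // ne; apply: (mulIf ne); rewrite mul0r.
    by rewrite wt mulr0.
  by rewrite yt; ring.
suff : t ^+ 2 = 1 by case/sqr_eq1=> ->; rewrite eqxx ?orbT.
apply: (mulIf x0); rewrite mul1r.
have -> : t ^+ 2 * x = t * (t * x) by ring.
rewrite xt; have -> : t * (0 * x + e * y + a * w) = e * (t * y) + a * (t * w) by ring.
rewrite wt yt; have -> : e * (e * x - 0 * y + 0 * 0) + a * (a * x) = (a ^+ 2 + e ^+ 2) * x by ring.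
by rewrite a2; ring.
Qed.

(** The averaging projection onto functions constant on the cliques. *)
Lemma two_cliques : (forall i j, ~~ bicompl F c i j) -> (q R (compl F) <= 2)%N.
Proof.
move=> none.
pose cnt b : R := \sum_i (c i == b)%:R.
pose A : 'M[R]_n := \matrix_(i, j) if c i == c j then (cnt (c i))^-1 else 0.
have cnt_pos i : 0 < cnt (c i).
  by rewrite /cnt (bigD1 i) //= eqxx ltr_pwDl ?ltr01 // sumr_ge0.
have GA : matrix_of (compl F) A.
  split; first by apply/matrixP => i j; rewrite !mxE eq_sym; case: eqP => // ->.
  move=> i j ij; rewrite mxE /= /compl_rel ij /=; have := none i j.
  rewrite /bicompl; case: eqP => /= [cij _|_ /negPn ->]; last by rewrite eqxx.
  rewrite invr_eq0 gt_eqF //; apply/esym/negP => /bip; by rewrite cij eqxx.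
have AA : A *m A = A.
  apply/matrixP => i j; rewrite mxE [RHS]mxE.
  transitivity (\sum_k (c k == c i)%:R * A i j / cnt (c i)).
    apply: eq_bigr => k _; rewrite !mxE [c k == c i]eq_sym.
    case: eqP => [<-|_]; last by rewrite !mul0r.
    by rewrite mul1r mulrC.
  rewrite -!mulr_suml -/(cnt _) mxE; case: ifP => _; last by rewrite mulr0 mul0r.
  by rewrite divff ?mul1r // gt_eqF.
apply: leq_trans (q_le GA) _; apply: (@q_mx_le_seq _ _ _ [:: 0; 1]) => t v v0 vA.
rewrite !inE; have : t * (t - 1) == 0; last by rewrite mulf_eq0 subr_eq0.
have /eqP : (t * (t - 1)) *: v = 0; last by rewrite scaler_eq0 (negPf v0) orbF.
by rewrite mulrBr scalerBl mulr1 -scalerA -vA scalemxAl -vA -mulmxA AA subrr.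
Qed.

(** On the span of w, x, y, z, x + y and x - y satisfy t^2 - e t - 1/4 = 0 and
    t^2 + e t - 1/4 = 0, whose roots are 1, -1/4 and -1, 1/4. *)
Lemma co_bipartite_two_sides : (exists i, c i && full F c i) ->
  (exists i, ~~ c i && full F c i) -> (q R (compl F) <= 4)%N.
Proof.
move=> some some'.
have [[i0 [j ij]]|none] := pselect (exists i j, bicompl F c i j); last first.
  apply: leq_trans (two_cliques _) _ => // i j; apply/negP => ij.
  by apply: none; exists i, j.
have := @co_bipartite_matrix R _ F c bip 0 (2^-1) (2^-1) e e0 e1 _ _ ij.
case=> //=.
- by case: some => i /andP[ci fi] /(_ i ci)/negP.
- by case: some' => i /andP[ci fi] /(_ i ci)/negP.
move=> M GM eig; apply: leq_trans (q_le GM) _.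
apply: (@q_mx_le_seq _ _ _ [:: 1; -1; 4^-1; - 4^-1]) => t v v0 vM; rewrite !inE.
case: (eig t v v0 vM) => [/sqr_eq1[]->|]; rewrite ?eqxx ?orbT //.
move=> [w [x [y [z [wf zf ne [wt xt yt zt]]]]]].
have sum : (t - 1) * (t + 4^-1) * (x + y) = 0.
  have -> : (t - 1) * (t + 4^-1) * (x + y) =
    t * (t * x) + t * (t * y) - 3 / 4 * (t * x + t * y) - 4^-1 * (x + y) by field.
  rewrite xt yt.
  have -> : t * (0 * x + e * y + 2^-1 * w) + t * (e * x - 0 * y + 2^-1 * z)
    = e * (t * x + t * y) + 2^-1 * (t * w + t * z) by ring.
  by rewrite wt zt xt yt /e; field.
have diff : (t + 1) * (t - 4^-1) * (x - y) = 0.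
  have -> : (t + 1) * (t - 4^-1) * (x - y) =
    t * (t * x) - t * (t * y) + 3 / 4 * (t * x - t * y) - 4^-1 * (x - y) by field.
  rewrite xt yt.
  have -> : t * (0 * x + e * y + 2^-1 * w) - t * (e * x - 0 * y + 2^-1 * z)
    = - e * (t * x - t * y) + 2^-1 * (t * w - t * z) by ring.
  by rewrite wt zt xt yt /e; field.
move: sum diff => /eqP; rewrite !mulf_eq0 subr_eq0 addr_eq0.
case/orP=> [/orP[]/eqP ->|]; rewrite ?eqxx ?orbT // => /eqP xy.
move=> /eqP; rewrite !mulf_eq0 subr_eq0 addr_eq0.
case/orP=> [/orP[]/eqP ->|]; rewrite ?eqxx ?orbT // => /eqP yx.
have x0 : x = 0 by lra.
have y0 : y = 0 by lra.
have w0 : w = 0 by move: xt; rewrite x0 y0; lra.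
have z0 : z = 0 by move: yt; rewrite x0 y0; lra.
by case: ne; rewrite ?w0 ?x0 ?y0 ?z0 eqxx.
Qed.

End Cases.

Lemma co_bipartite_q3 n (F : sgraph n) (c : 'I_n -> bool) b :
  (forall i j, F i j -> c i != c j) -> (forall i, c i = b -> ~~ full F c i) ->
  (exists i, c i = b) -> (q R (compl F) <= 3)%N.
Proof.
case: b => bip nf [i ci].
  apply: (@co_bipartite_one_side _ _ (fun k => ~~ c k)).
  - by move=> j k /bip; rewrite (inj_eq negb_inj).
  - by move=> j; rewrite negbK full_swap; apply: nf.
  - by exists i; rewrite ci.
apply: (@co_bipartite_one_side _ _ c) => //.
  by move=> j /negbTE; apply: nf.
by exists i; rewrite ci.
Qed.

Lemma co_bipartite_q4 n (F : sgraph n) (c : 'I_n -> bool) :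
  (forall i j, F i j -> c i != c j) -> (q R (compl F) <= 4)%N.
Proof.
move=> bip.
have [[i0 [j ij]]|none] := pselect (exists i j, bicompl F c i j); last first.
  apply: (leq_trans (two_cliques bip _)) => // i j; apply/negP => ij.
  by apply: none; exists i, j.
have col b : exists i, c i = b.
  have /andP[] := ij; case ci: (c i0); case cj: (c j) => // _ _.
    by case: b; [exists i0 | exists j].
  by case: b; [exists j | exists i0].
have [some|no1] := pselect (exists i, c i && full F c i); last first.
  apply/leqW/(@co_bipartite_q3 _ _ c true) => // k ck.
  by apply/negP => fk; apply: no1; exists k; rewrite ck.
have [some'|no2] := pselect (exists i, ~~ c i && full F c i); last first.
  apply/leqW/(@co_bipartite_q3 _ _ c false) => // k ck.
  by apply/negP => fk; apply: no2; exists k; rewrite ck.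
exact: (co_bipartite_two_sides bip some).
Qed.

End CoBipartiteQ.

(** * Bipartite graphs *)

(** Small graphs are recognised by listing their vertices in a suitable order.
    *)
Lemma isog_of_seq n k (F : sgraph n) (G : sgraph k) (x0 : 'I_n) (s : seq 'I_n) :
  uniq s -> size s = k -> (forall x, x \in s) ->
  (forall i j : 'I_k, F (nth x0 s i) (nth x0 s j) = G i j) -> isog F G.
Proof.
move=> us sk all FG; apply: isog_sym; exists (fun i : 'I_k => nth x0 s i) => //.
apply: inj_card_bij => [i j /eqP|].
  by rewrite nth_uniq ?sk // => /eqP /val_inj.
rewrite !card_ord -sk -[n in (n <= _)%N](size_enum_ord n).
by apply: uniq_leq_size => [|x _]; rewrite ?enum_uniq.
Qed.

(** When the bound fails, a small q of one graph excludes from the other one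
    every subgraph that would lower its q. *)
Lemma bound_fails_q4 a b n : (n + 2 < a + b -> b <= 4 -> ~ a + 2 <= n)%N.
Proof. by lia. Qed.

Lemma bound_fails_q3 a b n : (n + 2 < a + b -> b <= 3 -> ~ a + 1 <= n)%N.
Proof. by lia. Qed.

Lemma bound_fails_both_q4 a b n : (n + 2 < a + b -> a <= 4 -> b <= 4 -> n <= 5)%N.
Proof. by lia. Qed.

Lemma bound_fails_small a b n : (n + 2 < a + b -> n <= 5 -> a + 1 <= n -> ~ b + 2 <= n)%N.
Proof. by lia. Qed.

Section Bipartite.
Variable R : realType.
Implicit Types (n : nat).

Lemma neighbour_ex n (F : sgraph n) x : connectedg F -> (1 < n)%N -> exists y, F x y.
Proof.
move=> con n1; apply: contrapT => none; apply: (con [set x]); split.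
- by rewrite cards1.
- by rewrite cards1.
- move=> i j /set1P -> _; apply/negP => Fxj; by apply: none; exists j.
Qed.

(** A double star with P leaves at w and Q leaves at z. The diagonal entries 0 at the
    leaves of w, 1 at those of z, 1 - P at w and Q at z are chosen such that,
    after elimination of the leaves, the equations of w and z become
      (t - 1) (t + P) v_w = t v_z,   t (t - 1 - Q) v_z = (t - 1) v_w.
    For t other than 0 and 1 they combine to (t + P) (t - 1 - Q) = 1, a quadratic
    equation. *)
Section DoubleStar.
Local Open Scope ring_scope.
Variables (n : nat) (F : sgraph n) (c : 'I_n -> bool) (w z : 'I_n).
Hypotheses (cw : c w) (cz : ~~ c z).
Hypothesis bip : forall i j, c i = c j -> F i j = false.
Hypothesis star : forall x y, c x -> ~~ c y -> F x y = (x == w) || (y == z).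

Lemma double_star_q : (q R F <= 4)%N.
Proof.
pose P : R := \sum_(y | ~~ c y && (y != z)) 1.
pose Q : R := \sum_(x | c x && (x != w)) 1.
have P0 : 0 <= P by apply: sumr_ge0.
have Q0 : 0 <= Q by apply: sumr_ge0.
pose d i : R := if i == w then 1 - P else if i == z then Q else (c i)%:R.
pose A : 'M[R]_n := \matrix_(i, j) ((i == j)%:R * d i + (F i j)%:R).
have FA : matrix_of F A.
  split; first apply/matrixP => i j.
    by rewrite !mxE edge_sym eq_sym; case: eqP => [->|_] //; rewrite !mul0r.
  move=> i j ij; rewrite mxE (negPf ij) mul0r add0r pnatr_eq0.
  by case: (F i j).
pose b := 1 + Q - P; pose D := b ^+ 2 + 4 * (P * (1 + Q) + 1).
have D0 : 0 <= D by rewrite addr_ge0 ?sqr_ge0 // mulr_ge0 // addr_ge0 // mulr_ge0 // addr_ge0.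
pose s := Num.sqrt D.
have s2 : s ^+ 2 = D by rewrite sqr_sqrtr.
apply: leq_trans (q_le FA) _.
apply: (@q_mx_le_seq _ _ _ [:: 0; 1; (b + s) / 2; (b - s) / 2]) => t v v0 vA.
have eqn j : t * v 0 j = d j * v 0 j + \sum_(i | F i j) v 0 i.
  have /rowP/(_ j) := vA; rewrite [RHS]mxE => <-; rewrite mxE.
  under eq_bigr => i _ do rewrite mxE mulrDr.
  rewrite big_split /=; congr (_ + _).
    rewrite (bigD1 j) //= eqxx mul1r mulrC big1 ?addr0 // => i /negPf ->.
    by rewrite mul0r mulr0.
  rewrite [RHS]big_mkcond; apply: eq_bigr => i _.
  by case: (F i j); rewrite ?mulr1 ?mulr0.
have leaf_w y : ~~ c y && (y != z) -> t * v 0 y = v 0 w.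
  case/andP=> cy yz; rewrite eqn /d (negPf yz) (negPf cy).
  have -> : (y == w) = false by apply/negP => /eqP yw; rewrite yw cw in cy.
  rewrite mul0r add0r (big_pred1 w) // => i /=.
  case ci: (c i); first by rewrite star // (negPf yz) orbF.
  by rewrite bip ?ci ?(negPf cy) //; apply/esym/negP => /eqP iw; rewrite iw cw in ci.
have leaf_z x : c x && (x != w) -> (t - 1) * v 0 x = v 0 z.
  case/andP=> cx xw; rewrite mulrBl eqn /d (negPf xw) cx.
  have -> : (x == z) = false by apply/negP => /eqP xz; move: cz; rewrite -xz cx.
  rewrite mul1r addrC addKr (big_pred1 z) // => i /=.
  case ci: (c i); last by rewrite edge_sym star ?ci // (negPf xw).
  by rewrite bip ?ci ?cx //; apply/esym/negP => /eqP iz; move: cz; rewrite -iz ci.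
have wz : (w == z) = false by apply/negP => /eqP wz; move: cz; rewrite -wz cw.
pose Sy := \sum_(y | ~~ c y && (y != z)) v 0 y.
pose Sx := \sum_(x | c x && (x != w)) v 0 x.
have tSy : t * Sy = P * v 0 w.
  by rewrite mulr_sumr mulr_suml; apply: eq_bigr => y /leaf_w ->; rewrite mul1r.
have tSx : (t - 1) * Sx = Q * v 0 z.
  by rewrite mulr_sumr mulr_suml; apply: eq_bigr => y /leaf_z ->; rewrite mul1r.
have eq_w : t * v 0 w = (1 - P) * v 0 w + v 0 z + Sy.
  rewrite eqn /d eqxx -addrA; congr (_ + _); rewrite (bigD1 z) /=; last first.
    by rewrite edge_sym star // eqxx.
  congr (_ + _); apply: eq_bigl => i; congr (_ && _).
  case ci: (c i); first by rewrite bip ?ci.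
  by rewrite edge_sym star ?ci // eqxx.
have eq_z : t * v 0 z = Q * v 0 z + v 0 w + Sx.
  rewrite eqn /d eqxx eq_sym wz -addrA; congr (_ + _); rewrite (bigD1 w) /=; last first.
    by rewrite star // eqxx.
  congr (_ + _); apply: eq_bigl => i; congr (_ && _).
  case ci: (c i); last by rewrite bip ?ci ?(negPf cz).
  by rewrite star ?ci // eqxx orbT.
rewrite !inE; have [//|t0] := eqVneq t 0; have [//|t1] := eqVneq t 1.
have t1' : t - 1 != 0 by rewrite subr_eq0.
have rel_w : (t - 1) * (t + P) * v 0 w = t * v 0 z.
  have -> : (t - 1) * (t + P) * v 0 w = t * (t * v 0 w) - (1 - P) * (t * v 0 w) - P * v 0 w by ring.
  by rewrite {1}eq_w -tSy; ring.
have rel_z : t * (t - 1 - Q) * v 0 z = (t - 1) * v 0 w.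
  have -> : t * (t - 1 - Q) * v 0 z = (t - 1) * (t * v 0 z) - Q * (t - 1) * v 0 z - Q * v 0 z by ring.
  by rewrite eq_z -[X in _ - X]tSx; ring.
have vw : v 0 w != 0.
  apply/negP => /eqP vw; move/eqP: v0; apply; apply/rowP => i; rewrite [RHS]mxE.
  have vz : v 0 z = 0.
    by move: rel_w; rewrite vw mulr0 => /esym/eqP; rewrite mulf_eq0 (negPf t0) => /eqP.
  have [->//|iw] := eqVneq i w; have [->//|iz] := eqVneq i z.
  case ci: (c i).
    have := leaf_z i; rewrite ci iw vz => /(_ isT)/eqP.
    by rewrite mulf_eq0 (negPf t1') => /eqP.
  have := leaf_w i; rewrite ci iz vw => /(_ isT)/eqP.
  by rewrite mulf_eq0 (negPf t0) => /eqP.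
have : (t - 1) * v 0 w * ((t - (b + s) / 2) * (t - (b - s) / 2)) = 0.
  have -> : (t - (b + s) / 2) * (t - (b - s) / 2) = t ^+ 2 - b * t + (b ^+ 2 - s ^+ 2) / 4 by field.
  rewrite s2 /D.
  have -> : t ^+ 2 - b * t + (b ^+ 2 - (b ^+ 2 + 4 * (P * (1 + Q) + 1))) / 4 =
    (t + P) * (t - 1 - Q) - 1 by rewrite /b; field.
  have -> : (t - 1) * v 0 w * ((t + P) * (t - 1 - Q) - 1) =
    (t - 1) * (t + P) * v 0 w * (t - 1 - Q) - (t - 1) * v 0 w by ring.
  by rewrite rel_w -rel_z; ring.
move/eqP; rewrite !mulf_eq0 (negPf t1') (negPf vw) !subr_eq0 /=.
by case/orP => ->; rewrite ?orbT.
Qed.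

End DoubleStar.

Section Connected.
Variables (n : nat) (F : sgraph n) (c : 'I_n -> bool).
Hypothesis bip : forall i j, F i j -> c i != c j.

Let same i j : c i = c j -> F i j = false.
Proof. by move=> cij; apply/negP => /bip; rewrite cij eqxx. Qed.

Let fullP i j : full F c i -> c i != c j -> F i j.
Proof. by move=> /forallP/(_ j); rewrite /bicompl => + cij; rewrite cij negbK. Qed.

(** If F is complete bipartite, its complement consists of two cliques.
    Otherwise an edge that avoids both w and z closes a 4-cycle through w and z.
    Without one, F is a double star: with at least six vertices its q is at most
    4, with five it has a claw while the complement has a 4-cycle, and with four
    it is P_4. *)
Lemma both_sides_full w z : c w -> ~~ c z -> full F c w -> full F c z ->
  (q R F + q R (compl F) <= n + 2)%N \/ isog F (pathg 4).
Proof.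
move=> cw cz fw fz.
have [//|nb] := leqP (q R F + q R (compl F)) (n + 2); [by left|right].
have qF := q_le_size R F; have co4 := co_bipartite_q4 R bip.
have [[x [y [cx cy xy]]]|none] := pselect (exists x y, [/\ c x, ~~ c y & ~~ F x y]); last first.
  suff : (q R (compl F) <= 2)%N by lia.
  apply: (two_cliques R bip) => i j; apply/negP => /andP[cij Fij]; apply: none.
  case ci: (c i) cij; case cj: (c j) => // _; first by exists i, j; rewrite cj.
  by exists j, i; rewrite edge_sym ci.
have Fwz : F w z by apply: fullP; rewrite // cw (negPf cz).
have xw : x != w by apply: contra xy => /eqP ->; apply: fullP; rewrite // cw (negPf cy).
have yz : y != z.
  by apply: contra xy => /eqP ->; rewrite edge_sym; apply: fullP; rewrite // cx (negPf cz).
have Fw u : ~~ c u -> F w u by move=> cu; apply: fullP; rewrite // cw (negPf cu).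
have Fz u : c u -> F z u by move=> cu; apply: fullP; rewrite // cu (negPf cz).
have no4 a b : c a -> ~~ c b -> a != w -> b != z -> F a b = false.
  move=> ca cb aw bz; apply/negP => Fab.
  have Fbw : F b w by rewrite edge_sym Fw.
  exact: bound_fails_q4 nb co4 (four_cycle_q R Fab Fbw Fwz (Fz a ca) aw bz).
have star a b : c a -> ~~ c b -> F a b = (a == w) || (b == z).
  move=> ca cb; have [->|aw] := eqVneq a w; first by rewrite Fw.
  have [->|bz] := eqVneq b z; first by rewrite edge_sym Fz.
  by rewrite no4.
have n5 := bound_fails_both_q4 nb (double_star_q cw cz same star) co4.
have ne i j : c i -> ~~ c j -> i != j by move=> ci; apply: contra => /eqP <-.
have all_in u : u \in [:: y; w; z; x].
  apply: contrapT => /negP; rewrite !inE !negb_or => /and4P[uy uw uz ux].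
  case cu: (c u).
    have Fzw : F z w by rewrite edge_sym.
    have claw := claw_q R Fzw (Fz _ cx) (Fz _ cu).
    rewrite /= !inE negb_or (eq_sym w) xw (eq_sym w) uw (eq_sym x) ux in claw.
    have := @four_cycle_q R n (compl F) x w u y.
    rewrite /= /compl_rel xw (eq_sym w) uw (ne u) // (eq_sym y) (ne x) // (eq_sym x) ux (ne w) //.
    rewrite (same (i := x)) ?cx ?cw // (same (i := w)) ?cu ?cw // no4 ?cu // edge_sym xy.
    by move/(_ isT isT isT isT isT isT); apply: bound_fails_small nb n5 (claw isT).
  have Fwz' := Fw _ (negbT cu).
  have claw := claw_q R Fwz (Fw _ cy) Fwz'.
  rewrite /= !inE negb_or (eq_sym z) yz (eq_sym z) uz (eq_sym y) uy in claw.
  have := @four_cycle_q R n (compl F) y z u x.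
  rewrite /= /compl_rel yz (eq_sym z) uz ux (ne x) // (eq_sym y) uy (eq_sym z) (ne x) //.
  rewrite (same (i := y)) ?(negPf cy) ?(negPf cz) // (same (i := z)) ?cu ?(negPf cz) //.
  rewrite [F u x]edge_sym no4 ?cu // xy.
  by move/(_ isT isT isT isT isT isT); apply: bound_fails_small nb n5 (claw isT).
apply: (isog_of_seq (x0 := w) _ _ all_in) => //.
  by rewrite /= !inE !negb_or yz (eq_sym y w) (ne w y) // (eq_sym y x) (ne x y) // (ne w z) // (eq_sym w x) xw (eq_sym z x) ne.
have wyE := Fw _ cy; have zxE := Fz _ cx.
have yzE : F y z = false by rewrite same // (negPf cy) (negPf cz).
have wxE : F w x = false by rewrite same // cw cx.
case=> [[|[|[|[|i]]]] Hi] [[|[|[|[|j]]]] Hj] //=; rewrite /path_rel /= ?edge_irr //;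
  first [done | by rewrite edge_sym | by apply/negbTE | by apply/negbTE; rewrite edge_sym].
Qed.

End Connected.

End Bipartite.

Lemma bound_fails_q2 a b n : (n + 2 < a + b -> a <= n -> ~ b <= 2)%N.
Proof. by lia. Qed.

Lemma bound_fails_size a b n : (n + 2 < a + b -> a <= n -> b <= n -> 2 < n)%N.
Proof. by lia. Qed.

Lemma bound_fails_union_q3 a b m n k : (a <= maxn m k -> 0 < m -> 0 < k -> m + k = n -> n + 2 < a + b -> ~ b <= 3)%N.
Proof. by lia. Qed.

Lemma bound_fails_union_q4 a b m n k : (a <= maxn m k -> m + k = n -> n + 2 < a + b -> b <= 4 ->
  0 < m -> 0 < k -> m = 1 \/ k = 1)%N.
Proof. by lia. Qed.

Section BipartiteGraphs.
Variable R : realType.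
Implicit Types (n : nat).

(** The complement has q at most 3, so if the bound fails then F contains
    neither a claw nor a 4-cycle. As w is joined to its whole opposite class,
    this class has exactly two vertices, none of them full, and each of them has
    exactly one private neighbour: F is P_5. *)
Lemma one_side_full n (F : sgraph n) (c : 'I_n -> bool) b w :
  (forall i j, F i j -> c i != c j) -> connectedg F -> c w = b -> full F c w ->
  (forall z, c z = ~~ b -> ~~ full F c z) ->
  (q R F + q R (compl F) <= n + 2)%N \/ isog F (pathg 5).
Proof.
move=> bip con cw fw nf.
have [//|nb] := leqP (q R F + q R (compl F)) (n + 2); [by left|right].
have same i j : c i = c j -> F i j = false.
  by move=> cij; apply/negP => /bip; rewrite cij eqxx.
have Fw u : c u = ~~ b -> F w u.
  by move=> cu; move/forallP/(_ u): fw; rewrite /bicompl cw cu; case: (b); rewrite negbK.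
have n2 := bound_fails_size nb (q_le_size R F) (q_le_size R (compl F)).
have nbr x : exists y, F x y by apply: neighbour_ex => //; apply: leq_trans n2.
have flip x y d : F x y -> c x = d -> c y = ~~ d.
  by move=> /bip + <-; case: (c x); case: (c y).
have [y0 wy0] := nbr w; have cy0 := flip _ _ _ wy0 cw.
have co3 : (q R (compl F) <= 3)%N.
  by apply: (@co_bipartite_q3 R _ _ c (~~ b)) => //; exists y0.
have cyc x y y' : F x y -> F x y' -> x != w -> c x = b -> y = y'.
  move=> xy xy' xw cx; apply/eqP/negPn/negP => yy'.
  have yx : F y x by rewrite edge_sym.
  have y'w : F y' w by rewrite edge_sym Fw // (flip _ _ _ xy' cx).
  have wy : F w y by rewrite Fw // (flip _ _ _ xy cx).
  rewrite eq_sym in yy'.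
  exact: bound_fails_q4 nb (leqW co3) (four_cycle_q R xy' y'w wy yx xw yy').
have claw v x y z : F v x -> F v y -> F v z -> x != y -> x != z -> y == z.
  move=> vx vy vz xy xz; apply: contrapT => /negP yz.
  apply: bound_fails_q3 nb co3 (claw_q R vx vy vz _).
  by rewrite /= !inE negb_or xy xz yz.
(* some x1 is not joined to y0, and some x2 is not joined to the neighbour y1 of
   x1; a neighbour of x2 can only be y0 *)
have miss y : c y = ~~ b -> exists2 x, c x = b & ~~ F y x.
  move=> cy; have := nf y cy; rewrite negb_forall => /existsP[x /negPn/andP[yx Fyx]].
  by exists x => //; move: yx; rewrite cy; case: (b); case: (c x).
have [x1 cx1 y0x1] := miss y0 cy0; have [y1 x1y1] := nbr x1.
have cy1 := flip _ _ _ x1y1 cx1; have [x2 cx2 y1x2] := miss y1 cy1.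
have [y2 x2y2] := nbr x2; have cy2 := flip _ _ _ x2y2 cx2.
have wy1 := Fw y1 cy1; have wy2 := Fw y2 cy2.
have x1w : x1 != w by apply: contra y0x1 => /eqP ->; rewrite edge_sym.
have x2w : x2 != w by apply: contra y1x2 => /eqP ->; rewrite edge_sym.
have y10 : y1 != y0 by apply: contra y0x1 => /eqP <-; rewrite edge_sym.
have y12 : y1 != y2 by apply: contra y1x2 => /eqP ->; rewrite edge_sym.
have x12 : x1 != x2 by apply: contra y1x2 => /eqP <-; rewrite edge_sym.
have y02 : y0 = y2 by apply/eqP/(claw w y1).
move: x2y2 wy2 {cy2} y12; rewrite -y02 => x2y0 _ _ {y2 y02}.
have y0w : F y0 w by rewrite edge_sym.
have y1w : F y1 w by rewrite edge_sym.
have y1x1 : F y1 x1 by rewrite edge_sym.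
have y0x2 : F y0 x2 by rewrite edge_sym.
have in_y u : c u = ~~ b -> (u == y0) || (u == y1).
  move=> cu; have [//|uy0] := eqVneq u y0.
  by rewrite eq_sym; apply: (claw w y0 y1 u) => //; rewrite ?Fw // eq_sym.
have all_in u : u \in [:: x2; y0; w; y1; x1].
  rewrite !inE; have [cu|cu] : c u = ~~ b \/ c u = b by case: (b); case: (c u); auto.
    by case/orP: (in_y u cu) => ->; rewrite !orbT.
  have [->|uw] := eqVneq u w; first by rewrite !orbT.
  have [y uy] := nbr u; have cy := flip _ _ _ uy cu.
  have yu : F y u by rewrite edge_sym.
  case/orP: (in_y y cy) => /eqP yE; rewrite yE in yu.
    by rewrite eq_sym (claw y0 w x2 u) // eq_sym.
  by rewrite (eq_sym u x1) (claw y1 w x1 u) ?orbT // eq_sym.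
have ne i j : c i = b -> c j = ~~ b -> i != j.
  by move=> ci cj; apply/negP => /eqP ij; move: cj; rewrite -ij ci; case: (b).
apply: (isog_of_seq (x0 := w) _ _ all_in) => //.
  rewrite /= !inE !negb_or (ne x2 y0) // x2w (ne x2 y1) // (eq_sym x2) x12.
  rewrite (eq_sym y0 w) (ne w y0) // (eq_sym y0 y1) y10 (eq_sym y0 x1) (ne x1 y0) //.
  by rewrite (ne w y1) // (eq_sym w x1) x1w (eq_sym y1) ne.
have s1 : F x2 w = false by rewrite same // cx2 cw.
have s2 : F x2 x1 = false by rewrite same // cx2 cx1.
have s3 : F w x1 = false by rewrite same // cx1 cw.
have s4 : F y0 y1 = false by rewrite same // cy0 cy1.
case=> [[|[|[|[|[|i]]]]] Hi] [[|[|[|[|[|j]]]]] Hj] //=; rewrite /path_rel /= ?edge_irr //;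
  first [done | by rewrite edge_sym | by apply/negbTE | by apply/negbTE; rewrite edge_sym].
Qed.

(** In the disconnected case the number of values of F is bounded by the larger
    part, and an isolated vertex makes one colour class free of full vertices.
    In the connected case one counts the classes that contain a full vertex. *)
Lemma bipartite_bound n (F : sgraph n) : bipartite F ->
  (q R F + q R (compl F) <= n + 2)%N \/ isog F (pathg 4) \/ isog F (pathg 5).
Proof.
case=> c bip.
have [//|nb] := leqP (q R F + q R (compl F)) (n + 2); [by left|right].
have co4 := co_bipartite_q4 R bip.
have same i j : c i = c j -> F i j = false.
  by move=> cij; apply/negP => /bip; rewrite cij eqxx.
have [[C sep]|con] := pselect (exists C, separated F C).
  exfalso.
  have iso_co u : (1 < n)%N -> (forall j, F u j = false) -> (q R (compl F) <= 3)%N.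
    move=> n1 Fu; have [[v cv]|none] := pselect (exists v, c v = ~~ c u).
      apply: (@co_bipartite_q3 R _ _ c (~~ c u)) => //; last by exists v.
      move=> x cx; rewrite negb_forall; apply/existsP; exists u.
      by rewrite negbK /bicompl edge_sym Fu cx; case: (c u).
    have mono x : c x = c u.
      apply/eqP/negPn/negP => xu; apply: none; exists x.
      by move: xu; case: (c x); case: (c u).
    have F0 i j : F i j = false by apply: same; rewrite !mono.
    apply: (@co_bipartite_q3 R _ _ (fun k => k == u) false).
    - by move=> i j; rewrite F0.
    - move=> i iu; rewrite negb_forall; apply/existsP; exists u.
      by rewrite negbK /bicompl F0 iu eqxx.
    - have [v vu] : exists v, v \in [set~ u].
        by apply/set0Pn; rewrite -card_gt0 cardsC1 card_ord; case: (n) n1 => // -[].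
      by exists v; apply/negbTE; rewrite !inE in vu.
  have [G1 [G2 [iso [C0 C1 CE]]]] := separated_gunion sep.
  have := gunion_q_le R G1 G2; rewrite (q_isog R iso) => qF.
  have n1 : (1 < n)%N by move: C0 C1 CE; clear; lia.
  have [_ _ no] := sep.
  apply: (bound_fails_union_q3 qF C0 C1 CE nb).
  have [/eqP/cards1P[u Cu]|/eqP/cards1P[u Cu]] := bound_fails_union_q4 qF CE nb co4 C0 C1.
    apply: (iso_co u n1) => j; have [->|ju] := eqVneq j u; first by rewrite edge_irr.
    by apply: no; rewrite Cu !inE.
  apply: (iso_co u n1) => j; have [->|ju] := eqVneq j u; first by rewrite edge_irr.
  have inC x : (x \in C) = (x != u) by have /setP/(_ x) := Cu; rewrite !inE => <-; rewrite negbK.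
  by rewrite edge_sym; apply: no; rewrite inC // eqxx.
have {}con : connectedg F by move=> C sep; apply: con; exists C.
have [[w fw]|none] := pselect (exists w, full F c w); last first.
  exfalso; apply: (bound_fails_q2 nb (q_le_size R F)).
  by apply: (co_bipartite_no_full R bip) => i; apply/negP => fi; apply: none; exists i.
have [[z [cz fz]]|nf] := pselect (exists z, c z = ~~ c w /\ full F c z); last first.
  have [] := @one_side_full n F c (c w) w bip con erefl fw; last by right.
    by move=> z cz; apply/negP => fz; apply: nf; exists z.
  by move: nb; clear; lia.
left; have [] : (q R F + q R (compl F) <= n + 2)%N \/ isog F (pathg 4); last by [].
  case cw: (c w) cz => /= cz.
    by apply: (both_sides_full R bip (w := w) (z := z)); rewrite ?cw ?cz.
  by apply: (both_sides_full R bip (w := z) (z := w)); rewrite ?cw ?cz.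
by move: nb; clear; lia.
Qed.

End BipartiteGraphs.

(** * Cycles in graphs that are not bipartite *)

Section ClosingCycles.
Implicit Types (n : nat).

Definition inside n (H : sgraph n) (B : {set 'I_n}) : rel 'I_n :=
  fun x y => [&& x \in B, y \in B & H x y].

Lemma path_inside n (H : sgraph n) (B : {set 'I_n}) x p :
  path (inside H B) x p -> path H x p /\ (forall y, y \in p -> y \in B).
Proof.
elim: p x => [|y p IH] x //= /andP[/and3P[xB yB xy] /IH[yp pB]]; split; first by rewrite xy.
by move=> z; rewrite inE => /orP[/eqP->|/pB].
Qed.

(** A path inside B between two neighbours of v closes up through v. *)
Lemma closing_cycle n (H : sgraph n) (B : {set 'I_n}) u u' v :
  connect (inside H B) u u' -> u \in B -> v \notin B -> u != u' -> H v u -> H v u' ->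
  exists p, [/\ uniq (v :: u :: p), cycle H (v :: u :: p) & p != [::]].
Proof.
case/connectP=> p0 up0 -> uB vB; case/shortenP: up0 => p up upq _ {p0} uu' vu vu'.
have [Hp pB] := path_inside up.
exists p; split.
- rewrite cons_uniq upq andbT inE negb_or; apply/andP; split.
    by apply: contra vB => /eqP ->.
  by apply: contra vB => /pB.
- by rewrite /= vu rcons_path Hp edge_sym.
- by case: p uu' {up upq Hp pB vu'} => //=; rewrite eqxx.
Qed.

Lemma inside_sub n (H : sgraph n) (B B' : {set 'I_n}) x y : B \subset B' ->
  connect (inside H B) x y -> connect (inside H B') x y.
Proof.
move=> /fintype.subsetP BB'; apply: connect_sub => a b /and3P[aB bB ab].
by apply: connect1; rewrite /inside !BB'.
Qed.

(** Vertices are coloured one at a time, next to the coloured set B whenever an edge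
    leaves B. The vertices of B with a neighbour outside then lie in one component
    of B: this is kept by each step, and it makes the coloured neighbour of a
    new vertex unique, as a second one would close a cycle. *)
Lemma acyclic_bipartite n (H : sgraph n) :
  (forall c, uniq c -> cycle H c -> (size c < 3)%N) -> bipartite H.
Proof.
move=> acy.
pose front (B : {set 'I_n}) u := (u \in B) && [exists v, (v \notin B) && H u v].
suff grow k : (k <= n)%N -> exists B : {set 'I_n}, [/\ #|B| = k,
    exists c : 'I_n -> bool, forall i j, i \in B -> j \in B -> H i j -> c i != c j &
    forall u u', front B u -> front B u' -> connect (inside H B) u u'].
  have [B [Bn [c cP] _]] := grow n (leqnn n).
  have BT x : x \in B.
    apply/negPn/negP => xB; have := max_card (mem (x |: B)).
    by rewrite cardsU1 xB Bn card_ord ltnn.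
  by exists c => i j; apply: cP.
elim: k => [_|k IH kn].
  exists finset.set0; split; first by rewrite cards0.
    by exists predT => i j; rewrite inE.
  by move=> u u'; rewrite /front inE.
have [B [Bk [c cP] conn]] := IH (ltnW kn).
have [v [vB fr]] : exists v, v \notin B /\
    ((exists2 u, u \in B & H u v) \/ (forall u, ~~ front B u)).
  have [/existsP[u fu]|/existsPn none] := boolP [exists u, front B u].
    have /andP[uB /existsP[v /andP[vB uv]]] := fu.
    by exists v; split=> //; left; exists u.
  have [v vB] : exists v, v \in ~: B.
    by apply/finset.set0Pn; rewrite -card_gt0 cardsCs finset.setCK card_ord Bk subn_gt0.
  by exists v; split; [rewrite inE in vB | right].
have frontv u : u \in B -> H u v -> front B u.
  by move=> uB uv; rewrite /front uB; apply/existsP; exists v; rewrite vB.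
have one u u' : u \in B -> u' \in B -> H u v -> H u' v -> u = u'.
  move=> uB u'B uv u'v; apply/eqP/negPn/negP => uu'.
  have con := conn _ _ (frontv u uB uv) (frontv u' u'B u'v).
  rewrite edge_sym in uv; rewrite edge_sym in u'v.
  have [p [up cp p0]] := closing_cycle con uB vB uu' uv u'v.
  by have := acy _ up cp; case: (p) p0.
exists (v |: B); split; first by rewrite cardsU1 vB Bk.
  pose cv := if [pick u | (u \in B) && H u v] is Some u then ~~ c u else true.
  have cvP u : u \in B -> H u v -> c u != cv.
    move=> uB uv; rewrite /cv; case: pickP => [u' /andP[u'B u'v]|/(_ u)]; last by rewrite uB uv.
    by rewrite (one u u') //; case: (c u').
  exists (fun x => if x == v then cv else c x) => i j.
  rewrite !inE; case: (eqVneq i v) => [->|iv] /=; case: (eqVneq j v) => [->|jv] //=.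
  - by rewrite edge_irr.
  - by move=> _ jB; rewrite edge_sym eq_sym => /cvP->.
  - by move=> iB _ /cvP->.
  - exact: cP.
have step u : front (v |: B) u -> u = v \/ front B u.
  case/andP; rewrite !inE => /orP[/eqP->|uB] /existsP[x]; first by left.
  rewrite !inE negb_or -andbA => /and3P[_ xB ux]; right.
  by rewrite /front uB; apply/existsP; exists x; rewrite xB.
move=> u u' fu fu'.
have main w : front (v |: B) w -> connect (inside H (v |: B)) v w.
  move=> fw; case: (step w fw) => [->//|fBw].
  case: fr => [[x xB xv]|none]; last by rewrite (negPf (none w)) in fBw.
  apply: (connect_trans (y := x)); first by apply: connect1; rewrite /inside !inE eqxx xB orbT edge_sym.
  by apply: inside_sub (conn _ _ (frontv x xB xv) fBw); apply: finset.subsetUr.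
apply: (connect_trans (y := v)); last exact: main.
rewrite sym_connect_sym; first exact: main.
by move=> a b; rewrite /inside andbCA edge_sym.
Qed.

End ClosingCycles.

(** * Orthogonal representations in dimension three *)

Section Representation.
Variable R : realType.
Local Open Scope ring_scope.
Implicit Types (n : nat) (p : {poly R}).

Lemma non_root_ex p : p != 0 -> exists2 x, 0 < x & p.[x] != 0.
Proof.
move=> p0; apply: contrapT => none.
have := @max_poly_roots R p [seq k.+1%:R | k <- iota 0 (size p)] p0.
rewrite size_map size_iota ltnn; case/(_ _ _)/notF; last first.
  rewrite map_inj_uniq ?iota_uniq // => i j /eqP.
  by rewrite eqr_nat => /eqP[].
apply/allP => _ /mapP[k _ ->]; apply/rootP/eqP/negPn/negP => pk.
by apply: none; exists k.+1%:R; rewrite ?ltr0n.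
Qed.

Local Notation vec := (R * R * R)%type.
Definition dot (u v : vec) : R := u.1.1 * v.1.1 + u.1.2 * v.1.2 + u.2 * v.2.
Definition cross (u v : vec) : vec :=
  (u.1.2 * v.2 - u.2 * v.1.2, u.2 * v.1.1 - u.1.1 * v.2, u.1.1 * v.1.2 - u.1.2 * v.1.1).

Lemma dotC u v : dot u v = dot v u.
Proof. by rewrite /dot; ring. Qed.

Lemma dot_cross u r w : dot (cross u r) w = dot r (cross w u).
Proof. by rewrite /dot /cross /=; ring. Qed.

Lemma dot_cross_l u r : dot (cross u r) u = 0.
Proof. by rewrite /dot /cross /=; ring. Qed.

Lemma crossC u v : cross u v = 0 -> cross v u = 0.
Proof.
by rewrite /cross => -[h1 h2 h3]; congr (_, _, _); [move: h1|move: h2|move: h3]; lra.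
Qed.

(** The moment curve (1, x, x^2) meets each plane through 0 in finitely many
    points: the product of the corresponding nonzero polynomials has finitely
    many roots. *)
Lemma moment_curve (S : seq vec) : 0 \notin S ->
  exists r, forall g, g \in S -> dot r g != 0.
Proof.
pose P (g : vec) : {poly R} := Poly [:: g.1.1; g.1.2; g.2].
move=> S0; have P0 : \prod_(g <- S) P g != 0.
  rewrite prodf_seq_neq0; apply/allP => g gS /=.
  apply: contra S0 => /eqP/polyP Pg; suff <- : g = 0 by [].
  have := Pg 0; have := Pg 1; have := Pg 2; rewrite !coef_Poly !coef0 /=.
  by case: (g) => [[g1 g2] g3] /= -> -> ->.
have [x _ Px] := non_root_ex P0.
exists (1, x, x ^+ 2) => g gS; apply: contra Px => /eqP gx.
rewrite horner_prod prodf_seq_eq0; apply/hasP; exists g => //=.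
by apply/eqP; rewrite -[RHS]gx horner_Poly /dot /=; ring.
Qed.

(** A vector orthogonal to u but to no other vector of a family, and parallel to
    none: v = u x r for a generic r. Indeed <u x r, w> = <r, w x u>, and (u x r)
    x w = r <u,w> - u <r,w> is not 0: if <u,w> = 0 because <r,w> is not 0, and
    otherwise because r is not parallel to u. *)
Lemma orthogonal_extension (S : seq vec) (u w0 : vec) : w0 \in S -> cross w0 u != 0 ->
  (forall w, w \in S -> w != 0) -> (forall w, w \in S -> w != u -> cross w u != 0) ->
  exists v, [/\ dot v u = 0, forall w, w \in S -> w != u -> dot v w != 0 &
    forall w, w \in S -> cross v w != 0].
Proof.
move=> w0S w0u S0 Su.
have [] := @moment_curve (S ++ [seq cross w u | w <- S & w != u]).
  rewrite mem_cat negb_or; apply/andP; split; first by apply/negP => /S0; rewrite eqxx.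
  by apply/negP => /mapP[w]; rewrite mem_filter => /andP[wu wS] /esym/eqP; apply/negP/Su.
move=> r rP; have rS w : w \in S -> dot r w != 0 by move=> wS; apply: rP; rewrite mem_cat wS.
have rC w : w \in S -> w != u -> dot r (cross w u) != 0.
  move=> wS wu; apply: rP; rewrite mem_cat; apply/orP; right.
  by apply/mapP; exists w; rewrite // mem_filter wu.
exists (cross u r); split.
- exact: dot_cross_l.
- by move=> w wS wu; rewrite dot_cross rC.
move=> w wS; apply/negP => /eqP; rewrite /cross /= => -[h1 h2 h3].
(* the coordinates of (u x r) x w = r <u,w> - u <r,w> *)
have rE : [/\ r.1.1 * dot u w = u.1.1 * dot r w, r.1.2 * dot u w = u.1.2 * dot r w
  & r.2 * dot u w = u.2 * dot r w].
  by rewrite /dot; split; [move: h1|move: h2|move: h3]; move=> /eqP; rewrite -subr_eq0 => /eqP hh; apply/eqP; rewrite -subr_eq0 -hh; apply/eqP; ring.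
case: rE => e1 e2 e3.
have [uw|uw] := eqVneq (dot u w) 0.
  have u0 : u = 0.
    have rw := rS w wS.
    have z (x : R) : 0 = x * dot r w -> x = 0.
      by move/esym/eqP; rewrite mulf_eq0 (negPf rw) orbF => /eqP.
    move: e1 e2 e3; rewrite uw !mulr0 => /z e1 /z e2 /z e3.
    by move: e1 e2 e3; case: (u) => [[x y] z'] /= -> -> ->.
  by move/eqP: w0u; apply; rewrite u0 /cross /= !mulr0 !subr0.
have : dot r (cross w0 u) * dot u w == 0.
  apply/eqP; have -> : dot r (cross w0 u) * dot u w =
    (r.1.1 * dot u w) * (cross w0 u).1.1 + (r.1.2 * dot u w) * (cross w0 u).1.2
     + (r.2 * dot u w) * (cross w0 u).2 by rewrite {1}/dot; ring.
  by rewrite e1 e2 e3 /cross /=; ring.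
rewrite mulf_eq0 (negPf uw) orbF; apply/negP/rC => //.
by apply: contra w0u => /eqP ->; rewrite /cross /= ; apply/eqP; congr (_, _, _); ring.
Qed.

End Representation.

Section RepresentationQ.
Variable R : realType.
Local Open Scope ring_scope.
Local Notation vec := (R * R * R)%type.
Variables (n : nat) (H : sgraph n) (a b c : 'I_n).
Hypotheses (n6 : (6 <= n)%N) (con : connectedg H).
Hypotheses (ab : H a b) (bc : H b c) (ac : H a c).
Hypothesis short : forall s, uniq s -> cycle H s -> (size s <= 3)%N.
Local Notation triangle := [:: a; b; c].
Hypothesis only : forall x y z, H x y -> H y z -> H x z -> x \in triangle.

Let e1 : vec := (1, 0, 0).
Let e2 : vec := (0, 1, 0).
Let e3 : vec := (0, 0, 1).

Let abc : uniq triangle.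
Proof. by rewrite /= !inE !negb_or (edge_neq ab) (edge_neq ac) (edge_neq bc). Qed.

(** A faithful orthogonal representation of the complement of H on B. That no
    two vectors are parallel is part of it, since the extension step needs it.
    *)
Definition represents (B : {set 'I_n}) (f : 'I_n -> vec) :=
  forall i j, i \in B -> j \in B -> i != j ->
    (dot (f i) (f j) == 0) = H i j /\ cross (f i) (f j) != 0.

(** H is grown from the triangle, whose vertices get the standard basis. Every
    new vertex v is adjacent to some u in the connected set B built so far, and
    to no other vertex of B, since a second neighbour would close a long cycle
    or a second triangle; so v only has to be orthogonal to f u. *)
Lemma representation_ex : exists f, [/\ f a = e1, f b = e2, f c = e3 &
  forall i j, i != j -> (dot (f i) (f j) == 0) = H i j].
Proof.
have three : #|[set x in triangle]| = 3%N by rewrite cardsE (card_uniqP abc).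
suff grow k : (3 + k <= n)%N -> exists (B : {set 'I_n}) (f : 'I_n -> vec),
    [/\ #|B| = (3 + k)%N, {subset triangle <= B}, f a = e1 /\ f b = e2 /\ f c = e3,
      {in B &, forall i j, connect (inside H B) i j} & represents B f].
  have [|B [f [Bn _ [fa [fb fc]] _ rep]]] := grow (n - 3)%N; first by move: n6; lia.
  have BT x : x \in B.
    apply/negPn/negP => xB; have := max_card (mem (x |: B)).
    by rewrite cardsU1 xB Bn card_ord; move: n6; lia.
  by exists f; split=> // i j ij; case: (rep i j (BT i) (BT j) ij).
elim: k => [_|k IH kn].
  exists [set x in triangle], (fun x => if x == a then e1 else if x == b then e2 else e3).
  have [ba ca cb] : [/\ b == a = false, c == a = false & c == b = false].
    by split; apply/negbTE; rewrite eq_sym; apply: (edge_neq (H := H)).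
  split.
  - by rewrite three.
  - by move=> x xT; rewrite inE.
  - by rewrite /= !eqxx ba ca cb.
  - move=> i j iT jT; have [->//|ij] := eqVneq i j.
    apply: connect1; rewrite /inside iT jT /=; move: iT jT ij; rewrite !inE.
    case/or3P=> /eqP-> /or3P[]/eqP->; rewrite ?eqxx // => _; rewrite ?ab ?bc ?ac //;
    by rewrite edge_sym.
  move=> i j; rewrite !inE.
  have nz : (1 == 0 :> R) = false by rewrite oner_eq0.
  by case/or3P=> /eqP-> /or3P[]/eqP->; rewrite ?eqxx ?ba ?ca ?cb // => _;
    rewrite ?[H b a]edge_sym ?[H c a]edge_sym ?[H c b]edge_sym ?ab ?ac ?bc /dot /cross /= ?xpair_eqE
     !(mul0r, mulr0, addr0, add0r, mul1r, mulr1, subr0, sub0r, oppr_eq0) ?eqxx ?nz //= ?andbF.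
have [|B [f [Bk TB [fa [fb fc]] conn rep]]] := IH; first by move: kn; lia.
have [u [v [uB vB uv]]] : exists u v, [/\ u \in B, v \notin B & H u v].
  apply: contrapT => none; apply: (con (C := B)); split.
  - by rewrite Bk.
  - by rewrite Bk; move: kn; lia.
  - by move=> i j iB jB; apply/negP => ij; apply: none; exists i, j.
have vu : H v u by rewrite edge_sym.
have one w : w \in B -> H v w -> w = u.
  move=> wB vw; apply/eqP/negPn/negP; rewrite eq_sym => uw.
  have [p [up cp p0]] := closing_cycle (conn _ _ uB wB) uB vB uw vu vw.
  case: p p0 up cp => [//|x [|y p]] _ up cp; last by have := short up cp.
  move: cp; rewrite /= => /and4P[_ ux xv _].
  have := only vu ux; rewrite edge_sym => /(_ xv) vT.
  by move: vB; rewrite TB.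
have finj i j : i \in B -> j \in B -> f i = f j -> i = j.
  move=> iB jB fij; apply/eqP/negPn/negP => ij.
  have [_] := rep i j iB jB ij; rewrite fij /cross => /eqP; apply.
  by congr (_, _, _); ring.
have f0 i : i \in B -> f i != 0.
  move=> iB; have [j jT ij] : exists2 j, j \in triangle & i != j.
    have [->|] := eqVneq i a; last by exists a; rewrite // mem_head.
    by exists b; rewrite ?(edge_neq ab) // !inE eqxx orbT.
  have [_] := rep i j iB (TB _ jT) ij; apply: contra => /eqP ->.
  by rewrite /cross /= !mul0r !subr0.
have [w0 w0T uw0] : exists2 j, j \in triangle & j != u.
  have [au|] := eqVneq a u; last by exists a; rewrite // mem_head.
  by exists b; rewrite -?au ?[b == a]eq_sym ?(edge_neq ab) // !inE eqxx orbT.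
have memS w : w \in [seq f i | i <- enum B] -> exists2 i, i \in B & w = f i.
  by case/mapP=> i; rewrite mem_enum => iB ->; exists i.
have inS i : i \in B -> f i \in [seq f i | i <- enum B].
  by move=> iB; apply: map_f; rewrite mem_enum.
have [] := @orthogonal_extension R [seq f i | i <- enum B] (f u) (f w0) (inS _ (TB _ w0T)).
- by have [] := rep w0 u (TB _ w0T) uB uw0.
- by move=> w /memS[i iB ->]; apply: f0.
- move=> w /memS[i iB ->] fiu; have iu : i != u by apply: contra fiu => /eqP ->.
  by have [] := rep i u iB uB iu.
move=> g [gu gB gS].
exists (v |: B), (fun x => if x == v then g else f x).
have ne x : x \in B -> x != v by apply: contraTneq => ->.
split.
- by rewrite cardsU1 vB Bk addnS.
- by move=> x /TB xB; rewrite !inE xB orbT.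
- by rewrite !(negPf (ne _ (TB _ _))) ?fa ?fb ?fc // !inE eqxx ?orbT.
- have vw w : w \in v |: B -> connect (inside H (v |: B)) v w.
    rewrite !inE => /orP[/eqP->//|wB]; apply: (connect_trans (y := u)).
      by apply: connect1; rewrite /inside !inE eqxx uB orbT.
    by apply: inside_sub (conn _ _ uB wB); apply: finset.subsetUr.
  move=> i j iB jB; apply: (connect_trans (y := v)); last exact: vw.
  rewrite sym_connect_sym; first exact: vw.
  by move=> x y; rewrite /inside andbCA edge_sym.
have key x : x \in B -> (dot g (f x) == 0) = H v x /\ cross g (f x) != 0.
  move=> xB; split; last exact: gS (inS _ xB).
  have [->|xu] := eqVneq x u; first by rewrite gu eqxx vu.
  have -> : H v x = false by apply/negP => /(one x xB) xu'; rewrite xu' eqxx in xu.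
  by apply/negbTE/gB; rewrite ?inS //; apply: contra xu => /eqP /finj ->.
move=> i j; rewrite !inE.
case: (eqVneq i v) => [->|iv] /=; case: (eqVneq j v) => [->|jv] //=.
- by move=> _ jB _; apply: key.
- move=> iB _ _; have [k1 k2] := key i iB; rewrite dotC edge_sym; split=> //.
  by apply: contra k2 => /eqP /crossC ->.
- exact: rep.
Qed.

End RepresentationQ.

Section RepresentationMatrix.
Variable R : realType.
Local Open Scope ring_scope.

Lemma le_sum_squares (g1 g2 g3 : R) (s := g1 ^+ 2 + g2 ^+ 2 + g3 ^+ 2) :
  [/\ g1 ^+ 2 <= s, g2 ^+ 2 <= s & g3 ^+ 2 <= s].
Proof.
have := sqr_ge0 g1; have := sqr_ge0 g2; have := sqr_ge0 g3.
by rewrite /s; split; lra.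
Qed.

Lemma positive_gap (T r d s : R) : - r <= T -> d <= s -> 0 < 1 + T + s + r - d.
Proof. by lra. Qed.

(** The Gram matrix of the representation, with vector i scaled by s_i, has the
    nonzero eigenvalues of the 3 x 3 matrix N = sum of s_i^2 f_i^T f_i. Off the
    diagonal the entries of N come only from the vertices outside the triangle,
    and they are nonzero for suitable scalings s_i^2 = sg^i, because every two
    vertices of the triangle have a common non-neighbour outside. Three nonzero
    numbers are the entries off the diagonal of a matrix rho g^T g of rank one,
    and the scalings of the three basis vectors change the diagonal of N at
    will, as long as it is large: N becomes al + rho g^T g. So the eigenvalues
    are 0, al and al + rho |g|^2. *)
Lemma representation_q n (H : sgraph n) (a b c : 'I_n) : (6 <= n)%N -> connectedg H ->
  H a b -> H b c -> H a c -> (forall s, uniq s -> cycle H s -> (size s <= 3)%N) ->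
  (forall x y z, H x y -> H y z -> H x z -> x \in [:: a; b; c]) ->
  (forall t x y, t \in [:: a; b; c] -> x \notin [:: a; b; c] -> y \notin [:: a; b; c] ->
     H t x -> H t y -> x = y) ->
  (q R (compl H) <= 3)%N.
Proof.
move=> n6 con ab bc ac short only lone.
have [f [fa fb fc rep]] := representation_ex R n6 con ab bc ac short only.
have aT : a \in [:: a; b; c] by rewrite !inE eqxx.
have bT : b \in [:: a; b; c] by rewrite !inE eqxx orbT.
have cT : c \in [:: a; b; c] by rewrite !inE eqxx !orbT.
have outside s t : s \in [:: a; b; c] -> t \in [:: a; b; c] ->
    exists i, [/\ i \notin [:: a; b; c], ~~ H i s & ~~ H i t].
  move=> sT tT; pose N u := [set i | (i \notin [:: a; b; c]) && H u i].
  have N1 u : u \in [:: a; b; c] -> (#|N u| <= 1)%N.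
    move=> uT; apply/card_le1_eqP => i j; rewrite !inE => /andP[iT ui] /andP[jT uj].
    by apply: (lone u) => //; rewrite !inE.
  pose U := [set x in [:: a; b; c]] :|: (N s :|: N t).
  have U5 : (#|U| <= 5)%N.
    apply: leq_trans (leq_card_setU _ _) _; apply: (@leq_add _ _ 3 2).
      by rewrite cardsE card_size.
    by apply: leq_trans (leq_card_setU _ _) _; apply: (@leq_add _ _ 1 1); apply: N1.
  have [i iU] : exists i, i \in ~: U.
    apply/finset.set0Pn; rewrite -card_gt0 cardsCs finset.setCK card_ord subn_gt0.
    by apply: leq_ltn_trans U5 _.
  rewrite finset.in_setC in iU.
  have iT : i \notin [:: a; b; c] by apply: contra iU => iT; rewrite finset.in_setU inE iT.
  have NE u : (i \in N u) = H u i by rewrite inE iT.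
  exists i; split=> //; apply: contra iU => h.
    by rewrite !finset.in_setU NE edge_sym h orbT.
  by rewrite !finset.in_setU !NE [H t i]edge_sym h !orbT.
pose x i := (f i).1.1; pose y i := (f i).1.2; pose z i := (f i).2.
have notT i j : i \notin [:: a; b; c] -> j \in [:: a; b; c] -> i != j by move=> iT jT; apply: contraNneq iT => ->.
have xH i : i != a -> (x i == 0) = H i a.
  by move=> ia; rewrite -rep // fa /dot /= !mulr0 !addr0 mulr1.
have yH i : i != b -> (y i == 0) = H i b.
  by move=> ib; rewrite -rep // fb /dot /= !mulr0 addr0 add0r mulr1.
have zH i : i != c -> (z i == 0) = H i c.
  by move=> ic; rewrite -rep // fc /dot /= !mulr0 !add0r mulr1.
(* the entries of N off the diagonal, as polynomials in the common parameter: at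
   most two of the at least three outer vertices are adjacent to s or t, and a
   further one gives a nonzero coefficient *)
have pol_nz (u v : 'I_n -> R) s t : s \in [:: a; b; c] -> t \in [:: a; b; c] ->
    (forall i, i != s -> (u i == 0) = H i s) -> (forall i, i != t -> (v i == 0) = H i t) ->
    \sum_(i < n) (u i * v i) *: 'X^i != 0 :> {poly R}.
  move=> sT tT us vt; have [k [kT ks kt]] := outside s t sT tT.
  apply/negP => /eqP/polyP/(_ k); rewrite coef0 coef_sum (bigD1 k) //= big1 => [|i ik].
    rewrite addr0 coefZ coefXn eqxx mulr1 => /eqP; rewrite mulf_eq0 us ?vt ?(notT k) //.
    by rewrite (negPf ks) (negPf kt).
  by rewrite coefZ coefXn (inj_eq val_inj) eq_sym (negPf ik) mulr0.
have [sg sg0] := non_root_ex (mulf_neq0 (mulf_neq0 (pol_nz _ _ _ _ aT bT xH yH) (pol_nz _ _ _ _ aT cT xH zH)) (pol_nz _ _ _ _ bT cT yH zH)).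
have hs (u v : 'I_n -> R) : (\sum_(i < n) (u i * v i) *: 'X^i).[sg] = \sum_(i < n) sg ^+ i * (u i * v i).
  by rewrite horner_sum; apply: eq_bigr => i _; rewrite hornerZ hornerXn mulrC.
pose S (u v : 'I_n -> R) := \sum_(i < n) sg ^+ i * (u i * v i).
rewrite !hornerM !hs -!/(S _ _) !mulf_eq0 !negb_or -andbA => /and3P[mxy mxz myz].
pose g1 := S x y * S x z; pose g2 := S x y * S y z; pose g3 := S x z * S y z.
pose rho := (S x y * S x z * S y z)^-1.
have n12 : rho * g1 * g2 = S x y by rewrite /rho /g1 /g2; field; rewrite ?mxy ?mxz ?myz.
have n13 : rho * g1 * g3 = S x z by rewrite /rho /g1 /g3; field; rewrite ?mxy ?mxz ?myz.
have n23 : rho * g2 * g3 = S y z by rewrite /rho /g2 /g3; field; rewrite ?mxy ?mxz ?myz.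
pose D (u : 'I_n -> R) (s : 'I_n) := \sum_(i < n | i != s) sg ^+ i * (u i * u i).
have D0 u s : 0 <= D u s.
  by apply: sumr_ge0 => i _; rewrite mulr_ge0 ?(exprn_ge0 _ (ltW sg0)) // -expr2 sqr_ge0.
pose al := 1 + `|rho| * (g1 ^+ 2 + g2 ^+ 2 + g3 ^+ 2) + (D x a + D y b + D z c).
have rho_le g : g ^+ 2 <= g1 ^+ 2 + g2 ^+ 2 + g3 ^+ 2 -> - (rho * g ^+ 2) <= `|rho| * (g1 ^+ 2 + g2 ^+ 2 + g3 ^+ 2).
  move=> gle; apply: le_trans (ler_wpM2l (normr_ge0 _) gle).
  by rewrite -mulNr ler_wpM2r ?sqr_ge0 // -normrN ler_norm.
have [w1 w2 w3] : [/\ 0 < al + rho * g1 ^+ 2 - D x a, 0 < al + rho * g2 ^+ 2 - D y b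
    & 0 < al + rho * g3 ^+ 2 - D z c].
  rewrite /al; move: (g1) (g2) (g3) rho_le (D0 x a) (D0 y b) (D0 z c) => h1 h2 h3 le d1 d2 d3.
  have [s1 s2 s3] := le_sum_squares h1 h2 h3; split; apply: positive_gap; rewrite ?le //.
  - by rewrite -addrA lerDl addr_ge0.
  - by rewrite addrAC lerDr addr_ge0.
  - by rewrite lerDr addr_ge0.
(* the squared scaling factors; those of a, b and c adjust the diagonal of N *)
pose W (i : 'I_n) : R := if i == a then al + rho * g1 ^+ 2 - D x a else
  if i == b then al + rho * g2 ^+ 2 - D y b else
  if i == c then al + rho * g3 ^+ 2 - D z c else sg ^+ i.
have W0 i : 0 < W i by rewrite /W; do 3?case: ifP => _ //; rewrite exprn_gt0.
have coord : [/\ x b = 0 /\ x c = 0, y a = 0 /\ y c = 0 & z a = 0 /\ z b = 0].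
  by rewrite /x /y /z fa fb fc.
case: coord => -[xb xc] [ya yc] [za zb].
have [xa yb zc] : [/\ x a = 1, y b = 1 & z c = 1] by rewrite /x /y /z fa fb fc.
have off (u v : 'I_n -> R) : u a * v a = 0 -> u b * v b = 0 -> u c * v c = 0 ->
    \sum_(i < n) W i * (u i * v i) = S u v.
  move=> ua ub uc; apply: eq_bigr => i _; rewrite /W.
  case: eqP => [->|_]; first by rewrite ua !mulr0.
  case: eqP => [->|_]; first by rewrite ub !mulr0.
  by case: eqP => [->|_] //; rewrite uc !mulr0.
have diag (u : 'I_n -> R) s : u s = 1 -> (forall i, i \in [:: a; b; c] -> i != s -> u i = 0) ->
    \sum_(i < n) W i * (u i * u i) = W s + D u s.
  move=> us u0; rewrite (bigD1 s) //= us !mulr1; congr (_ + _).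
  apply: eq_bigr => i ia; have [iT|iT] := boolP (i \in [:: a; b; c]).
    by rewrite u0 // mul0r !mulr0.
  by rewrite /W; move: iT; rewrite !inE !negb_or => /and3P[/negPf -> /negPf -> /negPf ->].
have ab' := edge_neq ab; have ac' := edge_neq ac; have bc' := edge_neq bc.
have M11 : \sum_(i < n) W i * (x i * x i) = al + rho * g1 ^+ 2.
  rewrite (diag x a) // => [|i]; first by rewrite /W eqxx subrK.
  by rewrite !inE => /or3P[]/eqP-> //; rewrite eqxx.
have M22 : \sum_(i < n) W i * (y i * y i) = al + rho * g2 ^+ 2.
  rewrite (diag y b) // => [|i]; first by rewrite /W eq_sym (negPf ab') eqxx subrK.
  by rewrite !inE => /or3P[]/eqP-> //; rewrite eqxx.
have M33 : \sum_(i < n) W i * (z i * z i) = al + rho * g3 ^+ 2.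
  rewrite (diag z c) // => [|i].
    by rewrite /W eq_sym (negPf ac') eq_sym (negPf bc') eqxx subrK.
  by rewrite !inE => /or3P[]/eqP-> //; rewrite eqxx.
have M12 : \sum_(i < n) W i * (x i * y i) = rho * g1 * g2.
  by rewrite n12 off // ?ya ?xb ?xc ?mul0r ?mulr0.
have M13 : \sum_(i < n) W i * (x i * z i) = rho * g1 * g3.
  by rewrite n13 off // ?za ?xb ?xc ?mul0r ?mulr0.
have M23 : \sum_(i < n) W i * (y i * z i) = rho * g2 * g3.
  by rewrite n23 off // ?ya ?zb ?yc ?mul0r ?mulr0.
pose A : 'M[R]_n := \matrix_(i, j) (Num.sqrt (W i) * Num.sqrt (W j) * dot (f i) (f j)).
have HA : matrix_of (compl H) A.
  split; first by apply/matrixP => i j; rewrite !mxE dotC [_ * Num.sqrt _]mulrC.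
  move=> i j ij; rewrite mxE /= /compl_rel ij /= -rep //.
  by rewrite !mulf_eq0 !sqrtr_eq0 !leNgt !W0.
apply: leq_trans (q_le HA) _.
apply: (@q_mx_le_seq _ _ _ [:: 0; al; al + rho * (g1 ^+ 2 + g2 ^+ 2 + g3 ^+ 2)]) => t v v0 vA.
(* co x, co y, co z are the coordinates of the combination of the scaled vectors
   with coefficients v, an eigenvector of N or zero *)
pose s i := Num.sqrt (W i).
have ss i : s i * s i = W i by rewrite -expr2 sqr_sqrtr // ltW.
pose co (u : 'I_n -> R) := \sum_(i < n) v 0 i * s i * u i.
have tv j : t * v 0 j = s j * (co x * x j + co y * y j + co z * z j).
  have /rowP/(_ j) := vA; rewrite [RHS]mxE => <-; rewrite mxE /co !mulr_suml -!big_split mulr_sumr.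
  by apply: eq_bigr => i _; rewrite mxE /dot /s /x /y /z /=; ring.
have tco u : t * co u = co x * (\sum_(i < n) W i * (x i * u i)) + co y * (\sum_(i < n) W i * (y i * u i))
    + co z * (\sum_(i < n) W i * (z i * u i)).
  rewrite {1}/co mulr_sumr !mulr_sumr -!big_split; apply: eq_bigr => i _ /=.
  by rewrite -[v 0 i * _ * _]mulrA mulrA tv -!ss; ring.
have sumC (u w : 'I_n -> R) : \sum_(i < n) W i * (u i * w i) = \sum_(i < n) W i * (w i * u i).
  by apply: eq_bigr => i _; rewrite (mulrC (u i)).
pose l := g1 * co x + g2 * co y + g3 * co z.
have t1 : (t - al) * co x = rho * g1 * l.
  by rewrite mulrBl tco M11 (sumC y) M12 (sumC z) M13 /l; ring.
have t2 : (t - al) * co y = rho * g2 * l.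
  by rewrite mulrBl tco M22 M12 (sumC z) M23 /l; ring.
have t3 : (t - al) * co z = rho * g3 * l.
  by rewrite mulrBl tco M33 M13 M23 /l; ring.
rewrite !inE; have [//|t0] := eqVneq t 0; have [//|tal] /= := eqVneq t al.
rewrite -subr_eq0 in tal.
have l0 : l != 0.
  apply/negP => /eqP l0; move/eqP: v0; apply; apply/rowP => j; rewrite [RHS]mxE.
  have z0 r : (t - al) * r = 0 -> r = 0 by move/eqP; rewrite mulf_eq0 (negPf tal) => /eqP.
  have x0 : co x = 0 by apply: z0; rewrite t1 l0 mulr0.
  have y0 : co y = 0 by apply: z0; rewrite t2 l0 mulr0.
  have z00 : co z = 0 by apply: z0; rewrite t3 l0 mulr0.
  have := tv j; rewrite x0 y0 z00 !mul0r !addr0 mulr0 => /eqP.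
  by rewrite mulf_eq0 (negPf t0) => /eqP.
rewrite -subr_eq0; apply/eqP/(mulIf l0); rewrite mul0r opprD addrA mulrBl.
have -> : (t - al) * l = g1 * ((t - al) * co x) + g2 * ((t - al) * co y) + g3 * ((t - al) * co z).
  by rewrite /l; ring.
by rewrite t1 t2 t3; ring.
Qed.

End RepresentationMatrix.

(** * Graphs whose complement has small rank *)

Section LowRank.
Variable R : realType.
Implicit Types (n : nat).

(** The isolated vertex repeats an eigenvalue of the rest. *)
Lemma isolated_vertex_q n k (G : sgraph n) (G' : sgraph k) : k = 1 ->
  (q R (gunion G G') <= maxn 1 (q R G))%N.
Proof.
move=> k1; subst k; have [A GA qA] := q_attained R G.
pose l := head 0%R (spec A).
have G'l : matrix_of G' (l%:M : 'M[R]_1).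
  by split; [rewrite tr_scalar_mx | move=> i j; rewrite !ord1 eqxx].
have qle := q_le (matrix_of_gunion GA G'l); apply: (leq_trans qle).
have -> : maxn 1 (q R G) = size (if spec A is [::] then [:: l] else spec A).
  by rewrite -qA -size_spec; case: (spec A) => //= x s; apply/maxn_idPr.
apply: q_mx_le_seq => t v v0 /(block_eigenvector v0)[|/eigenvalueP[u uE u0]].
  by rewrite -mem_spec; case: (spec A) => //.
have -> : t = l.
  move: uE; rewrite mul_mx_scalar => /eqP; rewrite -subr_eq0 -scalerBl scaler_eq0 (negPf u0) orbF.
  by rewrite subr_eq0 => /eqP.
by rewrite /l; case: (spec A) => [|x s]; rewrite !inE eqxx.
Qed.

(** If q(H) exceeds n - 2, then H has no long cycle, no two disjoint triangles
    and no triangle with two more edges at a vertex. Hence a triangle is the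
    only one, each of its vertices has at most one neighbour outside, and each
    outer vertex has at most one neighbour in it. *)
Section Triangle.
Variables (n : nat) (H : sgraph n).
Hypothesis qH : ~ (q R H + 2 <= n)%N.

Lemma cycles_short s : uniq s -> cycle H s -> (size s <= 3)%N.
Proof.
by move=> us cs; rewrite leqNgt; apply/negP => s4; apply: qH; apply: long_cycle_q us cs s4.
Qed.

Variables (a b c : 'I_n).
Hypotheses (ab : H a b) (bc : H b c) (ac : H a c).
Local Notation triangle := [:: a; b; c].

(** The three vertices of the triangle play the same role. *)
Lemma triangle_rotate t : t \in triangle ->
  exists u w, [/\ H t u, H t w, H u w & triangle =i [:: t; u; w]].
Proof.
have sab : H b a by rewrite edge_sym.
have sbc : H c b by rewrite edge_sym.
have sac : H c a by rewrite edge_sym.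
rewrite !inE => /or3P[]/eqP->; [exists b, c|exists a, c|exists a, b]; split=> // x; rewrite !inE.
  by rewrite orbCA.
by rewrite orbA orbC.
Qed.

Lemma one_outer_neighbour t x y : t \in triangle -> x \notin triangle -> y \notin triangle ->
  H t x -> H t y -> x = y.
Proof.
move=> tT xT yT tx ty; apply/eqP/negPn/negP => xy; apply: qH.
have [u [w [tu tw uw TE]]] := triangle_rotate tT.
move: xT yT; rewrite !TE !inE !negb_or => /and3P[_ xu xw] /and3P[_ yu yw].
apply: (cricket_q R (a0 := t) (b := u) (c := w) (d := x) (e := y)) => //.
by rewrite /= !inE !negb_or (edge_neq uw) !(eq_sym u) !(eq_sym w) xu xw yu yw xy.
Qed.

Lemma one_inner_neighbour x s t : x \notin triangle -> s \in triangle -> t \in triangle ->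
  H x s -> H x t -> s = t.
Proof.
move=> xT sT tT xs xt; apply/eqP/negPn/negP => st; apply: qH.
have [u [w [su sw uw TE]]] := triangle_rotate sT.
move: xT tT; rewrite !TE !inE !negb_or => /and3P[_ xu xw].
rewrite eq_sym (negPf st) /= => /orP[]/eqP tE; subst t.
  apply: (four_cycle_q R xs sw _ _ xw st); by rewrite edge_sym.
by apply: (four_cycle_q R xs su uw _ xu st); rewrite edge_sym.
Qed.

Lemma one_triangle x y z : H x y -> H y z -> H x z -> x \in triangle.
Proof.
move=> xy yz xz; apply/negPn/negP => xT.
have yx : H y x by rewrite edge_sym.
have zx : H z x by rewrite edge_sym.
have zy : H z y by rewrite edge_sym.
have [yT|yT] := boolP (y \in triangle); have [zT|zT] := boolP (z \in triangle).
- by have := edge_neq yz; rewrite (one_inner_neighbour xT yT zT xy xz) eqxx.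
- by have := edge_neq xz; rewrite (one_outer_neighbour yT xT zT yx yz) eqxx.
- by have := edge_neq xy; rewrite (one_outer_neighbour zT xT yT zx zy) eqxx.
apply: qH; apply: (two_triangles_q R _ ab bc ac xy yz xz).
move: xT yT zT; rewrite !inE !negb_or => /and3P[xa xb xc] /and3P[ya yb yc] /and3P[za zb zc].
rewrite /= !inE !negb_or (edge_neq ab) (edge_neq ac) (edge_neq bc) (edge_neq xy) (edge_neq xz)
  (edge_neq yz) (eq_sym a x) (eq_sym a y) (eq_sym a z) (eq_sym b x) (eq_sym b y) (eq_sym b z)
  (eq_sym c x) (eq_sym c y) (eq_sym c z).
by rewrite xa xb xc ya yb yc za zb zc.
Qed.

End Triangle.

(** If the bound fails then q(H) is at least n - 1, and H has a unique triangle
    as above. H is connected: two parts with at least two vertices each give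
    q(H) <= n - 2, and so does an isolated vertex, as it repeats an eigenvalue
    of the rest, which has a triangle. With at least six vertices the orthogonal
    representation gives q at most 3 for the complement. With at most five, two
    outer vertices must be nonadjacent, lest the complement be bipartite, with
    the triangle and the rest as classes; they hang on different vertices of the
    triangle, and the complement is T_{2,2}. *)
Lemma non_bipartite_bound n (H : sgraph n) : ~ bipartite H -> ~ bipartite (compl H) ->
  (q R (compl H) <= 4)%N ->
  (q R H + q R (compl H) <= n + 2)%N \/ isog (compl H) T22.
Proof.
move=> nH nF q4; have [//|nb] := leqP (q R H + q R (compl H)) (n + 2); [by left|right].
have qH := bound_fails_q4 nb q4.
have short := cycles_short qH.
have [s [us cs s3]] : exists s, [/\ uniq s, cycle H s & (2 < size s)%N].
  apply: contrapT => none; apply: nH; apply: acyclic_bipartite => s us cs.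
  by rewrite ltnNge; apply/negP => s3; apply: none; exists s.
have s3' := short s us cs.
case: s s3 s3' us cs => [|a [|b [|c [|]]]] // _ _ abc /= /and4P[ab bc ca _].
have ac : H a c by rewrite edge_sym.
have [[C sep]|con] := pselect (exists C, separated H C).
  exfalso; have [G1 [G2 [iso [C0 C1 CE]]]] := separated_gunion sep.
  have key m k (G : sgraph m) (G' : sgraph k) : isog (gunion G G') H -> m + k = n -> k = 1 -> False.
    move=> iso' mk k1; apply: qH; rewrite -(q_isog R iso'); subst k.
    have := isolated_vertex_q G G' erefl.
    have [g _ gE] := isog_sym iso'.
    have left x y : gunion G G' x y -> exists x', x = lshift 1 x'.
      case: (fintype.split_ordP x) => [x' ->|x' ->]; first by exists x'.
      case: (fintype.split_ordP y) => [y' ->|y' ->]; rewrite gunionE //.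
      by rewrite (ord1 x') (ord1 y') edge_irr.
    have := gE a b; have := gE b c; have := gE a c; rewrite ab bc ac => ac' bc' ab'.
    have [x xE] := left _ _ ab'; have [y yE] := left _ _ bc'.
    rewrite edge_sym in ac'; have [z zE] := left _ _ ac'.
    move: ab' bc' ac'; rewrite xE yE zE !gunionE => xy yz zx.
    rewrite edge_sym in zx; have := triangle_q R xy yz zx.
    have x3 : (2 < m)%N.
      have xyz : uniq [:: x; y; z].
        by rewrite /= !inE !negb_or (edge_neq xy) (edge_neq yz) (edge_neq zx).
      rewrite -[m in (_ < m)%N](size_enum_ord m).
      by apply: (uniq_leq_size xyz) => ? _; rewrite mem_enum.
    by move: mk x3; clear; lia.
  have qG := gunion_q_le R G1 G2; rewrite (q_isog R iso) in qG.
  case: (bound_fails_union_q4 qG CE nb q4 C0 C1) => [c1|]; last exact: key iso CE.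
  by apply: (key _ _ _ _ (isog_trans (isog_gunionC G2 G1) iso)); rewrite // addnC.
have {}con : connectedg H by move=> C sep; apply: con; exists C.
have [n6|n5] := leqP 6 n.
  have q3 : (q R (compl H) <= 3)%N.
    apply: (representation_q R n6 con ab bc ac short).
      exact: (one_triangle qH ab bc ac).
    exact: (one_outer_neighbour qH ab bc ac).
  by case: (bound_fails_q3 nb q3); apply: triangle_q ab bc ac.
(* if the outer vertices were pairwise adjacent, the triangle and the rest would
   be colour classes of the complement *)
have [x [y [xT yT xy nxy]]] : exists x y, [/\ x \notin [:: a; b; c], y \notin [:: a; b; c],
    x != y & ~~ H x y].
  apply: contrapT => none; apply: nF; exists (fun i => i \in [:: a; b; c]) => i j.
  rewrite /= /compl_rel => /andP[ij nij]; apply/negP => /eqP.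
  have [iT|iT] := boolP (i \in _) => /esym jT.
    move: nij; have [u [w [iu iw uw TE]]] := triangle_rotate ab bc ac iT.
    by move: jT; rewrite TE !inE => /or3P[]/eqP je; move: ij; rewrite je ?eqxx ?iu ?iw.
  by apply: none; exists i, j; rewrite jT.
have all_in i : i \in [:: x; y; a; b; c].
  apply/negPn/negP => iN.
  have : (size [:: i; x; y; a; b; c] <= n)%N.
    rewrite -[n in (_ <= n)%N](size_enum_ord n); apply: uniq_leq_size.
      rewrite cons_uniq iN; move: xT yT abc; rewrite /= !inE !negb_or xy.
      by do 2!move=> /and3P[-> -> ->].
    by move=> ? _; rewrite mem_enum.
  by rewrite /= leqNgt n5.
have n1 : (1 < n)%N.
  by move: (edge_neq ab) (ltn_ord a) (ltn_ord b); rewrite -(inj_eq val_inj) /=; clear; lia.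
have inner u v : u \notin [:: a; b; c] -> ~~ H u v -> (forall i, i \in [:: u; v; a; b; c]) ->
    exists2 s, s \in [:: a; b; c] & H u s.
  move=> uT uv all'; have [s us] := neighbour_ex u con n1.
  exists s => //; have := all' s; rewrite [_ \in _]inE => /orP[/eqP su|].
    by rewrite su edge_irr in us.
  by rewrite inE => /orP[/eqP sv|//]; move: uv; rewrite -sv us.
have [s sT xs] := inner x y xT nxy all_in.
have [t tT yt] : exists2 t, t \in [:: a; b; c] & H y t.
  apply: (inner y x) => //; first by rewrite edge_sym.
  by move=> i; have := all_in i; rewrite !inE orbCA.
have st : s != t.
  apply: contra xy => /eqP st; apply/eqP; apply: (one_outer_neighbour qH ab bc ac sT xT yT).
    by rewrite edge_sym.
  by rewrite st edge_sym.
have [t' [u [st' su t'u TE]]] := triangle_rotate ab bc ac sT.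
have [w [sw tw TE']] : exists w, [/\ H s w, H t w & [:: a; b; c] =i [:: s; t; w]].
  move: (tT); rewrite TE !inE eq_sym (negPf st) /= => /orP[]/eqP->; [exists u | exists t']; split=> //.
    by rewrite edge_sym.
  by move=> i; rewrite TE !inE; congr (_ || _); rewrite orbC.
have sxT i : i \in [:: a; b; c] -> i != s -> H x i = false.
  move=> iT /eqP ni; apply/negP => xi; apply: ni.
  exact: (one_inner_neighbour qH ab bc ac xT iT sT).
have syT i : i \in [:: a; b; c] -> i != t -> H y i = false.
  move=> iT /eqP ni; apply/negP => xi; apply: ni.
  exact: (one_inner_neighbour qH ab bc ac yT iT tT).
have wT : w \in [:: a; b; c] by rewrite TE' !inE eqxx !orbT.
have ws : w != s by rewrite eq_sym (edge_neq sw).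
have wt : w != t by rewrite eq_sym (edge_neq tw).
have ts : t != s by rewrite eq_sym.
have xw := sxT w wT ws; have xt := sxT t tT ts.
have yw := syT w wT wt; have ys := syT s sT st.
have stH : H s t.
  have [t1 [u1 [h1 h2 h3 E]]] := triangle_rotate ab bc ac sT.
  by move: tT; rewrite E !inE (negPf ts) /= => /orP[]/eqP->.
move: (xT) (yT); rewrite !TE' !inE !negb_or => /and3P[nxs nxt nxw] /and3P[nys nyt nyw].
apply: (isog_of_seq (x0 := x) (s := [:: t; x; w; y; s])) => //.
- by rewrite /= !inE !negb_or (eq_sym t x) nxt (eq_sym t w) wt (eq_sym t y) nyt ts nxw xy nxs
    (eq_sym w y) nyw ws nys.
- by move=> i; have := all_in i; rewrite inE [i \in _ :: _]inE TE' !inE => /or4P[|||/orP[]] ->; rewrite ?orbT.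
have wt' : t != w by rewrite eq_sym.
have ts' : H t s by rewrite edge_sym.
have ws' : H w s by rewrite edge_sym.
have sym_of i j e : H i j = e -> (H i j = e) * (H j i = e) by move=> ije; rewrite [H j i]edge_sym.
have ne_of (i j : 'I_n) : i != j -> ((i == j) = false) * ((j == i) = false).
  by move=> ij; rewrite [j == i]eq_sym (negPf ij).
have Hval := (sym_of _ _ _ xt, sym_of _ _ _ xw, sym_of _ _ _ (negPf nxy), sym_of _ _ _ xs, sym_of _ _ _ yt, sym_of _ _ _ yw, sym_of _ _ _ ys, sym_of _ _ _ tw, sym_of _ _ _ ts', sym_of _ _ _ ws').
have nval := (ne_of _ _ nxt, ne_of _ _ nxw, ne_of _ _ xy, ne_of _ _ nxs, ne_of _ _ nyt, ne_of _ _ nyw, ne_of _ _ nys, ne_of _ _ wt', ne_of _ _ ts, ne_of _ _ ws).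
by case=> [[|[|[|[|[|i]]]]] Hi] [[|[|[|[|[|j]]]]] Hj] //=;
  rewrite /T22_rel /compl_rel /= /path_rel /= ?eqxx ?nval ?Hval.
Qed.

End LowRank.

(** * The three families *)

(** P_4 and T_{2,2} are self-complementary, so the exceptions form a set which
    is closed under complements, as the families are. *)
Lemma compl_P4 : isog (compl (pathg 4)) (pathg 4).
Proof.
apply: (@isog_of_seq _ _ _ _ ord0 [:: @Ordinal 4 1 isT; @Ordinal 4 3 isT; @Ordinal 4 0 isT; @Ordinal 4 2 isT]) => //.
  by case=> -[|[|[|[|i]]]].
by case=> [[|[|[|[|i]]]] Hi] [[|[|[|[|j]]]] Hj].
Qed.

Lemma compl_T22 : isog (compl T22) T22.
Proof.
apply: (@isog_of_seq _ _ _ _ ord0 [:: @Ordinal 5 3 isT; @Ordinal 5 0 isT; @Ordinal 5 2 isT;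
  @Ordinal 5 4 isT; @Ordinal 5 1 isT]) => //.
  by case=> -[|[|[|[|[|i]]]]].
by case=> [[|[|[|[|[|i]]]]] Hi] [[|[|[|[|[|j]]]]] Hj].
Qed.

Definition exceptional n (F : sgraph n) :=
  [\/ isog F (pathg 4), isog F (pathg 5), isog F (compl (pathg 5)) | isog F T22].

Lemma exceptional_compl n (F : sgraph n) : exceptional (compl F) -> exceptional F.
Proof.
have back m (G : sgraph m) : isog (compl F) G -> isog F (compl G).
  by move/isog_compl; apply: isog_trans; apply: isog_compl_compl.
case=> /back iso.
- by apply: Or41; apply: isog_trans iso compl_P4.
- exact: Or43.
- by apply: Or42; apply: isog_trans iso (isog_sym (isog_compl_compl _)).
- by apply: Or44; apply: isog_trans iso compl_T22.
Qed.

Section Families.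
Variable R : realType.
Implicit Types (n : nat).

Lemma q_compl_compl n (F : sgraph n) : q R (compl (compl F)) = q R F.
Proof. exact/esym/q_isog/isog_compl_compl. Qed.

Lemma bipartite_case n (F : sgraph n) : bipartite F ->
  (q R F + q R (compl F) <= n + 2)%N \/ exceptional F.
Proof.
case/(bipartite_bound R) => [|[]]; [by left| by right; apply: Or41|by right; apply: Or42].
Qed.

Lemma compl_case n (F : sgraph n) :
  (q R (compl F) + q R (compl (compl F)) <= n + 2)%N \/ exceptional (compl F) ->
  (q R F + q R (compl F) <= n + 2)%N \/ exceptional F.
Proof. by rewrite q_compl_compl addnC => -[|/exceptional_compl]; auto. Qed.

(** A matrix of rank at most 3 has at most four distinct eigenvalues, so that
    q(F) is at most 4. *)
Lemma low_rank_case n (F : sgraph n) : (min_rank R F <= 3)%N ->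
  (q R F + q R (compl F) <= n + 2)%N \/ exceptional F.
Proof.
move=> rF; have [bF|nF] := pselect (bipartite F); first exact: bipartite_case.
have [bH|nH] := pselect (bipartite (compl F)); first exact/compl_case/bipartite_case.
have q4 : (q R (compl (compl F)) <= 4)%N.
  have [A GA rA] := @min_overP R n F (fun A => \rank A).
  rewrite q_compl_compl; apply: leq_trans (q_le GA) _; apply: leq_trans (q_mx_le_rank A) _.
  by rewrite rA.
have nF' : ~ bipartite (compl (compl F)).
  move=> [c cP]; apply: nF; exists c => i j Fij; apply: cP.
  by rewrite /= /compl_rel /= /compl_rel (edge_neq Fij) Fij.
have [|iso] := non_bipartite_bound nH nF' q4.
  by rewrite q_compl_compl addnC; left.
by right; apply: Or44; apply: isog_trans iso; apply: isog_compl_compl.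
Qed.

Lemma family_dichotomy n (F : sgraph n) : in_families R F ->
  (q R F + q R (compl F) <= n + 2)%N \/ exceptional F.
Proof.
case=> [[|]|[|]|[m [k [G [H [mk km [] iso]]]]]].
- exact: bipartite_case.
- by move/bipartite_case/compl_case.
- exact: low_rank_case.
- by move/low_rank_case/compl_case.
- left; rewrite (q_isog R iso) (q_isog R (isog_compl iso)) (isog_size iso).
  by rewrite (q_isog R (isog_compl_gjoin G H)) addnC; apply: union_join_q.
left; rewrite (q_isog R iso) (q_isog R (isog_compl iso)) (isog_size iso).
by rewrite (q_isog R (isog_compl_gunion G H)); apply: union_join_q.
Qed.

End Families.

Theorem corollary5p5 (R : realType) (n : nat) (F : sgraph n) :
  in_families R F ->
  ((q R F + q R (compl F) <= n + 2)%N <->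
  ~ [\/ isog F (pathg 4), isog F (pathg 5), isog F (compl (pathg 5))
      | isog F T22]).
Proof.
move=> famF; split=> [le /(exceptions_q R)|]; first by rewrite ltnNge le.
by case: (family_dichotomy famF) => // exc /(_ exc).
Qed.
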